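(* Assume there are $C,c>0$ with $C|\xi|^p\le L_x(\xi)\le c(1+|\xi|^p)$ for all $\xi\in\mathbb M^{m\times N}$ and $\mu$-a.a. $x\in X$, and assume: (C$_0$) for every $u\in W^{1,p}_\mu(X;\mathbb R^m)$ and every $A\in\mathcal O(X)$, if $u=0$ $\mu$-a.e. on $A$ then $\nabla_\mu u=0$ $\mu$-a.e. on $A$; (C$_1$) there exist $K>0$, $\chi\ge1$, $\rho_0>0$ such that for all $x\in X$, all $0<\rho\le\rho_0$ and all $v\in W^{1,p}_{\mu,0}(Q_\rho(x);\mathbb R^m)$, $\big(\int_{Q_\rho(x)}|v|^{\chi p}d\mu\big)^{1/(\chi p)}\le\rho K\big(\int_{Q_\rho(x)}|\nabla_\mu v|^pd\mu\big)^{1/p}$; (C$_2$) for every $A\subset X$ and every family $\mathcal F$ of closed balls in $X$ with $\inf\{\rho>0:\overline Q_\rho(x)\in\mathcal F\}=0$ for all $x\in A$, there is a countable disjoint subfamily $\mathcal G\subset\mathcal F$ with $\mu(A\setminus\bigcup_{Q\in\mathcal G}Q)=0$. Then for all $u\in W^{1,p}_\mu(X;\mathbb R^m)$ and $\mu$-a.a. $x\in X$, $$\lambda_u(x)=\lim_{\rho\to0}\inf\Big\{{-}\!\!\!\!\!\!\int_{Q_\rho(x)}\widehat L_y(\nabla_\mu v(y))d\mu(y): v-u\in W^{1,p}_{\mu,0}(Q_\rho(x);\mathbb R^m)\Big\} =\lim_{\rho\to0}\inf\Big\{{-}\!\!\!\!\!\!\int_{Q_\rho(x)}\widehat L_y(\nabla_\mu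 u(y)+\nabla_\mu w(y))d\mu(y): w\in W^{1,p}_{\mu,0}(Q_\rho(x);\mathbb R^m)\Big\},$$ where $\lambda_u(x):=\lim_{\rho\to0}\overline E(u;Q_\rho(x))/\mu(Q_\rho(x))$.
   Context: Let $(X,d)$ be a separable compact metric space and $\mu$ a positive Radon measure on $X$. $\mathcal O(X)$ denotes the open subsets of $X$, $Q_\rho(x)=\{y:d(x,y)<\rho\}$, $\overline Q_\rho(x)=\{y:d(x,y)\le\rho\}$, $\partial Q_\rho(x)=\{y:d(x,y)=\rho\}$, $\mathrm{supp}(\mu)$ the smallest closed set of full measure, ${-}\!\!\!\!\!\int_Bf\,d\mu=\mu(B)^{-1}\int_Bf\,d\mu$. Let $\mathcal A(X)$ be a subalgebra of $C(X)$ with $1\in\mathcal A(X)$ having the Urysohn property: for all $K\subset V\subset X$, $K$ compact, $V$ open, there is $\varphi\in\mathcal A(X)$ with $0\le\varphi\le1$, $\varphi=0$ on $X\setminus V$, $\varphi=1$ on $K$. For $A\subset X$, $\varepsilon>0$ let $A^-(\varepsilon)=\{x:\mathrm{dist}(x,A)\le\varepsilon\}$, $A^+(\varepsilon)=\{x:\mathrm{dist}(x,A)\ge\varepsilon\}$; $\mathcal K(X)$ is the class of sets which are either $A^\pm(\varepsilon)$ with $A$ open, or $\overline Q_\rho(x)$ with $\mu(\partial Q_\rho(x))=0$. Let $N\ge1$ and $D:\mathcal A(X)\to L^\infty_\mu(X;\mathbb R^N)$ be linear with $D(fg)=fDg+gDf$ and such that if $f\in\mathcal A(X)$ is constant on $K\in\mathcal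 K(X)$ then $Df=0$ $\mu$-a.e. on $K$. Let $m\ge1$, $\mathcal A(X;\mathbb R^m)=\mathcal A(X)^m$, $\mathbb M^{m\times N}$ real $m\times N$ matrices with Euclidean inner product and norm, $\nabla u$ the matrix with rows $Du_1,\dots,Du_m$. $\mathcal A^m_0=\{v\in\mathcal A(X;\mathbb R^m):v=0\text{ on }\mathrm{supp}(\mu)\}$, $\mathcal H^m_0=\{w\in L^\infty_\mu(X;\mathbb M^{m\times N}):w=\nabla v\ \mu\text{-a.e., }v\in\mathcal A^m_0\}$; for $\mu$-a.e. $x$, $N^m_\mu(x)=\{w(x):w\in\mathcal H^m_0\}$, $T^m_\mu(x)$ its orthogonal complement, $P^m_\mu(x)$ the orthogonal projection onto $T^m_\mu(x)$, $\nabla_\mu u(x)=P^m_\mu(x)(\nabla u(x))$. For $p\in]1,\infty[$, $W^{1,p}_\mu(X;\mathbb R^m)$ is the completion of $\mathcal A(X;\mathbb R^m)$ for $\|u\|_{L^p_\mu}+\|\nabla_\mu u\|_{L^p_\mu}$, with $\nabla_\mu$ extended by continuity; for $A\in\mathcal O(X)$, $W^{1,p}_{\mu,0}(A;\mathbb R^m)$ is the closure in this norm of $\{u\in\mathcal A(X;\mathbb R^m):u=0\text{ on }X\setminus A\}$. $\{L_x\}$ is a field of Carathéodory integrands ($L_x:\mathbb M^{m\times N}\to[0,\infty]$ continuous for $\mu$-a.e. $x$, $x\mapsto L_x(\xi)$ $\mu$-measurable). $E(u;A)=\int_AL_x(\nabla u)d\mu$ for $u\in\mathcal A(X;\mathbb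 R^m)$; $\overline E(u;A)=\inf\{\liminf_nE(u_n;A):\mathcal A(X;\mathbb R^m)\ni u_n\to u\text{ in }L^p_\mu\}$ for $u\in W^{1,p}_\mu(X;\mathbb R^m)$, $A\in\mathcal O(X)$. $\widehat L_y(\xi)=\inf_{\zeta\in N^m_\mu(y)}L_y(\xi+\zeta)$ for $\xi\in T^m_\mu(y)$. *)

(* Defs.v *)
From HB Require Import structures.
From mathcomp Require Import all_boot all_order all_algebra.
From mathcomp Require Import all_classical all_reals all_analysis measurable_realfun.
Import Order.TTheory GRing.Theory Num.Theory numFieldNormedType.Exports numFieldTopology.Exports.
Set Implicit Arguments. Unset Strict Implicit. Unset Printing Implicit Defensive.
Local Open Scope classical_set_scope.
Local Open Scope ring_scope.

Notation borelT X := (g_sigma_algebraType (@open X)).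

Section Defs.
Context {R : realType} {X : pseudoPMetricType R}.
Implicit Types (d : X -> X -> R) (mu : {measure set (borelT X) -> \bar R}).

Definition oball d (x : X) (r : R) : set X := [set y | d x y < r].
Definition cball d (x : X) (r : R) : set X := [set y | d x y <= r].
Definition sphere d (x : X) (r : R) : set X := [set y | d x y = r].

(** dist(x, A) (= +oo for A empty), A^-(eps), A^+(eps) *)
Definition distE d (x : X) (A : set X) : \bar R := ereal_inf [set (d x a)%:E | a in A].
Definition Aminus d (A : set X) (e : R) : set X := [set x | (distE d x A <= e%:E)%E].
Definition Aplus d (A : set X) (e : R) : set X := [set x | (e%:E <= distE d x A)%E].

Definition Kclass d mu (K : set X) : Prop :=
  (exists (A : set X) (e : R), open A /\ 0 < e /\ (K = Aminus d A e \/ K = Aplus d A e))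
  \/ (exists (x : X) (r : R), 0 < r /\ K = cball d x r /\ mu (sphere d x r) = 0%E).

Definition supp mu : set X :=
  \bigcap_(F in [set F : set X | closed F /\ mu (~` F) = 0%E]) F.

(** Euclidean (Frobenius) norm and inner product on matrices; vectors of R^m
    are row vectors 'rV_m, so this is also the Euclidean norm on R^m. *)
Definition fnorm {a b : nat} (A : 'M[R]_(a, b)) : R :=
  Num.sqrt (\sum_(i < a) \sum_(j < b) A i j ^+ 2).
Definition frob {a b : nat} (A B : 'M[R]_(a, b)) : R :=
  \sum_(i < a) \sum_(j < b) A i j * B i j.

Definition mmeas {a b : nat} (f : X -> 'M[R]_(a, b)) : Prop :=
  forall i j, measurable_fun setT (fun x : borelT X => f x i j).

Definition inAm {m : nat} (Alg : set (X -> R)) (u : X -> 'rV[R]_m) : Prop :=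
  forall i, Alg (fun x => u x ord0 i).

Definition grad {m N : nat} (D : (X -> R) -> X -> 'rV[R]_N) (u : X -> 'rV[R]_m) :
  X -> 'M[R]_(m, N) :=
  fun x => \matrix_(i < m, j < N) D (fun y => u y ord0 i) x ord0 j.

Definition A0 {m : nat} (Alg : set (X -> R)) mu (u : X -> 'rV[R]_m) : Prop :=
  inAm Alg u /\ forall x, supp mu x -> u x = 0.

Definition spanAt {m N : nat} (D : (X -> R) -> X -> 'rV[R]_N)
  (vk : nat -> X -> 'rV[R]_m) (x : X) : set 'M[R]_(m, N) :=
  [set z | exists (n : nat) (c : nat -> R), z = \sum_(k < n) c k *: grad D (vk k) x].

(** [vk] generates the normal space field N^m_mu: every v_k lies in A^m_0 and
    for every v in A^m_0, nabla v(x) lies in span{nabla v_k(x)} for mu-a.e. x.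
    Then N^m_mu(x) = spanAt D vk x for mu-a.e. x. *)
Definition normal_gen {m N : nat} (Alg : set (X -> R)) mu
  (D : (X -> R) -> X -> 'rV[R]_N) (vk : nat -> X -> 'rV[R]_m) : Prop :=
  (forall k, A0 Alg mu (vk k)) /\
  forall v, A0 Alg mu v -> {ae mu, forall x : borelT X, spanAt D vk x (grad D v x)}.

Definition projT {m N : nat} (S : set 'M[R]_(m, N)) (xi : 'M[R]_(m, N)) : 'M[R]_(m, N) :=
  xget xi [set eta | S (xi - eta) /\ forall z, S z -> frob eta z = 0].

(** nabla_mu u (x) = P_mu(x) (nabla u(x)), with N_mu(x) = Sx x *)
Definition gradmu {m N : nat} (D : (X -> R) -> X -> 'rV[R]_N)
  (Sx : X -> set 'M[R]_(m, N)) (u : X -> 'rV[R]_m) : X -> 'M[R]_(m, N) :=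
  fun x => projT (Sx x) (grad D u x).

Definition lpdist {a b : nat} mu (p : R) (f g : X -> 'M[R]_(a, b)) : \bar R :=
  (\int[mu]_(x in [set: borelT X]) ((fnorm (f x - g x)) `^ p)%:E)%E.
Definition cvgLp {a b : nat} mu (p : R) (fn : nat -> X -> 'M[R]_(a, b))
  (f : X -> 'M[R]_(a, b)) : Prop :=
  lpdist mu p (fn n) f @[n --> \oo] --> 0%E.

(** Elements of W^{1,p}_mu(X;R^m) (completion of A(X;R^m)) are represented by the
    pair (u, nabla_mu u) of their images in L^p x L^p (the completion is
    isometric to the closure of the graph of nabla_mu). *)
Definition inW {m N : nat} (Alg : set (X -> R)) mu (p : R)
  (D : (X -> R) -> X -> 'rV[R]_N) (Sx : X -> set 'M[R]_(m, N))
  (u : X -> 'rV[R]_m) (G : X -> 'M[R]_(m, N)) : Prop :=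
  mmeas u /\ mmeas G /\
  exists un : nat -> X -> 'rV[R]_m, (forall n, inAm Alg (un n)) /\
    cvgLp mu p un u /\ cvgLp mu p (fun n => gradmu D Sx (un n)) G.

Definition inW0 {m N : nat} (Alg : set (X -> R)) mu (p : R)
  (D : (X -> R) -> X -> 'rV[R]_N) (Sx : X -> set 'M[R]_(m, N)) (A : set X)
  (u : X -> 'rV[R]_m) (G : X -> 'M[R]_(m, N)) : Prop :=
  mmeas u /\ mmeas G /\
  exists un : nat -> X -> 'rV[R]_m,
    (forall n, inAm Alg (un n) /\ forall x, ~ A x -> un n x = 0) /\
    cvgLp mu p un u /\ cvgLp mu p (fun n => gradmu D Sx (un n)) G.

Definition Efun {m N : nat} mu (D : (X -> R) -> X -> 'rV[R]_N)
  (L : X -> 'M[R]_(m, N) -> \bar R) (u : X -> 'rV[R]_m) (A : set X) : \bar R :=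
  (\int[mu]_(x in A) L x (grad D u x))%E.

Definition Ebar {m N : nat} (Alg : set (X -> R)) mu (p : R)
  (D : (X -> R) -> X -> 'rV[R]_N) (L : X -> 'M[R]_(m, N) -> \bar R)
  (u : X -> 'rV[R]_m) (A : set X) : \bar R :=
  ereal_inf [set limn_einf (fun n => Efun mu D L (un n) A) |
             un in [set un : nat -> X -> 'rV[R]_m |
                    (forall n, inAm Alg (un n)) /\ cvgLp mu p un u]].

Definition Lhat {m N : nat} (Sx : X -> set 'M[R]_(m, N))
  (L : X -> 'M[R]_(m, N) -> \bar R) (y : X) (xi : 'M[R]_(m, N)) : \bar R :=
  ereal_inf [set L y (xi + z) | z in Sx y].

Definition avg mu (B : set X) (f : X -> \bar R) : \bar R :=
  ((fine (mu B))^-1%:E * \int[mu]_(y in B) f y)%E.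

End Defs.

(* Main.v *)
Require Import Defs.
From HB Require Import structures.
From mathcomp Require Import all_boot all_order all_algebra.
From mathcomp Require Import all_classical all_reals all_analysis measurable_realfun.
From mathcomp Require Import ring lra.
Import Order.TTheory GRing.Theory Num.Theory numFieldNormedType.Exports numFieldTopology.Exports.
Set Implicit Arguments. Unset Strict Implicit. Unset Printing Implicit Defensive.
Local Open Scope classical_set_scope.
Local Open Scope ring_scope.

(** Let hl be the relaxed integrand, F = Ebar(u; .) and let m(Q) be the infimum of the
    integrals over Q of hl(grad_mu u + grad_mu w), w vanishing off Q.  If test functions w
    small in L^p satisfy int_A hl(grad_mu u + grad_mu w) < M, then F(A) <= M: almost optimal
    normal perturbations are patched together by Urysohn cut-offs of functions of A^m_0,
    which are free in L^p because they vanish mu-a.e.  Conversely, slicing turns a recovery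
    sequence for F(Q) into such w with support inside Q, so m(Q) <= F(Q).

    For s < t let E be the set of points having arbitrarily small balls with
    m(Q) < s mu(Q) and arbitrarily small balls with F(Q) > t mu(Q).  Let A be an open
    neighbourhood of E whose measure is close to the outer measure e of E.  By (C2), A
    contains disjoint balls of either kind exhausting E.  Competitors on balls of the first
    kind, glued together, are small in L^p by (C1), hence F(A) is at most about s e; by
    superadditivity over the balls of the second kind F(A) is at least about t e.  So
    e = 0, and the quotients m(Q)/mu(Q) <= F(Q)/mu(Q) have a common limit a.e. *)

(** * Frobenius norm and orthogonal projections *)

(** Four obstacles shape the argument. The algebra is closed under polynomials only and (C0) gives
    locality on open sets only, so truncation of functions has to be rebuilt from polynomials whose
    derivative is nearly 0 near 0 and nearly 1 away from it. No sphere is known to be null, whereas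
    (C2) handles closed balls and the quotients live on open ones; estimates are therefore moved to
    slightly smaller radii, with competitors vanishing off a closed ball inside the open one, and
    the slack of a strict inequality pays for the thin ring. F is not known to be a measure, nor E
    to be measurable, so a differentiation theorem is replaced by comparing F on open neighbourhoods
    of E with outer measure. As an infimum of continuous functions [hl] is only upper semicontinuous
    in the matrix, so the estimates are strict upper bounds of integrals, which survive small L^p
    perturbations of the gradient. The glued competitors are small in L^p because coercivity bounds
    their total gradient energy independently of the balls, while (C1) multiplies it by the p-th
    power of the radius. *)

Section Frobenius.
Context {R : realType} {a b : nat}.
Implicit Types A B C : 'M[R]_(a, b).

Lemma frobC A B : frob A B = frob B A.
Proof. by apply: eq_bigr => i _; apply: eq_bigr => j _; rewrite mulrC. Qed.

Lemma frobDl A B C : frob (A + B) C = frob A C + frob B C.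
Proof.
rewrite /frob -big_split; apply: eq_bigr => i _ /=.
by rewrite -big_split; apply: eq_bigr => j _ /=; rewrite mxE mulrDl.
Qed.

Lemma frobZl k A B : frob (k *: A) B = k * frob A B.
Proof.
rewrite /frob mulr_sumr; apply: eq_bigr => i _.
by rewrite mulr_sumr; apply: eq_bigr => j _; rewrite mxE mulrA.
Qed.

Lemma frobDr A B C : frob C (A + B) = frob C A + frob C B.
Proof. by rewrite !(frobC C) frobDl. Qed.

Lemma frobZr k A B : frob A (k *: B) = k * frob A B.
Proof. by rewrite !(frobC A) frobZl. Qed.

Lemma frobNl A B : frob (- A) B = - frob A B.
Proof. by rewrite -scaleN1r frobZl mulN1r. Qed.

Lemma frobNr A B : frob A (- B) = - frob A B.
Proof. by rewrite frobC frobNl frobC. Qed.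

Lemma frob0r A : frob A 0 = 0.
Proof. by rewrite -(scale0r 0) frobZr mul0r. Qed.

Lemma frob_delta A i j : frob A (delta_mx i j) = A i j.
Proof.
rewrite /frob (bigD1 i) //= (bigD1 j) //= !mxE !eqxx mulr1.
rewrite big1 ?addr0 => [|k kj]; last by rewrite mxE (negPf kj) andbF mulr0.
rewrite big1 ?addr0 // => k ki; rewrite big1 // => l _.
by rewrite mxE (negPf ki) mulr0.
Qed.

Lemma frob_ge0 A : 0 <= frob A A.
Proof. by apply: sumr_ge0 => i _; apply: sumr_ge0 => j _; rewrite -expr2 sqr_ge0. Qed.

Lemma frob_eq0 A : frob A A = 0 -> A = 0.
Proof.
move=> /eqP h; apply/matrixP => i j; rewrite mxE.
move: h; rewrite psumr_eq0 => [/allP/(_ i)|k _]; last first.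
  by apply: sumr_ge0 => l _; rewrite -expr2 sqr_ge0.
rewrite mem_index_enum => /(_ isT); rewrite psumr_eq0 => [/allP/(_ j)|k _]; last first.
  by rewrite -expr2 sqr_ge0.
by rewrite mem_index_enum => /(_ isT); rewrite mulf_eq0 orbb => /eqP.
Qed.

Lemma fnormE A : fnorm A = Num.sqrt (frob A A).
Proof. by congr Num.sqrt; apply: eq_bigr => i _; apply: eq_bigr => j _; rewrite expr2. Qed.

Lemma fnorm_ge0 A : 0 <= fnorm A. Proof. exact: sqrtr_ge0. Qed.

Lemma sqr_fnorm A : fnorm A ^+ 2 = frob A A.
Proof. by rewrite fnormE sqr_sqrtr // frob_ge0. Qed.

Lemma fnorm0 : fnorm (0 : 'M[R]_(a, b)) = 0.
Proof. by rewrite fnormE frob0r sqrtr0. Qed.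

Lemma fnormZ k A : fnorm (k *: A) = `|k| * fnorm A.
Proof.
by rewrite !fnormE frobZl frobZr mulrA -expr2 sqrtrM ?sqr_ge0 // sqrtr_sqr.
Qed.

Lemma fnormN A : fnorm (- A) = fnorm A.
Proof. by rewrite -scaleN1r fnormZ normrN1 mul1r. Qed.

Lemma fnormB A B : fnorm (A - B) = fnorm (B - A).
Proof. by rewrite -fnormN opprB. Qed.

Lemma sqr_fnormD A B : fnorm (A + B) ^+ 2 <= 2 * (fnorm A ^+ 2 + fnorm B ^+ 2).
Proof.
rewrite !sqr_fnorm.
have := frob_ge0 (A - B); rewrite !(frobDl, frobDr, frobNl, frobNr) (frobC B A).
by move=> h; lra.
Qed.

Lemma fnormD_max A B : fnorm (A + B) <= 2 * Num.max (fnorm A) (fnorm B).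
Proof.
set M := Num.max _ _.
have M0 : 0 <= M by rewrite le_max fnorm_ge0.
rewrite -(ler_pXn2r (n := 2)) ?nnegrE ?fnorm_ge0 ?mulr_ge0//.
apply: (le_trans (sqr_fnormD A B)).
have hA : fnorm A ^+ 2 <= M ^+ 2.
  by rewrite ler_pXn2r ?nnegrE ?fnorm_ge0// le_max lexx.
have hB : fnorm B ^+ 2 <= M ^+ 2.
  by rewrite ler_pXn2r ?nnegrE ?fnorm_ge0// le_max lexx orbT.
by rewrite exprMn; lra.
Qed.

Lemma normr_le_fnorm A i j : `|A i j| <= fnorm A.
Proof.
rewrite -(ler_pXn2r (n := 2)) ?nnegrE ?fnorm_ge0// sqr_fnorm real_normK ?num_real//.
rewrite /frob (bigD1 i) //= (bigD1 j) //= -expr2 -addrA lerDl.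
apply: addr_ge0; apply: sumr_ge0 => k _; first by rewrite -expr2 sqr_ge0.
by apply: sumr_ge0 => l _; rewrite -expr2 sqr_ge0.
Qed.

Lemma fnorm_le_entries A e : 0 <= e -> (forall i j, `|A i j| <= e) ->
  fnorm A <= (a * b)%:R * e.
Proof.
move=> e0 h; rewrite -(ler_pXn2r (n := 2)) ?nnegrE ?fnorm_ge0 ?mulr_ge0//.
rewrite sqr_fnorm /frob.
apply: (@le_trans _ _ ((a * b)%:R * e ^+ 2)).
  apply: (@le_trans _ _ (\sum_(i < a) \sum_(j < b) e ^+ 2)).
    apply: ler_sum => i _; apply: ler_sum => j _.
    by rewrite -expr2 -real_normK ?num_real// ler_pXn2r ?nnegrE.
  by rewrite !sumr_const !card_ord -mulrnA mulr_natl mulnC.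
rewrite exprMn ler_wpM2r ?sqr_ge0// -natrX ler_nat.
by case: (a * b)%N => // n; rewrite expnS expn1 leq_pmulr.
Qed.

Context (p : R) (p0 : 0 < p).

Lemma fpowD A B : fnorm (A + B) `^ p <= 2 `^ p * (fnorm A `^ p + fnorm B `^ p).
Proof.
apply: (@le_trans _ _ ((2 * Num.max (fnorm A) (fnorm B)) `^ p)).
  by rewrite ge0_ler_powR ?nnegrE ?fnorm_ge0 ?mulr_ge0 ?le_max ?fnorm_ge0 ?(ltW p0)// fnormD_max.
rewrite powRM ?le_max ?fnorm_ge0// ler_wpM2l ?powR_ge0//.
by have [_|_] := leP (fnorm A) (fnorm B); rewrite ?lerDr ?lerDl powR_ge0.
Qed.

Lemma fpow_le A B : fnorm A <= fnorm B -> fnorm A `^ p <= fnorm B `^ p.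
Proof. by move=> h; rewrite ge0_ler_powR ?nnegrE ?fnorm_ge0 ?(ltW p0). Qed.

End Frobenius.

(** The rank-one matrix by which the gradient of [phi *: v] differs from [phi *: grad v] in the
    Leibniz rule. *)
Definition outer {R : realType} {m N : nat} (v : 'rV[R]_m) (g : 'rV[R]_N) : 'M[R]_(m, N) :=
  v^T *m g.

Lemma outerE {R : realType} {m N : nat} (v : 'rV[R]_m) (g : 'rV[R]_N) i j :
  outer v g i j = v ord0 i * g ord0 j.
Proof. by rewrite /outer mxE big_ord_recl big_ord0 addr0 mxE. Qed.

Lemma fnorm_outer {R : realType} {m N : nat} (v : 'rV[R]_m) (g : 'rV[R]_N) :
  fnorm (outer v g) = fnorm v * fnorm g.
Proof.
rewrite !fnormE -sqrtrM ?frob_ge0//; congr Num.sqrt.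
rewrite /frob !big_ord_recl !big_ord0 !addr0 mulr_suml; apply: eq_bigr => i _.
by rewrite mulr_sumr; apply: eq_bigr => j _; rewrite outerE mulrACA.
Qed.

Section Projection.
Context {R : realType} {m N : nat}.
Implicit Types (xi eta : 'M[R]_(m, N)) (b : nat -> 'M[R]_(m, N)).

(** With [b k := grad D (vk k) x] this is convertible to [spanAt D vk x], so pointwise linear
    algebra can be done without X. *)
Definition seqspan b : set 'M[R]_(m, N) :=
  [set z | exists (n : nat) (c : nat -> R), z = \sum_(k < n) c k *: b k].

Definition nspan b n : set 'M[R]_(m, N) :=
  [set z | exists c : nat -> R, z = \sum_(k < n) c k *: b k].

Lemma nspanD b n z z' : nspan b n z -> nspan b n z' -> nspan b n (z + z').
Proof.
move=> [c ->] [c' ->]; exists (fun k => c k + c' k).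
by rewrite -big_split; apply: eq_bigr => k _ /=; rewrite scalerDl.
Qed.

Lemma nspanZ b n r z : nspan b n z -> nspan b n (r *: z).
Proof.
move=> [c ->]; exists (fun k => r * c k).
by rewrite scaler_sumr; apply: eq_bigr => k _ /=; rewrite scalerA.
Qed.

Lemma nspanS b n n' z : (n <= n')%N -> nspan b n z -> nspan b n' z.
Proof.
move=> nn' [c ->]; exists (fun k => if (k < n)%N then c k else 0).
rewrite -(big_mkord xpredT (fun k => c k *: b k)).
rewrite -(big_mkord xpredT (fun k => (if (k < n)%N then c k else 0) *: b k)).
rewrite (big_cat_nat (leq0n n) nn')//= [X in _ + X]big_nat [X in _ + X]big1 ?addr0.
  by rewrite !big_nat; apply: eq_bigr => k /andP[_ ->].
by move=> k /andP[nk _]; rewrite ltnNge nk scale0r.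
Qed.

Lemma nspan_gen b n k : (k < n)%N -> nspan b n (b k).
Proof.
move=> kn; exists (fun j => (j == k)%:R).
rewrite (bigD1 (Ordinal kn)) //= eqxx scale1r big1 ?addr0// => j jk.
by case: eqP => [e|]; rewrite ?scale0r//; move/eqP: jk; case; apply/val_inj.
Qed.

Lemma seqspanD b z z' : seqspan b z -> seqspan b z' -> seqspan b (z + z').
Proof.
move=> [n hz] [n' hz']; exists (maxn n n').
by apply: nspanD; [apply: (nspanS (leq_maxl n n')) | apply: (nspanS (leq_maxr n n'))].
Qed.

Lemma seqspanZ b r z : seqspan b z -> seqspan b (r *: z).
Proof. by move=> [n hz]; exists n; apply: nspanZ. Qed.

Lemma seqspan0 b : seqspan b 0.
Proof. by exists 0%N, (fun=> 0); rewrite big_ord0. Qed.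

Lemma seqspanN b z : seqspan b z -> seqspan b (- z).
Proof. by rewrite -scaleN1r; apply: seqspanZ. Qed.

Lemma seqspanB b z z' : seqspan b z -> seqspan b z' -> seqspan b (z - z').
Proof. by move=> hz /seqspanN; apply: seqspanD. Qed.

(* Gram-Schmidt: the residual of the new generator against the previous span
   is the only new direction. *)
Lemma nspan_proj b n xi :
  exists eta, nspan b n (xi - eta) /\ forall z, nspan b n z -> frob eta z = 0.
Proof.
elim: n xi => [|n IH] xi.
  exists xi; split; first by exists (fun=> 0); rewrite big_ord0 subrr.
  by move=> z [c ->]; rewrite big_ord0 frob0r.
have [b' [hb' ob']] := IH (b n); have [e [he oe]] := IH xi.
have ebb z : nspan b n.+1 z -> exists c z', nspan b n z' /\ z = z' + c *: b'.
  move=> [c ->]; rewrite big_ord_recr /=.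
  exists (c n), (\sum_(k < n) c k *: b k + c n *: (b n - b')); split.
    by apply: nspanD; [exists c | exact: nspanZ].
  by rewrite scalerBr addrA subrK.
have b'S : nspan b n.+1 b'.
  rewrite -(subKr (b n) b'); apply: nspanD; first exact: nspan_gen.
  by rewrite -scaleN1r; apply: nspanZ; apply: nspanS hb'.
have [b0|b0] := eqVneq (frob b' b') 0.
  exists e; split; first exact: nspanS he.
  move=> z /ebb [c [z' [hz' ->]]].
  by rewrite (frob_eq0 b0) scaler0 addr0; apply: oe.
exists (e - (frob e b' / frob b' b') *: b'); split.
  rewrite opprB addrCA addrC; apply: nspanD; first exact: nspanS he.
  exact: nspanZ.
move=> z /ebb [c [z' [hz' ->]]].
rewrite !(frobDl, frobNl, frobZl, frobDr, frobZr) (oe _ hz') (ob' _ hz').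
by rewrite mulr0 oppr0 !add0r divfK// mulrN subrr.
Qed.

(* The dimensions of the finite spans are bounded, so one of them is maximal. *)
Lemma seqspan_stable b : exists n, seqspan b = nspan b n.
Proof.
pose V n := (<<[seq b k | k <- iota 0 n]>>)%VS : {vspace 'M[R]_(m, N)}.
pose Q := fun d : nat => `[< exists n, \dim (V n) = d >].
have exQ : exists d, Q d by exists (\dim (V 0%N)); apply/asboolP; exists 0%N.
have ubQ d : Q d -> (d <= m * N)%N.
  move=> /asboolP [n <-]; apply: leq_trans (dimvS (subvf _)) _.
  by rewrite dimvf /dim /=.
have [d /asboolP[n nd] dmax] := ex_maxnP exQ ubQ.
have VS k l : (k <= l)%N -> (V k <= V l)%VS.
  move=> kl; apply: sub_span => x /mapP [j]; rewrite mem_iota => /andP[_ jk] ->.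
  by apply: map_f; rewrite mem_iota/= add0n; apply: leq_trans kl.
have Vn l : (V l <= V n)%VS.
  have [ln|nl] := leqP l n; first exact: VS.
  have /eqP -> : V n == V l; last by [].
  rewrite eqEdim VS ?(ltnW nl)//= nd; apply: dmax; apply/asboolP.
  by exists l.
have inV l z : nspan b l z <-> z \in V l.
  split=> [[c ->]|hz].
    apply: memv_suml => i _; apply: memvZ; apply: memv_span; apply: map_f.
    by rewrite mem_iota /= add0n.
  have sz : size [seq b k | k <- iota 0 l] = l by rewrite size_map size_iota.
  rewrite (coord_span (X := in_tuple _) hz).
  pose c k := if insub k is Some i then coord (in_tuple [seq b k | k <- iota 0 l]) i z else 0.
  exists c.
  have -> : \sum_(k < l) c k *: b k = \sum_(k < size [seq b k | k <- iota 0 l]) c k *: b k.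
    by move: c sz; move: (size _) => l' c ->.
  apply: eq_bigr => i _; congr (_ *: _); first by rewrite /c valK.
  have il : (i < l)%N by rewrite -[X in (_ < X)%N]sz ltn_ord.
  by rewrite /= (nth_map 0%N) ?size_iota// nth_iota.
exists n; apply/seteqP; split=> z; last by move=> h; exists n.
by move=> [l /inV hz]; apply/inV; apply: subvP hz.
Qed.

Lemma projT_ex b xi : exists eta,
  seqspan b (xi - eta) /\ forall z, seqspan b z -> frob eta z = 0.
Proof. by have [n ->] := seqspan_stable b; apply: nspan_proj. Qed.

Lemma projTP b xi : seqspan b (xi - projT (seqspan b) xi) /\
  forall z, seqspan b z -> frob (projT (seqspan b) xi) z = 0.
Proof.
rewrite /projT; case: (xgetP xi); first by [].
by move=> h; have [eta] := projT_ex b xi => /h.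
Qed.

Lemma projT_uniq b xi eta : seqspan b (xi - eta) ->
  (forall z, seqspan b z -> frob eta z = 0) -> projT (seqspan b) xi = eta.
Proof.
move=> h1 h2; have [k1 k2] := projTP b xi; set e := projT _ _ in k1 k2 *.
apply/eqP; rewrite -subr_eq0; apply/eqP/frob_eq0.
have hS : seqspan b (e - eta).
  by have := seqspanB h1 k1; rewrite opprB addrC addrA subrK.
by rewrite frobDl frobNl k2// h2// subr0.
Qed.

Lemma projTD b xi eta :
  projT (seqspan b) (xi + eta) = projT (seqspan b) xi + projT (seqspan b) eta.
Proof.
have [x1 x2] := projTP b xi; have [e1 e2] := projTP b eta.
apply: projT_uniq => [|z hz]; last by rewrite frobDl x2// e2// addr0.
by rewrite opprD addrACA; apply: seqspanD.
Qed.

Lemma projTZ b r xi : projT (seqspan b) (r *: xi) = r *: projT (seqspan b) xi.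
Proof.
have [x1 x2] := projTP b xi.
apply: projT_uniq => [|z hz]; last by rewrite frobZl x2// mulr0.
by rewrite -scalerBr; apply: seqspanZ.
Qed.

Lemma projTN b xi : projT (seqspan b) (- xi) = - projT (seqspan b) xi.
Proof. by rewrite -scaleN1r projTZ scaleN1r. Qed.

Lemma projTB b xi eta :
  projT (seqspan b) (xi - eta) = projT (seqspan b) xi - projT (seqspan b) eta.
Proof. by rewrite projTD projTN. Qed.

Lemma projT0 b : projT (seqspan b) 0 = 0.
Proof. by apply: projT_uniq => [|z _]; rewrite ?subr0 ?(frobC 0) ?frob0r//; exact: seqspan0. Qed.

Lemma projT_span b z : seqspan b z -> projT (seqspan b) z = 0.
Proof.
by move=> hz; apply: projT_uniq => [|w _]; rewrite ?subr0// frobC frob0r.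
Qed.

(** Pythagoras. Hence the norm of the projection is the distance of xi to the span, an infimum that
    may be taken over rational combinations; measurability in x will rest on this. *)
Lemma sqr_fnorm_projT b xi z : seqspan b z ->
  fnorm (xi - z) ^+ 2 = fnorm (projT (seqspan b) xi) ^+ 2 +
                        fnorm (xi - projT (seqspan b) xi - z) ^+ 2.
Proof.
move=> hz; have [x1 x2] := projTP b xi; set e := projT _ _ in x1 x2 *.
have h : frob e (xi - e - z) = 0 by apply: x2; apply: seqspanB.
have -> : xi - z = e + (xi - e - z) by rewrite addrA addrCA subrr addr0.
move: (xi - e - z) h => r h; rewrite sqr_fnorm frobDl !frobDr (frobC r e) h.
by rewrite addr0 add0r !sqr_fnorm.
Qed.

Lemma fnorm_projT b xi : fnorm (projT (seqspan b) xi) <= fnorm xi.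
Proof.
rewrite -(ler_pXn2r (n := 2)) ?nnegrE ?fnorm_ge0//.
have := sqr_fnorm_projT xi (seqspan0 b); rewrite !subr0 => ->.
by rewrite lerDl sqr_ge0.
Qed.

(* Polarization, using that the projection is self-adjoint. *)
Lemma projT_entry b xi i j : projT (seqspan b) xi i j =
  (fnorm (projT (seqspan b) (xi + delta_mx i j)) ^+ 2 -
   fnorm (projT (seqspan b) (xi - delta_mx i j)) ^+ 2) / 4.
Proof.
rewrite !sqr_fnorm projTB projTD.
set e := projT _ xi; set f := projT _ (delta_mx i j).
have ef : frob e f = e i j.
  have [x1 x2] := projTP b xi; have [f1 f2] := projTP b (delta_mx i j).
  by rewrite -[RHS]frob_delta -[X in _ = frob _ X](subrK f) frobDr (x2 _ f1) add0r.
rewrite !(frobDl, frobDr, frobNl, frobNr) (frobC f e) ef.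
by field.
Qed.

End Projection.

(** * Measure and integration *)

Section NonMeasurable.
Context d (T : measurableType d) (R : realType) (mu : {measure set T -> \bar R}).
Local Open Scope ereal_scope.

(* MathComp-Analysis integrates a nonnegative function as a supremum over the
   simple functions below it, so monotonicity needs no measurability. *)
Lemma ge0_le_integral_nonmeas (D : set T) (f g : T -> \bar R) :
  (forall x, D x -> 0 <= f x) -> (forall x, D x -> f x <= g x) ->
  \int[mu]_(x in D) f x <= \int[mu]_(x in D) g x.
Proof.
move=> f0 fg; rewrite !(integral_mkcond D).
have h0 x : 0 <= (f \_ D) x by apply: erestrict_ge0.
have k0 x : 0 <= (g \_ D) x.
  by apply: erestrict_ge0 => // t Dt; apply: le_trans (fg _ Dt); exact: f0.
rewrite !ge0_integralTE//; apply: ereal_sup_le => _ [h hf <-]; exists h => // x.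
by apply: le_trans (hf x) _; apply: lee_restrict.
Qed.

(** Meant for the integrands built from [L] and [Lhat], which agree with measurable functions only
    outside a null set. *)
Lemma ge0_ae_eq_integral_nonmeas (D : set T) (f g : T -> \bar R) : measurable D ->
  (forall x, D x -> 0 <= f x) -> (forall x, D x -> 0 <= g x) ->
  measurable_fun D g -> {ae mu, forall x, D x -> f x = g x} ->
  \int[mu]_(x in D) f x = \int[mu]_(x in D) g x.
Proof.
move=> mD f0 g0 mg [N [mN N0 DN]].
have eN x : D x -> ~ N x -> f x = g x.
  by move=> Dx nNx; apply: contrapT => h; apply: nNx; apply: DN => /= /(_ Dx).
apply/eqP; rewrite eq_le; apply/andP; split.
(* Raising g to +oo on the null set gives a measurable function above f everywhere, with the
   integral of g. *)
- pose g' x := if x \in N then +oo else g x.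
  have mg' : measurable_fun D g'.
    apply: measurable_fun_if => //; last exact: measurable_funS mg.
    apply: (measurable_fun_bool true); rewrite (_ : _ @^-1` _ = N); first exact: measurableI.
    by apply/seteqP; split=> x /=; [move/set_mem | move/mem_set].
  have <- : \int[mu]_(x in D) g' x = \int[mu]_(x in D) g x.
    apply: ge0_ae_eq_integral => //.
    - by move=> x Dx; rewrite /g'; case: ifP => // _; exact: g0.
    - exists N; split => // x /= /not_implyP[Dx]; rewrite /g'; case: ifPn => //.
      by rewrite inE.
  apply: ge0_le_integral_nonmeas => // x Dx; rewrite /g'; case: ifPn => [_|].
    by rewrite leey.
  by rewrite notin_setE => /(eN _ Dx) ->.
(* For the converse g is restricted to the complement of N, where it equals f. *)
- rewrite (@ge0_negligible_integral _ _ _ mu D N g) //.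
  rewrite !(integral_mkcond D) (integral_mkcond (D `\` N)).
  apply: ge0_le_integral_nonmeas => [x _|x _].
    by apply: erestrict_ge0 => y [Dy _]; exact: g0.
  rewrite /patch; case: ifPn => [|_].
    by rewrite inE => -[Dx nNx]; rewrite mem_set// (eN _ Dx nNx).
  by case: ifPn => // ; rewrite inE => /f0.
Qed.

End NonMeasurable.

Section ErealSequence.
Context (R : realType).
Local Open Scope ereal_scope.

Lemma cvgn_gt (f : nat -> \bar R) l y : f n @[n --> \oo] --> l -> y < l ->
  exists n, y < f n.
Proof.
move=> fl yl; have [n _ h] := fl _ (open_ereal_gt' yl).
by exists n; apply: (h n) => /=.
Qed.

Lemma cvgn_lt (f : nat -> \bar R) l y : f n @[n --> \oo] --> l -> l < y ->
  exists n, f n < y.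
Proof.
move=> fl yl; have [n _ h] := fl _ (open_ereal_lt' yl).
by exists n; apply: (h n) => /=.
Qed.

End ErealSequence.

Section AbsoluteContinuity.
Context d (T : measurableType d) (R : realType) (mu : {measure set T -> \bar R}).

Lemma integral_abs_cont (f : T -> R) (e : R) : measurable_fun setT f ->
  (forall x, 0 <= f x) -> (\int[mu]_x (f x)%:E < +oo)%E -> 0 < e ->
  exists2 del : R, 0 < del & forall A, measurable A -> (mu A < del%:E)%E ->
    (\int[mu]_(x in A) (f x)%:E < e%:E)%E.
Proof.
move=> mf f0 fi e0.
have fI : mu.-integrable setT (EFin \o f).
  apply/integrableP; split; first exact/measurable_EFinP.
  by under eq_integral => x _ do rewrite /= ger0_norm//.
have [del [del0 hdel]] := integral_normr_continuous fI e0.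
exists del => // A mA muA; have := hdel A mA muA.
rewrite /Rintegral; under eq_integral => x _ do rewrite ger0_norm//.
have Af : (\int[mu]_(x in A) (f x)%:E)%E \is a fin_num.
  rewrite ge0_fin_numE; last by apply: integral_ge0 => x _; rewrite lee_fin.
  apply: le_lt_trans fi; apply: ge0_subset_integral => //; first exact/measurable_EFinP.
  by move=> x _; rewrite lee_fin.
by rewrite -lte_fin fineK.
Qed.

Lemma measure_decr_lt (F : (set T)^nat) (e : R) : (mu (F 0%N) < +oo)%E ->
  (forall n, measurable (F n)) -> (forall n k, (n <= k)%N -> F k `<=` F n) ->
  \bigcap_n F n = set0 -> 0 < e -> exists n, (mu (F n) < e%:E)%E.
Proof.
move=> F0 mF dF F_ e0.
have h : mu (F n) @[n --> \oo] --> mu (\bigcap_n F n).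
  apply: nonincreasing_cvg_mu => //; first exact: bigcap_measurableType.
  by move=> n k nk; apply/subsetPset; apply: dF.
rewrite F_ measure0 in h.
have e0' : (0 < e%:E)%E by rewrite lte_fin.
exact: cvgn_lt h e0'.
Qed.

End AbsoluteContinuity.

Record compact_metric {R : realType} {X : pseudoPMetricType R} (d : X -> X -> R)
    (mu : {measure set (borelT X) -> \bar R}) : Prop := CompactMetric {
  cm_ge0 : forall x y, 0 <= d x y ;
  cm_eq0 : forall x y, d x y = 0 <-> x = y ;
  cm_sym : forall x y, d x y = d y x ;
  cm_tri : forall x y z, d x z <= d x y + d y z ;
  cm_ball : forall (x : X) (e : R), 0 < e -> ball x e = oball d x e ;
  cm_cpt : compact [set: X] ;
  cm_fin : (mu [set: borelT X] < +oo)%E }.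

(** * Regularity and support of a finite Borel measure on a compact metric space *)

Section CompactMetric.
Context {R : realType} {X : pseudoPMetricType R} {d : X -> X -> R}
  {mu : {measure set (borelT X) -> \bar R}} (HX : compact_metric d mu).
Let d_ge0 := cm_ge0 HX.
Let d_eq0 := cm_eq0 HX.
Let d_sym := cm_sym HX.
Let d_tri := cm_tri HX.
Let d_ball := cm_ball HX.
Let cptX := cm_cpt HX.
Let mu_fin := cm_fin HX.

Lemma dxx x : d x x = 0.
Proof. by apply/d_eq0. Qed.

Lemma nbhs_oball x (A : set X) :
  nbhs x A <-> exists2 e : R, 0 < e & oball d x e `<=` A.
Proof.
split=> [/nbhs_ballP[e /= e0 h]|[e e0 h]]; first by exists e; rewrite -?d_ball.
by apply/nbhs_ballP; exists e => //; rewrite d_ball.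
Qed.

Lemma open_oballP (A : set X) :
  open A <-> forall x, A x -> exists2 e : R, 0 < e & oball d x e `<=` A.
Proof.
rewrite openE; split=> h x /h; first by move/nbhs_oball.
by move=> hx; apply/nbhs_oball.
Qed.

Lemma open_oball x r : open (oball d x r).
Proof.
apply/open_oballP => y; rewrite /oball /= => yr; exists (r - d x y).
  by rewrite subr_gt0.
by move=> z; rewrite /oball /= => yz; apply: le_lt_trans (d_tri x y z) _; lra.
Qed.

Lemma open_oballC x r : open [set y | r < d x y].
Proof.
apply/open_oballP => y /= ry; exists (d x y - r); first by rewrite subr_gt0.
move=> z; rewrite /oball /= => yz; have := d_tri x z y; rewrite (d_sym z y); lra.
Qed.

Lemma cballE x r : cball d x r = ~` [set y | r < d x y].
Proof.
apply/seteqP; split => y; rewrite /cball /=; first by move=> h; apply/negP; rewrite -leNgt.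
by move/negP; rewrite -leNgt.
Qed.

Lemma closed_cball x r : closed (cball d x r).
Proof. by rewrite cballE closedC; exact: open_oballC. Qed.

Lemma closed_cpt (A : set X) : closed A -> compact A.
Proof. by move=> cA; apply: subclosed_compact cptX _. Qed.

Lemma hausX : hausdorff_space X.
Proof.
rewrite ball_hausdorff => x y xy.
have dxy : 0 < d x y by rewrite lt_neqAle d_ge0 andbT eq_sym; apply/eqP => /d_eq0 /eqP; apply/negP.
have d2 : 0 < d x y / 2 by rewrite divr_gt0.
exists (PosNum d2, PosNum d2) => /=; rewrite !d_ball//; apply/eqP; rewrite -subset0 => z [].
rewrite /oball /= => xz yz; have := d_tri x z y; rewrite (d_sym z y); lra.
Qed.

Lemma open_meas (A : set X) : open A -> measurable (A : set (borelT X)).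
Proof. by move=> oA; apply: sub_sigma_algebra. Qed.

Lemma closed_meas (A : set X) : closed A -> measurable (A : set (borelT X)).
Proof.
move=> cA; rewrite -(setCK A); apply: measurableC; apply: open_meas.
by rewrite openC.
Qed.

Lemma meas_oball x r : measurable (oball d x r : set (borelT X)).
Proof. by apply: open_meas; exact: open_oball. Qed.

Lemma meas_cball x r : measurable (cball d x r : set (borelT X)).
Proof. by apply: closed_meas; exact: closed_cball. Qed.

Lemma continuous_meas (f : X -> R) : continuous f ->
  measurable_fun [set: borelT X] (f : borelT X -> R).
Proof.
move=> cf; apply: (measurability _ (RGenOInfty.measurableE R)).
move=> _ [_ [a ->] <-]; rewrite setTI; apply: open_meas.
by apply: open_comp => // x _; exact: cf.
Qed.

Lemma mu_fin_meas (A : set (borelT X)) : measurable A -> (mu A < +oo)%E.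
Proof. by move=> mA; apply: le_lt_trans mu_fin; apply: le_measure; rewrite ?inE. Qed.

Lemma mu_fin_num (A : set (borelT X)) : measurable A -> mu A \is a fin_num.
Proof. by move=> mA; rewrite ge0_fin_numE// mu_fin_meas. Qed.

Lemma mu_leU (A B : set (borelT X)) : measurable A -> measurable B ->
  (mu (A `|` B) <= mu A + mu B)%E.
Proof. by move=> mA mB; exact: measureU2. Qed.

(** Asking for the closed and the open set simultaneously makes the property symmetric under
    complements. *)
Definition regular_set (B : set (borelT X)) := measurable B /\ forall e : R, 0 < e ->
  exists C U : set X, [/\ closed C, open U, C `<=` B, B `<=` U & (mu (U `\` C) < e%:E)%E].

Lemma open_regular (U : set X) : open U -> regular_set U.
Proof.
move=> oU; split=> [|e e0]; first exact: open_meas.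
(* The points at distance at least 1/(n+1) from the complement of U: closed sets increasing to U. *)
pose C n : set X := ~` \bigcup_(z in ~` U) oball d z n.+1%:R^-1.
have cC n : closed (C n).
  by rewrite closedC; apply: bigcup_open => z _; exact: open_oball.
have CU n : C n `<=` U.
  move=> x Cx; apply: contrapT => nUx; apply: Cx; exists x => //.
  by rewrite /oball /= dxx invr_gt0.
have [n hn] : exists n, (mu (U `\` C n) < e%:E)%E.
  apply: (@measure_decr_lt _ _ _ mu (fun n => U `\` C n)) => //.
  - by apply: mu_fin_meas; apply: measurableD; [exact: open_meas|exact: closed_meas].
  - by move=> n; apply: measurableD; [exact: open_meas|exact: closed_meas].
  - move=> n k nk x [Ux nCk]; split=> // Cn; apply: nCk => -[z nUz hz]; apply: Cn.
    exists z => //; apply: lt_le_trans hz _.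
    by rewrite lef_pV2 ?posrE// ler_nat.
  - rewrite -subset0 => x h; have [Ux _] := h 0%N I.
    have /open_oballP/(_ _ Ux)[r r0 hr] := oU.
    have [n hn] : exists n : nat, n.+1%:R^-1 < r.
      have := near_infty_natSinv_lt (PosNum r0).
      by case=> n _ /(_ n (leqnn n)) hn; exists n.
    have [_ []] := h n I; move=> [z nUz hz]; apply: nUz; apply: hr.
    by rewrite /oball /= d_sym; apply: lt_trans hn.
by exists (C n), U; split.
Qed.

Lemma regular_setC B : regular_set B -> regular_set (~` B).
Proof.
move=> [mB hB]; split=> [|e e0]; first exact: measurableC.
have [C [U [cC oU CB BU hUC]]] := hB e e0.
exists (~` U), (~` C); split; rewrite ?closedC ?openC//; try exact: subsetC.
by rewrite setDE setCK setIC -setDE.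
Qed.

Lemma regular_bigcup (F : (set (borelT X))^nat) : (forall n, regular_set (F n)) ->
  regular_set (\bigcup_n F n).
Proof.
move=> hF; have mF n : measurable (F n) by have [] := hF n.
split=> [|e e0]; first exact: bigcupT_measurable.
(* Half of e is shared geometrically among the gaps [U n \ C n]; the other half pays for keeping
   finitely many [C n], whose union is still closed. *)
pose en (n : nat) := e / 2 / (2 ^ n.+1)%:R : R.
have en0 n : 0 < en n by rewrite !divr_gt0// ltr0n expn_gt0.
have /choice[C /choice[U hCU]] : forall n, exists C U : set X,
    [/\ closed C, open U, C `<=` F n, F n `<=` U & (mu (U `\` C) < (en n)%:E)%E].
  by move=> n; apply: (hF n).2.
have cC n : closed (C n) by have [] := hCU n.
have oU n : open (U n) by have [] := hCU n.
have mC n : measurable (C n : set (borelT X)) by exact: closed_meas.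
have mU n : measurable (U n : set (borelT X)) by exact: open_meas.
pose UU := \bigcup_n U n; pose CC n := \bigcup_(k < n) C k.
have mUU : measurable (UU : set (borelT X)) by apply: bigcupT_measurable.
have mCC n : measurable (CC n : set (borelT X)).
  by apply: bigcup_measurable => k _.
have [N hN] : exists N, (mu ((\bigcup_n C n) `\` CC N) < (e / 2)%:E)%E.
  apply: (@measure_decr_lt _ _ _ mu (fun n => (\bigcup_n C n) `\` CC n)).
  - apply: mu_fin_meas; apply: measurableD => //; exact: bigcupT_measurable.
  - by move=> n; apply: measurableD => //; exact: bigcupT_measurable.
  - move=> n k nk x [Cx nC]; split=> // -[j /= jn Cj]; apply: nC; exists j => //=.
    exact: leq_trans nk.
  - rewrite -subset0 => x h; have [[k _ Ck] _] := h 0%N I.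
    by have [_] := h k.+1 I; apply; exists k => /=.
  - by rewrite divr_gt0.
exists (CC N), UU; split.
- apply: closed_bigcup => //; exact: finite_II.
- by apply: bigcup_open.
- by move=> x [k _ Ck]; exists k => //; have [_ _ + _ _] := hCU k; apply.
- by move=> x [k _ Fk]; exists k => //; have [_ _ _ + _] := hCU k; apply.
have sub : UU `\` CC N `<=` (\bigcup_n (U n `\` C n)) `|` ((\bigcup_n C n) `\` CC N).
  move=> x [[k _ Uk] nC]; have [h|h] := pselect ((\bigcup_n C n) x); first by right.
  by left; exists k => //; split=> // Ck; apply: h; exists k.
have mUC : measurable (\bigcup_n (U n `\` C n) : set (borelT X)).
  by apply: bigcupT_measurable => n; exact: measurableD.
have mCN : measurable ((\bigcup_n C n) `\` CC N : set (borelT X)).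
  by apply: measurableD => //; exact: bigcupT_measurable.
apply: (@le_lt_trans _ _ (mu ((\bigcup_n (U n `\` C n)) `|` ((\bigcup_n C n) `\` CC N)))).
  by apply: le_measure; rewrite ?inE//; [exact: measurableD|exact: measurableU].
apply: le_lt_trans (mu_leU _ _) _ => //.
rewrite [e]splitr EFinD; apply: lee_ltD => //.
  rewrite ge0_fin_numE//; exact: mu_fin_meas.
apply: (@le_trans _ _ (\sum_(0 <= n <oo) mu (U n `\` C n))%E).
  by apply: measure_sigma_subadditive => // n; exact: measurableD.
apply: (@le_trans _ _ (\sum_(0 <= n <oo) (en n)%:E)%E).
  by apply: lee_nneseries => // n _ ; have [_ _ _ _ /ltW] := hCU n.
by apply: epsilon_trick0; rewrite divr_ge0// ltW.
Qed.

Lemma borel_regular B : measurable B -> regular_set B.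
Proof.
move=> mB; suff : measurable B -> regular_set B by apply.
apply: smallest_sub; last exact: open_regular.
split.
- by apply: open_regular; exact: open0.
- by move=> A hA; rewrite setTD; exact: regular_setC.
- by move=> F hF; exact: regular_bigcup.
Qed.

Lemma compact_approx (B : set (borelT X)) (e : R) : measurable B -> 0 < e ->
  exists2 K : set X, compact K /\ K `<=` B & (mu (B `\` K) < e%:E)%E.
Proof.
move=> mB e0; have [_ /(_ _ e0)[C [U [cC oU CB BU h]]]] := borel_regular mB.
exists C; first by split=> //; exact: closed_cpt.
apply: le_lt_trans h; apply: le_measure; rewrite ?inE.
- by apply: measurableD => //; exact: closed_meas.
- by apply: measurableD; [exact: open_meas|exact: closed_meas].
- exact: setSD.
Qed.

Lemma open_approx (B : set (borelT X)) (e : R) : measurable B -> 0 < e ->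
  exists2 U : set X, open U /\ B `<=` U & (mu U <= mu B + e%:E)%E.
Proof.
move=> mB e0; have [_ /(_ _ e0)[C [U [cC oU CB BU h]]]] := borel_regular mB.
have mU := open_meas oU; have mC := closed_meas cC.
exists U => //.
have -> : U = (B `|` (U `\` C)) `&` U.
  apply/seteqP; split=> [x Ux|x [_ //]]; split=> //.
  by have [Cx|nCx] := pselect (C x); [left; exact: CB|right].
have mBU : measurable (B `|` (U `\` C)) by apply: measurableU => //; exact: measurableD.
apply: (@le_trans _ _ (mu (B `|` (U `\` C)))).
  by apply: le_measure; rewrite ?inE//; exact: measurableI.
apply: le_trans (mu_leU _ _) _ => //; first exact: measurableD.
by rewrite leeD2l// ltW.
Qed.

(** Contains the complement of the support. Off this set every ball has positive measure, so the
    averages divide by a nonzero number. *)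
Definition null_points : set X := [set x | exists2 r : R, 0 < r & mu (oball d x r) = 0%E].

Lemma open_null_points : open null_points.
Proof.
apply/open_oballP => x [r r0 hr]; exists (r / 2); first by rewrite divr_gt0.
move=> y; rewrite /oball /= => hy; exists (r / 2); first by rewrite divr_gt0.
apply/eqP; rewrite eq_le measure_ge0 andbT -hr; apply: le_measure; rewrite ?inE; try exact: meas_oball.
by move=> z; rewrite /oball /= => hz; have := d_tri x y z; lra.
Qed.

(** By inner regularity it suffices to treat compact subsets, which finitely many null balls
    cover. *)
Lemma mu_null_points : mu null_points = 0%E.
Proof.
have mN := open_meas open_null_points.
apply/eqP; rewrite eq_le measure_ge0 andbT; apply/lee_addgt0Pr => e e0; rewrite add0e.
have [K [cK KN] h] := compact_approx mN e0.
have mK : measurable (K : set (borelT X)).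
  by apply: closed_meas; apply: compact_closed => //; exact: hausX.
suff K0 : mu K = 0%E.
  have -> : null_points = K `|` (null_points `\` K) by rewrite setDUK.
  apply: le_trans (mu_leU _ _) _ => //; first exact: measurableD.
  by rewrite K0 add0e ltW.
have /choice[r hr] : forall x, exists r : R, null_points x ->
    0 < r /\ mu (oball d x r) = 0%E.
  move=> x.
  have [[r r0 h0]|nx] := pselect (null_points x); first by exists r.
  by exists 0 => /nx.
have := cK; rewrite compact_cover => /(_ X null_points (fun x => oball d x (r x))).
case=> [x _|x Kx|D' D'N KD']; first exact: open_oball.
  by exists x; [exact: KN|rewrite /oball /= dxx; have [] := hr x (KN _ Kx)].
apply/eqP; rewrite eq_le measure_ge0 andbT.
have [mU U0] : measurable (\big[setU/set0]_(i <- finmap.enum_fset D') oball d i (r i) : set (borelT X)) /\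
    mu (\big[setU/set0]_(i <- finmap.enum_fset D') oball d i (r i)) = 0%E.
  rewrite big_seq; apply: (big_ind (fun A : set (borelT X) => measurable A /\ mu A = 0%E)).
  - by split=> //; rewrite measure0.
  - move=> A B [mA A0] [mB B0]; split; first exact: measurableU.
    apply/eqP; rewrite eq_le measure_ge0 andbT.
    by apply: le_trans (mu_leU _ _) _ => //; rewrite A0 B0 adde0.
  - move=> i iD; split; first exact: meas_oball.
    have : null_points i by apply/set_mem; exact: D'N.
    by move=> /hr[].
rewrite -U0; apply: le_measure; rewrite ?inE// => x /KD'.
by rewrite /cover /= bigcup_fset.
Qed.

Lemma supp_null_points x : ~ supp mu x -> null_points x.
Proof.
move=> nx; apply: contrapT => h; apply: nx => F [cF F0]; apply: contrapT => nFx.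
have /open_oballP/(_ x nFx)[e e0 he] : open (~` F) by rewrite openC.
apply: h; exists e => //; apply/eqP; rewrite eq_le measure_ge0 andbT -F0.
apply: le_measure; rewrite ?inE//; first exact: meas_oball.
by apply: measurableC; exact: closed_meas.
Qed.

Lemma ae_supp : {ae mu, forall x : borelT X, supp mu x /\ ~ null_points x}.
Proof.
exists null_points; split; [exact: open_meas open_null_points | exact: mu_null_points |].
move=> x /= h; apply: contrapT => nx; apply: h; split=> //.
by apply: contrapT => /supp_null_points.
Qed.

End CompactMetric.

Section LimInf.
Context {R : realType}.
Implicit Types (u : nat -> \bar R) (v : \bar R).
Local Open Scope ereal_scope.

Lemma limn_einf_sup u : limn_einf u = ereal_sup (range (einfs u)).
Proof.
rewrite limn_einf_lim; apply/cvg_lim => //; apply: ereal_nondecreasing_cvgn.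
exact: nondecreasing_einfs.
Qed.

Lemma limn_einf_ge u v n0 : (forall n, (n0 <= n)%N -> v <= u n) -> v <= limn_einf u.
Proof.
move=> h; rewrite limn_einf_sup; apply: le_ereal_sup_tmp; exists (einfs u n0); first by exists n0.
by apply: le_ereal_inf_tmp => _ [n /= hn <-]; exact: h.
Qed.

Lemma lt_limn_einf u v : v < limn_einf u -> exists n0, forall n, (n0 <= n)%N -> v < u n.
Proof.
rewrite limn_einf_sup => /ereal_sup_gt[_ [n0 _ <-] h]; exists n0 => n hn.
by apply: lt_le_trans h _; apply: ereal_inf_lbound; exists n.
Qed.

Lemma limn_einf_lt u v n0 : limn_einf u < v -> exists2 n, (n0 <= n)%N & u n < v.
Proof.
move=> h; apply: contrapT => hn; move: h; apply/negP; rewrite -leNgt.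
apply: (@limn_einf_ge _ _ n0) => n n0n; rewrite leNgt; apply/negP => hlt; apply: hn.
by exists n.
Qed.

End LimInf.

(** * Rational combinations and measurability of projected matrix fields *)

Section RationalSpan.
Context {R : realType} {m N : nat}.
Implicit Types (b : nat -> 'M[R]_(m, N)) (s : seq rat).

(** Coefficients form a [seq rat], a countable type, so [unpickle] enumerates a dense part of the
    span. *)
Definition ratcomb b s : 'M[R]_(m, N) := \sum_(k < size s) ratr s`_k *: b k.

Lemma seqspan_ratcomb b s : seqspan b (ratcomb b s).
Proof. by exists (size s), (fun k => ratr s`_k). Qed.

Lemma ratcomb_dense b z (e : R) : seqspan b z -> 0 < e ->
  exists s, fnorm (z - ratcomb b s) < e.
Proof.
move=> [n [c ->]] e0.
(* Coefficient errors below e / K give a total error below e; the summand 1 keeps K positive and the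
   inequality strict. *)
pose K := (m * N)%:R * (\sum_(k < n) fnorm (b k)) + 1.
have S0 : 0 <= \sum_(k < n) fnorm (b k) by apply: sumr_ge0 => k _; exact: fnorm_ge0.
have K0 : 0 < K by rewrite ltr_pwDr// mulr_ge0.
pose eta := e / K; have eta0 : 0 < eta by rewrite divr_gt0.
have /choice[q hq] : forall k, exists q : rat, `|c k - ratr q| < eta.
  move=> k; have /rat_in_itvoo[q] : c k - eta < c k + eta by lra.
  by rewrite in_itv /= => /andP[h1 h2]; exists q; rewrite ltr_distlC; apply/andP; split; lra.
exists (mkseq q n).
have -> : ratcomb b (mkseq q n) = \sum_(k < n) ratr (q k) *: b k.
  rewrite /ratcomb -(big_mkord xpredT (fun k => ratr (mkseq q n)`_k *: b k)) size_mkseq.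
  by rewrite big_mkord; apply: eq_bigr => k _; rewrite nth_mkseq.
rewrite -sumrB.
apply: (@le_lt_trans _ _ ((m * N)%:R * (eta * \sum_(k < n) fnorm (b k)))).
  apply: fnorm_le_entries; first by rewrite mulr_ge0// ltW.
  move=> i j; rewrite summxE mulr_sumr; apply: le_trans (ler_norm_sum _ _ _) _.
  apply: ler_sum => k _; rewrite -scalerBl mxE normrM; apply: ler_pM => //.
    by rewrite ltW.
  exact: normr_le_fnorm.
rewrite mulrCA /eta -mulrA -[ltRHS]mulr1 ltr_pM2l// mulrC ltr_pdivrMr// mul1r /K.
by rewrite ltrDl.
Qed.

(** Strict sublevel sets of the projected norm become countable unions. *)
Lemma fnorm_projT_lt b xi (a : R) :
  fnorm (projT (seqspan b) xi) ^+ 2 < a <-> exists s, fnorm (xi - ratcomb b s) ^+ 2 < a.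
Proof.
split=> [h|[s hs]]; last first.
  by apply: le_lt_trans hs; rewrite (sqr_fnorm_projT xi (seqspan_ratcomb b s)) lerDl sqr_ge0.
pose e := Num.sqrt (a - fnorm (projT (seqspan b) xi) ^+ 2).
have e0 : 0 < e by rewrite sqrtr_gt0 subr_gt0.
have [s hs] := ratcomb_dense (projTP b xi).1 e0; exists s.
rewrite (sqr_fnorm_projT xi (seqspan_ratcomb b s)) addrC -ltrBrDr.
rewrite -[ltRHS]sqr_sqrtr ?subr_ge0 ?(ltW h)//.
by rewrite ltr_pXn2r ?nnegrE ?fnorm_ge0 ?sqrtr_ge0.
Qed.

End RationalSpan.

Section MatrixMeasurability.
Context {R : realType} {X : pseudoPMetricType R}.
Implicit Types a b : nat.

Lemma mmeas_cst a b (A : 'M[R]_(a, b)) : mmeas (fun _ : X => A).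
Proof. by move=> i j; exact: measurable_cst. Qed.

Lemma mmeasD a b (f g : X -> 'M[R]_(a, b)) : mmeas f -> mmeas g -> mmeas (fun x => f x + g x).
Proof.
move=> mf mg i j; under eq_fun do rewrite mxE.
by apply: measurable_funD; [exact: mf|exact: mg].
Qed.

Lemma mmeasZ a b (k : X -> R) (f : X -> 'M[R]_(a, b)) :
  measurable_fun [set: borelT X] (k : borelT X -> R) -> mmeas f ->
  mmeas (fun x => k x *: f x).
Proof.
move=> mk mf i j; under eq_fun do rewrite mxE.
by apply: measurable_funM; [exact: mk|exact: mf].
Qed.

Lemma mmeasB a b (f g : X -> 'M[R]_(a, b)) : mmeas f -> mmeas g -> mmeas (fun x => f x - g x).
Proof.
move=> mf mg i j; under eq_fun do rewrite !mxE.
by apply: measurable_funB; [exact: mf|exact: mg].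
Qed.

Lemma mmeas_sum a b n (f : nat -> X -> 'M[R]_(a, b)) : (forall k, mmeas (f k)) ->
  mmeas (fun x => \sum_(k < n) f k x).
Proof.
move=> mf; elim: n => [|n IH].
  by under eq_fun do rewrite big_ord0; exact: mmeas_cst.
by under eq_fun do rewrite big_ord_recr /=; apply: mmeasD.
Qed.

Lemma measurable_sqr_fnorm a b (f : X -> 'M[R]_(a, b)) : mmeas f ->
  measurable_fun [set: borelT X] (fun x : borelT X => fnorm (f x) ^+ 2).
Proof.
move=> mf; under eq_fun do rewrite sqr_fnorm /frob.
have -> : (fun x : borelT X => \sum_(i < a) \sum_(j < b) f x i j * f x i j) =
  (fun x => \sum_(i <- enum 'I_a) \sum_(j <- enum 'I_b) f x i j * f x i j).
  by apply/funext => x; rewrite big_enum; apply: eq_bigr => i _; rewrite big_enum.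
apply: measurable_sum => i; apply: measurable_sum => j.
by apply: measurable_funM; exact: mf.
Qed.

Lemma measurable_fnorm a b (f : X -> 'M[R]_(a, b)) : mmeas f ->
  measurable_fun [set: borelT X] (fun x : borelT X => fnorm (f x)).
Proof.
move=> mf.
have -> : (fun x : borelT X => fnorm (f x)) = (fun x => Num.sqrt (fnorm (f x) ^+ 2)).
  by apply/funext => x; rewrite sqrtr_sqr ger0_norm// fnorm_ge0.
apply: (measurableT_comp (f := (Num.sqrt : R -> R))); last exact: measurable_sqr_fnorm.
by apply: continuous_measurable_fun; exact: sqrt_continuous.
Qed.

Lemma measurable_fpow a b (p : R) (f : X -> 'M[R]_(a, b)) : mmeas f ->
  measurable_fun [set: borelT X] (fun x : borelT X => fnorm (f x) `^ p).
Proof.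
move=> mf; apply: (measurableT_comp (f := @powR R ^~ p)) => //.
exact: measurable_fnorm.
Qed.

Lemma mmeas_ratcomb a b (B : nat -> X -> 'M[R]_(a, b)) s : (forall k, mmeas (B k)) ->
  mmeas (fun x => ratcomb (fun k => B k x) s).
Proof.
move=> mB; apply: (@mmeas_sum _ _ (size s) (fun k x => ratr s`_k *: B k x)) => k.
by apply: mmeasZ.
Qed.

(** Polarization ([projT_entry]) reduces entries to squared norms of projections, whose strict
    sublevel sets are countable unions over rational combinations. *)
Lemma mmeas_projT a b (B : nat -> X -> 'M[R]_(a, b)) (G : X -> 'M[R]_(a, b)) :
  (forall k, mmeas (B k)) -> mmeas G ->
  mmeas (fun x => projT (seqspan (fun k => B k x)) (G x)).
Proof.
move=> mB mG.
have key H : mmeas H -> measurable_fun [set: borelT X]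
    (fun x : borelT X => fnorm (projT (seqspan (fun k => B k x)) (H x)) ^+ 2).
  move=> mH; apply: (measurability _ (RGenInftyO.measurableE R)).
  move=> _ [_ [r ->] <-]; rewrite setTI.
  rewrite [X in measurable X](_ : _ =
    \bigcup_(n : nat) [set x | exists2 s : seq rat, unpickle n = Some s &
        fnorm (H x - ratcomb (fun k => B k x) s) ^+ 2 < r]); last first.
    apply/seteqP; split=> x /=; rewrite in_itv/=.
      by move=> /fnorm_projT_lt [s hs]; exists (pickle s) => //=; exists s; rewrite ?pickleK.
    by move=> [n _ [s _ hs]]; apply/fnorm_projT_lt; exists s.
  apply: bigcupT_measurable => n.
  case E : (unpickle n : option (seq rat)) => [s|]; last first.
    rewrite (_ : [set _ | _] = set0)//; apply/seteqP; split=> x //= -[s].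
  rewrite (_ : [set _ | _] = [set x | fnorm (H x - ratcomb (fun k => B k x) s) ^+ 2 < r]).
    have := measurable_sqr_fnorm (mmeasB mH (mmeas_ratcomb s mB)).
    move=> /(_ measurableT `]-oo, r[%classic (measurable_itv _)); rewrite setTI.
    by congr measurable; apply/seteqP; split=> x /=; rewrite in_itv.
  by apply/seteqP; split=> x /=; [move=> [s' [<-]]|exists s].
move=> i j; under eq_fun do rewrite projT_entry.
apply: measurable_funM; last exact: measurable_cst.
apply: measurable_funB; apply: key.
  by apply: mmeasD => //; exact: mmeas_cst.
by apply: mmeasB => //; exact: mmeas_cst.
Qed.

End MatrixMeasurability.

(** Used with k = 2 [^ p, the constant of the quasi-triangle inequality; this is the origin of the
    recurring threshold]e / (2 [^ p * 2)]. *)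
Lemma lte_half2 (R : realType) (k e : R) (x y : \bar R) : 0 < k ->
  (x < (e / (k * 2))%:E)%E -> (y < (e / (k * 2))%:E)%E -> (k%:E * (x + y) < e%:E)%E.
Proof.
move=> k0; have -> : (e%:E = k%:E * ((e / (k * 2))%:E + (e / (k * 2))%:E))%E.
  by rewrite -EFinD -EFinM invfM mulrA -splitr mulrCA mulfV ?mulr1// gt_eqF.
move: (e / (k * 2)) => t xt yt; rewrite lte_pmul2l ?lte_fin//; exact: lteD.
Qed.

(** * Integrals of nonnegative functions and L^p distances *)

Section RealIntegrals.
Context {R : realType} {X : pseudoPMetricType R} {mu : {measure set (borelT X) -> \bar R}}.
Implicit Types (A B : set X) (f g : X -> R).

Definition measX A := measurable (A : set (borelT X)).
Definition rmeas f := measurable_fun [set: borelT X] (f : borelT X -> R).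

Lemma rmeasE A f : rmeas f -> measurable_fun (A : set (borelT X)) (fun x : borelT X => (f x)%:E).
Proof. by move=> mf; apply/measurable_EFinP; apply: measurable_funS mf. Qed.

Lemma rmeasD f g : rmeas f -> rmeas g -> rmeas (fun x => f x + g x).
Proof. exact: measurable_funD. Qed.

Lemma rmeasB f g : rmeas f -> rmeas g -> rmeas (fun x => f x - g x).
Proof. exact: measurable_funB. Qed.

Lemma rmeasZ k f : rmeas f -> rmeas (fun x => k * f x).
Proof. exact: measurable_funM. Qed.

Lemma rmeas_cst (k : R) : rmeas (fun=> k).
Proof. exact: measurable_cst. Qed.

Lemma int_ge0 A f : (forall x, 0 <= f x) -> (0 <= \int[mu]_(x in A) (f x)%:E)%E.
Proof. by move=> f0; apply: integral_ge0 => x _; rewrite lee_fin. Qed.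

Lemma intD A f g : measX A -> rmeas f -> rmeas g -> (forall x, 0 <= f x) -> (forall x, 0 <= g x) ->
  (\int[mu]_(x in A) (f x + g x)%:E =
   \int[mu]_(x in A) (f x)%:E + \int[mu]_(x in A) (g x)%:E)%E.
Proof.
move=> mA mf mg f0 g0; rewrite -ge0_integralD//.
- by move=> x _; rewrite lee_fin.
- exact: rmeasE.
- by move=> x _; rewrite lee_fin.
- exact: rmeasE.
Qed.

Lemma intZ A k f : measX A -> rmeas f -> (forall x, 0 <= f x) -> 0 <= k ->
  (\int[mu]_(x in A) (k * f x)%:E = k%:E * \int[mu]_(x in A) (f x)%:E)%E.
Proof.
move=> mA mf f0 k0; rewrite -ge0_integralZl_EFin//.
- by move=> x _; rewrite lee_fin.
- exact: rmeasE.
Qed.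

Lemma int_cst A (k : R) : measX A -> (\int[mu]_(x in A) k%:E = k%:E * mu A)%E.
Proof. by move=> mA; exact: integral_cst. Qed.

Lemma int_le_ae A f g : measX A -> rmeas f -> rmeas g -> (forall x, 0 <= f x) ->
  (forall x, 0 <= g x) -> {ae mu, forall x : borelT X, A x -> f x <= g x} ->
  (\int[mu]_(x in A) (f x)%:E <= \int[mu]_(x in A) (g x)%:E)%E.
Proof.
move=> mA mf mg f0 g0 fg; apply: ae_ge0_le_integral => //.
- by move=> x _; rewrite lee_fin.
- exact: rmeasE.
- by move=> x _; rewrite lee_fin.
- exact: rmeasE.
Qed.

Lemma int_eq_ae A f g : measX A -> rmeas f -> rmeas g -> (forall x, 0 <= f x) ->
  (forall x, 0 <= g x) -> {ae mu, forall x : borelT X, A x -> f x = g x} ->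
  (\int[mu]_(x in A) (f x)%:E = \int[mu]_(x in A) (g x)%:E)%E.
Proof.
move=> mA mf mg f0 g0 fg; apply/eqP; rewrite eq_le.
by apply/andP; split; apply: int_le_ae => //; apply: filterS fg => x h Ax; rewrite h.
Qed.

Lemma int_le A f g : measX A -> rmeas f -> rmeas g -> (forall x, 0 <= f x) ->
  (forall x, A x -> f x <= g x) ->
  (\int[mu]_(x in A) (f x)%:E <= \int[mu]_(x in A) (g x)%:E)%E.
Proof.
move=> mA mf mg f0 fg; apply: ge0_le_integral => //.
- by move=> x _; rewrite lee_fin.
- exact: rmeasE.
- exact: rmeasE.
Qed.

Lemma int_subset A B f : measX A -> measX B -> rmeas f -> (forall x, 0 <= f x) -> A `<=` B ->
  (\int[mu]_(x in A) (f x)%:E <= \int[mu]_(x in B) (f x)%:E)%E.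
Proof.
move=> mA mB mf f0 AB; apply: ge0_subset_integral => //; first exact: rmeasE.
by move=> x _; rewrite lee_fin.
Qed.

Lemma int_splitD A B f : measX A -> measX B -> rmeas f -> (forall x, 0 <= f x) -> B `<=` A ->
  (\int[mu]_(x in A) (f x)%:E =
   \int[mu]_(x in B) (f x)%:E + \int[mu]_(x in A `\` B) (f x)%:E)%E.
Proof.
move=> mA mB mf f0 BA; rewrite -{1}(setDUK BA) ge0_integral_setU//.
- exact: measurableD.
- exact: rmeasE.
- by move=> x _; rewrite lee_fin.
- by rewrite disj_set2E setDIK.
Qed.

End RealIntegrals.

Section LpIntegrals.
Context {R : realType} {X : pseudoPMetricType R} {d : X -> X -> R}
  {mu : {measure set (borelT X) -> \bar R}} (HX : compact_metric d mu)
  (p : R) (p1 : 1 < p).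
Let p0 : 0 < p := lt_trans ltr01 p1.

Definition Ip {a b : nat} (A : set X) (f : X -> 'M[R]_(a, b)) : \bar R :=
  (\int[mu]_(x in A) (fnorm (f x) `^ p)%:E)%E.

Lemma Ip_ge0 a b A (f : X -> 'M[R]_(a, b)) : (0 <= Ip A f)%E.
Proof. by apply: integral_ge0 => x _; rewrite lee_fin powR_ge0. Qed.

Lemma mfpow a b A (f : X -> 'M[R]_(a, b)) : mmeas f ->
  measurable_fun (A : set (borelT X)) (fun x : borelT X => (fnorm (f x) `^ p)%:E).
Proof.
move=> mf; apply/measurable_EFinP; apply: measurable_funS (measurable_fpow p mf) => //.
Qed.

Lemma IpD a b A (f g : X -> 'M[R]_(a, b)) : measX A -> mmeas f -> mmeas g ->
  (Ip A (fun x => f x + g x)%R <= (2 `^ p)%:E * (Ip A f + Ip A g))%E.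
Proof.
move=> mA mf mg; rewrite /Ip -ge0_integralD//; last 4 first.
- by move=> x _; rewrite lee_fin powR_ge0.
- exact: mfpow.
- by move=> x _; rewrite lee_fin powR_ge0.
- exact: mfpow.
rewrite -ge0_integralZl_EFin ?powR_ge0//; last 2 first.
- by move=> x _; rewrite -EFinD lee_fin addr_ge0 ?powR_ge0.
- by apply: emeasurable_funD; exact: mfpow.
apply: ge0_le_integral => //.
- by move=> x _; rewrite lee_fin powR_ge0.
- by apply: mfpow; exact: mmeasD.
- by apply: measurable_funeM; apply: emeasurable_funD; exact: mfpow.
- by move=> x _; rewrite -EFinD -EFinM lee_fin fpowD.
Qed.

Lemma IpN a b A (f : X -> 'M[R]_(a, b)) : Ip A (fun x => - f x) = Ip A f.
Proof. by apply: eq_integral => x _; rewrite fnormN. Qed.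

Lemma IpB a b A (f g : X -> 'M[R]_(a, b)) : measX A -> mmeas f -> mmeas g ->
  (Ip A (fun x => f x - g x)%R <= (2 `^ p)%:E * (Ip A f + Ip A g))%E.
Proof.
move=> mA mf mg; rewrite -(IpN A g); apply: IpD => //.
by move=> i j; under eq_fun do rewrite mxE; apply: measurableT_comp => //; exact: mg.
Qed.

Lemma Ip_subset a b A B (f : X -> 'M[R]_(a, b)) : measX A -> measX B -> mmeas f ->
  A `<=` B -> (Ip A f <= Ip B f)%E.
Proof.
move=> mA mB mf AB; apply: ge0_subset_integral => //; first exact: mfpow.
by move=> x _; rewrite lee_fin powR_ge0.
Qed.

Lemma Ip_le a b a' b' A (f : X -> 'M[R]_(a, b)) (g : X -> 'M[R]_(a', b')) :
  measX A -> mmeas f -> mmeas g ->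
  {ae mu, forall x : borelT X, A x -> fnorm (f x) <= fnorm (g x)} ->
  (Ip A f <= Ip A g)%E.
Proof.
move=> mA mf mg h; apply: ae_ge0_le_integral => //.
- by move=> x _; rewrite lee_fin powR_ge0.
- exact: mfpow.
- by move=> x _; rewrite lee_fin powR_ge0.
- exact: mfpow.
apply: filterS h => x h Ax; rewrite lee_fin ge0_ler_powR ?nnegrE ?fnorm_ge0 ?(ltW p0)//.
exact: h.
Qed.

Lemma Ip_ae_eq a b A (f g : X -> 'M[R]_(a, b)) : measX A -> mmeas f -> mmeas g ->
  {ae mu, forall x : borelT X, A x -> f x = g x} -> Ip A f = Ip A g.
Proof.
move=> mA mf mg h; apply/eqP; rewrite eq_le; apply/andP; split; apply: Ip_le => //;
  by apply: filterS h => x h Ax; rewrite h.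
Qed.

Lemma lpdistE a b (f g : X -> 'M[R]_(a, b)) : lpdist mu p f g = Ip setT (fun x => f x - g x).
Proof. by []. Qed.

Lemma lpdistC a b (f g : X -> 'M[R]_(a, b)) : lpdist mu p f g = lpdist mu p g f.
Proof. by apply: eq_integral => x _; rewrite fnormB. Qed.

Lemma lpdistxx a b (f : X -> 'M[R]_(a, b)) : lpdist mu p f f = 0%E.
Proof.
apply: integral0_eq => x _; rewrite subrr fnorm0 powR0//; exact: lt0r_neq0.
Qed.

Lemma lpdist_tri a b (f g h : X -> 'M[R]_(a, b)) : mmeas f -> mmeas g -> mmeas h ->
  (lpdist mu p f h <= (2 `^ p)%:E * (lpdist mu p f g + lpdist mu p g h))%E.
Proof.
move=> mf mg mh; rewrite !lpdistE.
have -> : (fun x => f x - h x) = (fun x => (f x - g x) + (g x - h x)).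
  by apply/funext => x; rewrite addrA subrK.
by apply: IpD; [exact: measurableT|exact: mmeasB|exact: mmeasB].
Qed.

Lemma lpdist_lt_tri a b (f g h : X -> 'M[R]_(a, b)) (e : R) : mmeas f -> mmeas g -> mmeas h ->
  (lpdist mu p f g < (e / (2 `^ p * 2))%:E)%E -> (lpdist mu p g h < (e / (2 `^ p * 2))%:E)%E ->
  (lpdist mu p f h < e%:E)%E.
Proof.
move=> mf mg mh h1 h2; apply: le_lt_trans (lpdist_tri mf mg mh) _.
by apply: lte_half2 => //; rewrite powR_gt0.
Qed.

Lemma cvgLpP a b (fn : nat -> X -> 'M[R]_(a, b)) f : cvgLp mu p fn f <->
  forall e : R, 0 < e -> exists n0, forall n, (n0 <= n)%N -> (lpdist mu p (fn n) f < e%:E)%E.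
Proof.
split=> [h e e0|h].
  have e0' : (0 < e%:E)%E by rewrite lte_fin.
  have [n0 _ hn] := h _ (open_ereal_lt' e0').
  by exists n0 => n; exact: hn.
have h0 n : (0 <= lpdist mu p (fn n) f)%E by exact: Ip_ge0.
apply/fine_cvgP; split.
  have [n0 hn] := h 1 ltr01; exists n0 => // n /= /hn h1.
  by rewrite ge0_fin_numE//; apply: lt_trans h1 _; exact: ltry.
apply/cvgrPdist_lt => e e0; have [n0 hn] := h e e0; exists n0 => // n /= /hn h1.
rewrite sub0r normrN ger0_norm ?fine_ge0// -lte_fin fineK// ge0_fin_numE//.
by apply: lt_trans h1 _; exact: ltry.
Qed.

Lemma cvgLp_cst a b (f : X -> 'M[R]_(a, b)) : cvgLp mu p (fun=> f) f.
Proof. by apply/cvgLpP => e e0; exists 0%N => n _; rewrite lpdistxx lte_fin. Qed.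

Lemma cvgLpD a b (fn gn : nat -> X -> 'M[R]_(a, b)) f g :
  (forall n, mmeas (fn n)) -> (forall n, mmeas (gn n)) -> mmeas f -> mmeas g ->
  cvgLp mu p fn f -> cvgLp mu p gn g ->
  cvgLp mu p (fun n x => fn n x + gn n x) (fun x => f x + g x).
Proof.
move=> mfn mgn mf mg /cvgLpP hf /cvgLpP hg; apply/cvgLpP => e e0.
have K0 : 0 < 2 `^ p :> R by rewrite powR_gt0.
have e0' : 0 < e / (2 `^ p * 2) by rewrite divr_gt0// mulr_gt0.
have [n1 h1] := hf _ e0'; have [n2 h2] := hg _ e0'.
exists (maxn n1 n2) => n; rewrite geq_max => /andP[/h1 l1 /h2 l2].
rewrite lpdistE; have -> : (fun x => fn n x + gn n x - (f x + g x)) =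
    (fun x => (fn n x - f x) + (gn n x - g x)).
  by apply/funext => x; rewrite opprD addrACA.
apply: le_lt_trans (IpD _ _ _) _ => //; [exact: measurableT|exact: mmeasB|exact: mmeasB|].
exact: (lte_half2 K0 l1 l2).
Qed.

(* Along a fast L^p-convergent sequence of arguments the arguments converge a.e.; Fatou is
   applied to the growth bound minus the integrand. *)
Lemma nemytskii_usc a b (h : X -> 'M[R]_(a, b) -> R) (c : R) :
  0 <= c -> (forall x xi, 0 <= h x xi) -> (forall x xi, h x xi <= c * (1 + fnorm xi `^ p)) ->
  (forall G, mmeas G -> measurable_fun [set: borelT X] (fun x : borelT X => h x (G x))) ->
  {ae mu, forall x : borelT X, forall (xi : 'M[R]_(a, b)) (e : R), 0 < e -> exists2 del : R, 0 < del &
     forall xi' : 'M[R]_(a, b), fnorm (xi' - xi) < del -> h x xi' < h x xi + e} ->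
  forall A G (M : R), measX A -> mmeas G -> (Ip setT G < +oo)%E ->
  (\int[mu]_(x in A) (h x (G x))%:E < M%:E)%E ->
  exists2 del : R, 0 < del & forall G', mmeas G' -> (lpdist mu p G' G < del%:E)%E ->
    (\int[mu]_(x in A) (h x (G' x))%:E < M%:E)%E.
Proof.
move=> c0 h0 hc mh usc A G M mA mG IG hM; apply: contrapT => hn.
(* Summable errors: the series S of the p-th powers is then integrable, hence finite a.e., and its
   terms tend to 0. *)
pose en (n : nat) : R := 1 / (2 ^ n.+1)%:R.
have en0 n : 0 < en n by rewrite divr_gt0// ltr0n expn_gt0.
have /choice[Gn hGn] : forall n, exists G', [/\ mmeas G', (lpdist mu p G' G < (en n)%:E)%E &
    (M%:E <= \int[mu]_(x in A) (h x (G' x))%:E)%E].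
  move=> n; apply: contrapT => hG; apply: hn; exists (en n) => // G' mG' lG'.
  by rewrite ltNge; apply/negP => hle; apply: hG; exists G'.
have mGn n : mmeas (Gn n) by have [] := hGn n.
have ldn n : (lpdist mu p (Gn n) G < (en n)%:E)%E by have [] := hGn n.
have Mn n : (M%:E <= \int[mu]_(x in A) (h x (Gn n x))%:E)%E by have [] := hGn n.
pose D n x := fnorm (Gn n x - G x) `^ p.
have D0 n x : 0 <= D n x by exact: powR_ge0.
have mD n : measurable_fun [set: borelT X] (D n : borelT X -> R).
  by apply: measurable_fpow; exact: mmeasB.
pose S (x : borelT X) : \bar R := (\sum_(n <oo) (D n x)%:E)%E.
have mS : measurable_fun setT S.
  apply: ge0_emeasurable_sum => [n x _ _|n _]; first by rewrite lee_fin.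
  exact/measurable_EFinP.
have S0 x : (0 <= S x)%E by apply: nneseries_ge0 => n _ _; rewrite lee_fin.
have IS : (\int[mu]_x S x < +oo)%E.
  rewrite integral_nneseries//; last 2 first.
  - by move=> n; exact/measurable_EFinP.
  - by move=> n x _; rewrite lee_fin.
  apply: (@le_lt_trans _ _ (\sum_(n <oo) (en n)%:E)%E).
    apply: lee_nneseries => n *; last exact/ltW/ldn.
    by apply: integral_ge0 => x _; rewrite lee_fin.
  by apply: le_lt_trans (epsilon_trick0 _ ler01) _; exact: ltry.
have Sfin : {ae mu, forall x : borelT X, S x \is a fin_num}.
  have /integrable_ae : mu.-integrable setT S.
    apply/integrableP; split => //.
    by under eq_integral => x _ do rewrite gee0_abs//.
  by move=> /(_ measurableT); apply: filterS => x; exact.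
have Dto x : S x \is a fin_num -> forall e : R, 0 < e -> exists n0, forall n, (n0 <= n)%N -> D n x < e.
  move=> Sx e e0.
  have Sx' : (S x < +oo)%E by rewrite ltey_eq Sx.
  have tl : (\sum_(N <= k <oo) (D k x)%:E)%E @[N --> \oo] --> 0%E.
    by apply: (@nneseries_tail_cvg R (fun k => (D k x)%:E) xpredT) => // n _; rewrite lee_fin.
  have e0' : (0 < e%:E)%E by rewrite lte_fin.
  have [n0 _ hn0] := tl _ (open_ereal_lt' e0'); exists n0 => n n0n.
  rewrite -lte_fin; apply: le_lt_trans (hn0 n n0n).
  rewrite (nneseries_split n 1); last by move=> k _; rewrite lee_fin.
  by rewrite addn1 big_nat1 leeDl//; apply: nneseries_ge0 => k _ _; rewrite lee_fin.
have K1 : 1 <= 2 `^ p :> R.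
  by rewrite -[leLHS](powRr0 2); apply: ler_powR; [rewrite ler1n|exact: ltW].
have K0 : 0 < 2 `^ p :> R by rewrite powR_gt0.
pose g x := fnorm (G x) `^ p.
have g0 x : 0 <= g x by exact: powR_ge0.
have mg : measurable_fun [set: borelT X] (g : borelT X -> R) by exact: measurable_fpow.
pose bn n x := c * (1 + 2 `^ p * (g x + D n x)); pose b0 x := c * (1 + 2 `^ p * g x).
have mbn n : measurable_fun [set: borelT X] (bn n : borelT X -> R).
  apply: measurable_funM => //; apply: measurable_funD => //; apply: measurable_funM => //.
  exact: measurable_funD.
have mb0 : measurable_fun [set: borelT X] (b0 : borelT X -> R).
  by apply: measurable_funM => //; apply: measurable_funD => //; apply: measurable_funM.
have hbn n x : h x (Gn n x) <= bn n x.
  apply: le_trans (hc _ _) _; rewrite ler_wpM2l// lerD2l.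
  by have := fpowD p0 (G x) (Gn n x - G x); rewrite addrC subrK.
have hb x : h x (G x) <= b0 x.
  apply: le_trans (hc _ _) _; rewrite ler_wpM2l// lerD2l -[leLHS]mul1r.
  exact: ler_wpM2r (g0 x) _ _ K1.
have mA' : measurable (A : set (borelT X)) by [].
have mE (f : borelT X -> R) : measurable_fun setT f ->
    measurable_fun (A : set (borelT X)) (fun x => (f x)%:E).
  by move=> mf; apply/measurable_EFinP; apply: measurable_funS mf.
have Ib0 : (\int[mu]_(x in A) (b0 x)%:E < +oo)%E.
  apply: (@le_lt_trans _ _ (c%:E * (mu A + (2 `^ p)%:E * Ip A G))%E).
    have mKg : rmeas (fun x => 2 `^ p * g x) by exact: rmeasZ.
    have Kg0 x : 0 <= 2 `^ p * g x by rewrite mulr_ge0// ltW.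
    rewrite /Ip -(intZ mA mg g0 (ltW K0)).
    rewrite -(mul1e (mu A)) -(int_cst 1 mA) -intD//; last exact: rmeas_cst.
    rewrite -intZ//; first by apply: rmeasD => //; exact: rmeas_cst.
    by move=> x; rewrite addr_ge0.
  have IA : (Ip A G < +oo)%E by apply: le_lt_trans IG; apply: Ip_subset => //; exact: measurableT.
  rewrite lte_mul_pinfty ?lee_fin//.
  by rewrite lte_add_pinfty ?(mu_fin_meas HX)// lte_mul_pinfty// lee_fin ltW.
have b00 x : 0 <= b0 x by apply: le_trans (hb x).
have Ib0f : (\int[mu]_(x in A) (b0 x)%:E)%E \is a fin_num.
  by rewrite ge0_fin_numE// integral_ge0// => x _; rewrite lee_fin.
pose kn n x := bn n x - h x (Gn n x).
have kn0 n x : 0 <= kn n x by rewrite subr_ge0.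
have mkn n : measurable_fun [set: borelT X] (kn n : borelT X -> R).
  by apply: measurable_funB => //; exact: mh.
have liminf : {ae mu, forall x : borelT X,
    A x -> ((b0 x - h x (G x))%:E <= limn_einf (fun n => (kn n x)%:E))%E}.
  apply: filterS (filterI Sfin usc) => x [Sx uscx] _; apply/lee_subgt0Pr => e e0.
  have [del del0 hdel] := uscx (G x) e e0.
  have [n0 hn0] := Dto x Sx (del `^ p) (powR_gt0 _ del0).
  apply: (@limn_einf_ge _ _ _ n0) => n n0n; rewrite -EFinB lee_fin /kn.
  have nd : fnorm (Gn n x - G x) < del.
    rewrite ltNge; apply/negP => hle; have := hn0 n n0n; apply/negP; rewrite -leNgt.
    by rewrite /D ge0_ler_powR ?nnegrE ?fnorm_ge0 ?(ltW p0) ?(ltW del0).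
  have b0n : b0 x <= bn n x.
    by rewrite ler_wpM2l// lerD2l ler_wpM2l ?(ltW K0)// lerDl.
  by have := hdel _ nd; lra.
have Ik : (\int[mu]_(x in A) (b0 x - h x (G x))%:E <=
    limn_einf (fun n => \int[mu]_(x in A) (kn n x)%:E))%E.
  apply: le_trans (fatou _ _ _ _) => //; last 2 first.
  - by move=> n; exact: mE.
  - by move=> n x _; rewrite lee_fin.
  apply: ae_ge0_le_integral => //.
  - by move=> x _; rewrite lee_fin subr_ge0.
  - by apply: mE; apply: measurable_funB => //; exact: mh.
  - by move=> x _; apply: (@limn_einf_ge _ _ _ 0%N) => n _; rewrite lee_fin.
  - apply: (emeasurable_fun_cvg (fun n (x : borelT X) => einfs (fun k => (kn k x)%:E) n)).
      by move=> n; apply: measurable_fun_einfs => k; exact: mE.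
    by move=> x _; rewrite limn_einf_lim; exact: is_cvg_einfs.
have eB : (\int[mu]_(x in A) (b0 x)%:E = \int[mu]_(x in A) (b0 x - h x (G x))%:E +
    \int[mu]_(x in A) (h x (G x))%:E)%E.
  rewrite -intD//; first by under [RHS]eq_integral do rewrite subrK.
  - by apply: rmeasB => //; exact: mh.
  - exact: mh.
  - by move=> x; rewrite subr_ge0.
have eBn n : (\int[mu]_(x in A) (bn n x)%:E = \int[mu]_(x in A) (kn n x)%:E +
    \int[mu]_(x in A) (h x (Gn n x))%:E)%E.
  rewrite -(intD mA (mkn n) (mh _ (mGn n)) (kn0 n) (fun x => h0 x _)).
  by under [RHS]eq_integral do rewrite subrK.
(* The dominating functions [bn] vary with n, as in generalized dominated convergence; their
   integrals exceed that of [b0] by a multiple of the L^p error only. *)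
have eBn' n : (\int[mu]_(x in A) (bn n x)%:E <=
    \int[mu]_(x in A) (b0 x)%:E + (c * 2 `^ p * en n)%:E)%E.
  apply: (@le_trans _ _ (\int[mu]_(x in A) (b0 x)%:E + (c * 2 `^ p)%:E * lpdist mu p (Gn n) G)%E).
    rewrite lpdistE; apply: (@le_trans _ _ (\int[mu]_(x in A) (b0 x)%:E +
        (c * 2 `^ p)%:E * Ip A (fun x => Gn n x - G x)%R)%E); last first.
      rewrite leeD2l// lee_wpmul2l ?lee_fin ?mulr_ge0 ?(ltW K0)//.
      by apply: Ip_subset => //; [exact: measurableT|exact: mmeasB].
    have mcD : rmeas (fun x => c * 2 `^ p * D n x) by apply: rmeasZ; exact: mD.
    have cD0 x : 0 <= c * 2 `^ p * D n x by rewrite !mulr_ge0// ltW.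
    have kk : 0 <= c * 2 `^ p by rewrite mulr_ge0// ltW.
    rewrite /Ip -(intZ mA (mD n) (D0 n) kk) -intD//.
    apply: (int_le mA (mbn n) (rmeasD mb0 mcD)).
      by move=> x; apply: le_trans (hbn n x).
    by move=> x _; rewrite /bn /b0; rewrite le_eqVlt; apply/orP; left; apply/eqP; ring.
  rewrite leeD2l// (EFinM (c * 2 `^ p)); apply: lee_wpmul2l; last exact: ltW.
  by rewrite lee_fin mulr_ge0// ltW.
move: hM Ik Ib0f eB; set I := (\int[mu]_(x in A) (b0 x - h x (G x))%:E)%E.
set H := (\int[mu]_(x in A) (h x (G x))%:E)%E => hM Ik Ib0f eB.
have I0 : (0 <= I)%E by apply: integral_ge0 => x _; rewrite lee_fin subr_ge0.
have H0 : (0 <= H)%E by apply: integral_ge0 => x _; rewrite lee_fin.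
have Hf : H \is a fin_num by rewrite ge0_fin_numE//; apply: lt_trans hM _; exact: ltry.
have If : I \is a fin_num by move: Ib0f; rewrite eB fin_numD => /andP[].
have hM' : fine H < M by rewrite -lte_fin fineK.
(* Half of the gap goes to Fatou's lower bound, half to the excess of the dominating integrals. *)
pose eta := (M - fine H) / 2; have eta0 : 0 < eta by rewrite divr_gt0// subr_gt0.
have : ((fine I - eta)%:E < limn_einf (fun n => \int[mu]_(x in A) (kn n x)%:E))%E.
  by apply: lt_le_trans Ik; rewrite -(fineK If) lte_fin gtrBl.
move=> /lt_limn_einf[n0 hn0].
have cK0 : 0 <= c * 2 `^ p by rewrite mulr_ge0// ltW.
have [n n0n hnn] : exists2 n, (n0 <= n)%N & c * 2 `^ p * en n < eta.
  pose k := Num.bound (c * 2 `^ p / eta); exists (maxn n0 k); first exact: leq_maxl.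
  rewrite /en mulrA mulr1 ltr_pdivrMr ?ltr0n ?expn_gt0// -ltr_pdivrMl// mulrC.
  apply: lt_le_trans (_ : k%:R <= _); last first.
    rewrite ler_nat; apply: leq_trans (leq_maxr n0 k) _.
    by apply: leq_trans (leqnSn _) _; apply: ltnW; exact: ltn_expl.
  by have := archi_boundP (_ : 0 <= c * 2 `^ p / eta); apply; rewrite divr_ge0// ltW.
have := eBn' n; rewrite eBn; apply/negP; rewrite -ltNge.
apply: (@lt_le_trans _ _ ((fine I - eta)%:E + M%:E)%E); last by apply: leeD => //; exact/ltW/hn0.
rewrite eB -(fineK If) -(fineK Hf) -!EFinD lte_fin.
have : eta * 2 = M - fine H by rewrite /eta divfK.
by lra.
Qed.

End LpIntegrals.
Arguments Ip {R X} mu p {a b} A f.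

(** * Sobolev calculus *)

Record diff_algebra {R : realType} {X : pseudoPMetricType R} (d : X -> X -> R)
    (mu : {measure set (borelT X) -> \bar R}) (Alg : set (X -> R)) {N : nat}
    (D : (X -> R) -> X -> 'rV[R]_N) : Prop := DiffAlgebra {
  da_metric : compact_metric d mu ;
  da_cont : forall f, Alg f -> continuous f ;
  da_one : Alg (fun _ => 1) ;
  da_add : forall f g, Alg f -> Alg g -> Alg (fun x => f x + g x) ;
  da_mul : forall f g, Alg f -> Alg g -> Alg (fun x => f x * g x) ;
  da_scale : forall (a : R) f, Alg f -> Alg (fun x => a * f x) ;
  da_urysohn : forall K V : set X, compact K -> open V -> K `<=` V ->
     exists phi, Alg phi /\ (forall x, 0 <= phi x <= 1) /\
       (forall x, ~ V x -> phi x = 0) /\ (forall x, K x -> phi x = 1) ;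
  da_meas : forall f, Alg f ->
     (forall j, measurable_fun [set: borelT X] (fun x : borelT X => D f x ord0 j)) /\
     exists M : R, {ae mu, forall x : borelT X, fnorm (D f x) <= M} ;
  da_Dadd : forall f g, Alg f -> Alg g ->
     {ae mu, forall x : borelT X, D (fun y => f y + g y) x = D f x + D g x} ;
  da_Dscale : forall (a : R) f, Alg f ->
     {ae mu, forall x : borelT X, D (fun y => a * f y) x = a *: D f x} ;
  da_Dmul : forall f g, Alg f -> Alg g ->
     {ae mu, forall x : borelT X, D (fun y => f y * g y) x = f x *: D g x + g x *: D f x} }.

Section DiffAlgebra.
Context {R : realType} {X : pseudoPMetricType R} {d : X -> X -> R}
  {mu : {measure set (borelT X) -> \bar R}} {Alg : set (X -> R)} {N : nat}
  {D : (X -> R) -> X -> 'rV[R]_N} (H : diff_algebra d mu Alg D).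
Let HX := da_metric H.

Lemma Alg_cst c : Alg (fun _ => c).
Proof. by have := da_scale H c (da_one H); under eq_fun do rewrite mulr1. Qed.

Lemma Alg_opp f : Alg f -> Alg (fun x => - f x).
Proof. by move=> /(da_scale H (-1)); under eq_fun do rewrite mulN1r. Qed.

Lemma Alg_sub f g : Alg f -> Alg g -> Alg (fun x => f x - g x).
Proof. by move=> hf /Alg_opp; exact: (da_add H). Qed.

Lemma D_cst c : {ae mu, forall x : borelT X, D (fun _ => c) x = 0}.
Proof.
have h1 : {ae mu, forall x : borelT X, D (fun _ => 1) x = 0}.
  have := da_Dmul H (da_one H) (da_one H); apply: filterS => x.
  by rewrite mulr1 !scale1r => /eqP; rewrite -subr_eq0 opprD addNKr oppr_eq0 => /eqP.
have := da_Dscale H c (da_one H); apply: filterS2 h1 => x h1.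
by rewrite mulr1 h1 scaler0.
Qed.

Lemma rmeas_Alg f : Alg f -> rmeas f.
Proof. by move=> /(da_cont H); exact: continuous_meas. Qed.

Lemma D_bounded f : Alg f -> exists2 M : R, 0 <= M & {ae mu, forall x : borelT X, fnorm (D f x) <= M}.
Proof.
move=> /(da_meas H)[_ [M hM]]; exists (Num.max M 0); first by rewrite le_max lexx orbT.
by apply: filterS hM => x h; rewrite le_max h.
Qed.

Lemma Alg_bounded f : Alg f -> exists2 M : R, 0 < M & forall x, `|f x| <= M.
Proof.
move=> /(da_cont H) cf.
have : compact (f @` [set: X]).
  by apply: continuous_compact; [exact: continuous_subspaceT|exact: cm_cpt HX].
move=> /compact_bounded[M [Mr hM]]; exists (Num.max (M + 1) 1).
  by rewrite lt_max ltr01 orbT.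
by move=> x; apply: (hM (Num.max (M + 1) 1)); [rewrite lt_max ltrDl ltr01|exists x].
Qed.

(** Follows from linearity and the Leibniz rule by induction on P; polynomials are the only
    compositions known to stay in the algebra. *)
Lemma Alg_poly (P : {poly R}) f : Alg f -> Alg (fun x => P.[f x]) /\
  {ae mu, forall x : borelT X, D (fun y => P.[f y]) x = P^`().[f x] *: D f x}.
Proof.
move=> Af; elim/poly_ind: P => [|P c [AP DP]].
  under eq_fun do rewrite horner0; split; first exact: Alg_cst.
  by apply: filterS (D_cst 0) => x; rewrite linear0 horner0 scale0r.
have AX : Alg (fun x => P.[f x] * f x) by exact: (da_mul H).
have E : (fun x => (P * 'X + c%:P).[f x]) = (fun x => P.[f x] * f x + c).
  by apply/funext => x; rewrite hornerD hornerC hornerMX.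
rewrite E; split; first by apply: (da_add H) => //; exact: Alg_cst.
have h1 := da_Dadd H AX (Alg_cst c); have h2 := da_Dmul H AP Af.
apply: filterS (filterI h1 (filterI h2 (filterI (D_cst c) DP))) => x [-> [-> [-> ->]]].
rewrite addr0 derivMXaddC hornerD hornerMX scalerDl scalerA addrC.
by rewrite addrC [f x * _]mulrC.
Qed.

Section Vectors.
Context {m : nat}.
Implicit Types (u v w : X -> 'rV[R]_m).

Lemma inAmD u v : inAm Alg u -> inAm Alg v -> inAm Alg (fun x => u x + v x).
Proof. by move=> hu hv i; under eq_fun do rewrite mxE; exact: (da_add H). Qed.

Lemma inAmB u v : inAm Alg u -> inAm Alg v -> inAm Alg (fun x => u x - v x).
Proof. by move=> hu hv i; under eq_fun do rewrite !mxE; exact: Alg_sub. Qed.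

Lemma inAmM phi v : Alg phi -> inAm Alg v -> inAm Alg (fun x => phi x *: v x).
Proof. by move=> hu hv i; under eq_fun do rewrite mxE; exact: (da_mul H). Qed.

Lemma inAmZ (c : R) v : inAm Alg v -> inAm Alg (fun x => c *: v x).
Proof. by move=> hv i; under eq_fun do rewrite mxE; exact: (da_scale H). Qed.

Lemma inAm0 : inAm Alg (fun _ => 0 : 'rV[R]_m).
Proof. by move=> i; under eq_fun do rewrite mxE; exact: Alg_cst. Qed.

Lemma inAm_sum n (v : nat -> X -> 'rV[R]_m) : (forall k, inAm Alg (v k)) ->
  inAm Alg (fun x => \sum_(k < n) v k x).
Proof.
move=> hv; elim: n => [|n IH].
  by under eq_fun do rewrite big_ord0; exact: inAm0.
by under eq_fun do rewrite big_ord_recr /=; apply: inAmD.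
Qed.

Lemma mmeas_inAm u : inAm Alg u -> mmeas u.
Proof. by move=> hu i j; rewrite ord1; apply: rmeas_Alg (hu j). Qed.

Lemma mmeas_grad u : inAm Alg u -> mmeas (grad D u).
Proof.
by move=> hu i j; under eq_fun do rewrite mxE; exact: (da_meas H (hu i)).1.
Qed.

Lemma inAm_bounded u : inAm Alg u -> exists2 M : R, 0 < M & forall x, fnorm (u x) <= M.
Proof.
move=> hu.
have /choice[M hM] : forall i, exists M : R, 0 < M /\ forall x, `|u x ord0 i| <= M.
  by move=> i; have [M M0 hM] := Alg_bounded (hu i); exists M.
pose S := \sum_i M i.
have S0 : 0 <= S by apply: sumr_ge0 => i _; have [/ltW] := hM i.
exists ((1 * m)%:R * S + 1); first by rewrite ltr_wpDl// mulr_ge0.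
move=> x; apply: (@le_trans _ _ ((1 * m)%:R * S)); last by rewrite lerDl.
apply: fnorm_le_entries => // i j; rewrite ord1; apply: le_trans ((hM j).2 x) _.
rewrite /S (bigD1 j)//= lerDl; apply: sumr_ge0 => k _; by have [/ltW] := hM k.
Qed.

Lemma ae_forall_ord n (P : 'I_n -> X -> Prop) :
  (forall i, {ae mu, forall x : borelT X, P i x}) -> {ae mu, forall x : borelT X, forall i, P i x}.
Proof.
move=> h; have hn : {ae mu, forall x : borelT X, forall k, (if insub k is Some i then P i x else True)}.
  apply/ae_foralln => k; case: insubP => [i _ _|_]; first exact: h.
  exact: aeW.
by apply: filterS hn => x hx i; have := hx (val i); rewrite valK.
Qed.

Lemma grad_bounded u : inAm Alg u ->
  exists2 M : R, 0 <= M & {ae mu, forall x : borelT X, fnorm (grad D u x) <= M}.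
Proof.
move=> hu.
have /choice[M hM] : forall i, exists M : R, 0 <= M /\
    {ae mu, forall x : borelT X, fnorm (D (fun y => u y ord0 i) x) <= M}.
  by move=> i; have [M M0 hM] := D_bounded (hu i); exists M.
pose S := \sum_i M i.
have MS i : M i <= S.
  rewrite /S (bigD1 i)//= lerDl; apply: sumr_ge0 => k _; by have [] := hM k.
have S0 : 0 <= S by apply: sumr_ge0 => i _; have [] := hM i.
exists ((m * N)%:R * S); first by rewrite mulr_ge0.
have := ae_forall_ord (fun i => (hM i).2); apply: filterS => x hx.
apply: fnorm_le_entries => // i j; rewrite mxE.
exact: le_trans (normr_le_fnorm _ _ _) (le_trans (hx i) (MS i)).
Qed.

Lemma gradD u v : inAm Alg u -> inAm Alg v ->
  {ae mu, forall x : borelT X, grad D (fun y => u y + v y) x = grad D u x + grad D v x}.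
Proof.
move=> hu hv; have := ae_forall_ord (fun i => da_Dadd H (hu i) (hv i)).
apply: filterS => x hx; apply/matrixP => i j; rewrite !mxE.
have -> : (fun y => (u y + v y) ord0 i) = (fun y => u y ord0 i + v y ord0 i).
  by apply/funext => y; rewrite mxE.
by rewrite hx mxE.
Qed.

Lemma gradZ (c : R) u : inAm Alg u ->
  {ae mu, forall x : borelT X, grad D (fun y => c *: u y) x = c *: grad D u x}.
Proof.
move=> hu; have := ae_forall_ord (fun i => da_Dscale H c (hu i)).
apply: filterS => x hx; apply/matrixP => i j; rewrite !mxE.
have -> : (fun y => (c *: u y) ord0 i) = (fun y => c * u y ord0 i).
  by apply/funext => y; rewrite mxE.
by rewrite hx mxE.
Qed.

Lemma gradB u v : inAm Alg u -> inAm Alg v ->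
  {ae mu, forall x : borelT X, grad D (fun y => u y - v y) x = grad D u x - grad D v x}.
Proof.
move=> hu hv; have h1 := gradD hu (inAmZ (-1) hv); have h2 := gradZ (-1) hv.
apply: filterS (filterI h1 h2) => x [].
have -> : (fun y => u y + -1 *: v y) = (fun y => u y - v y).
  by apply/funext => y; rewrite scaleN1r.
by move=> -> ->; rewrite scaleN1r.
Qed.

Lemma gradM phi v : Alg phi -> inAm Alg v ->
  {ae mu, forall x : borelT X, grad D (fun y => phi y *: v y) x =
     phi x *: grad D v x + outer (v x) (D phi x)}.
Proof.
move=> hp hv; have := ae_forall_ord (fun i => da_Dmul H hp (hv i)).
apply: filterS => x hx; apply/matrixP => i j; rewrite !mxE.
have -> : (fun y => (phi y *: v y) ord0 i) = (fun y => phi y * v y ord0 i).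
  by apply/funext => y; rewrite mxE.
by rewrite hx !mxE big_ord_recl big_ord0 addr0 !mxE.
Qed.

Lemma grad0 : {ae mu, forall x : borelT X, grad D (fun _ => 0 : 'rV[R]_m) x = 0}.
Proof.
have := D_cst 0; apply: filterS => x hx; apply/matrixP => i j; rewrite !mxE.
by rewrite hx mxE.
Qed.

Lemma grad_sum n (v : nat -> X -> 'rV[R]_m) : (forall k, inAm Alg (v k)) ->
  {ae mu, forall x : borelT X,
     grad D (fun y => \sum_(k < n) v k y) x = \sum_(k < n) grad D (v k) x}.
Proof.
move=> hv; elim: n => [|n IH].
  have -> : (fun y => \sum_(k < 0) v k y) = (fun=> 0).
    by apply/funext => y; rewrite big_ord0.
  by apply: filterS grad0 => x ->; rewrite big_ord0.
have -> : (fun y => \sum_(k < n.+1) v k y) = (fun y => \sum_(k < n) v k y + v n y).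
  by apply/funext => y; rewrite big_ord_recr.
apply: filterS (filterI IH (gradD (inAm_sum n hv) (hv n))) => x [h1 ->].
by rewrite h1 big_ord_recr.
Qed.

Section NormalSpace.
Context {vk : nat -> X -> 'rV[R]_m} (Hvk : forall k, inAm Alg (vk k)).

Lemma gradmuE u x : gradmu D (spanAt D vk) u x =
  projT (seqspan (fun k => grad D (vk k) x)) (grad D u x).
Proof. by []. Qed.

Lemma mmeas_gradmu u : inAm Alg u -> mmeas (gradmu D (spanAt D vk) u).
Proof.
move=> hu; apply: (mmeas_projT (B := fun k x => grad D (vk k) x)).
  by move=> k; exact: mmeas_grad.
exact: mmeas_grad.
Qed.

Lemma fnorm_gradmu u x : fnorm (gradmu D (spanAt D vk) u x) <= fnorm (grad D u x).
Proof. by rewrite gradmuE; exact: fnorm_projT. Qed.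

Lemma gradmuD u v : inAm Alg u -> inAm Alg v -> {ae mu, forall x : borelT X,
  gradmu D (spanAt D vk) (fun y => u y + v y) x =
  gradmu D (spanAt D vk) u x + gradmu D (spanAt D vk) v x}.
Proof. by move=> hu hv; apply: filterS (gradD hu hv) => x h; rewrite !gradmuE h projTD. Qed.

Lemma gradmuB u v : inAm Alg u -> inAm Alg v -> {ae mu, forall x : borelT X,
  gradmu D (spanAt D vk) (fun y => u y - v y) x =
  gradmu D (spanAt D vk) u x - gradmu D (spanAt D vk) v x}.
Proof. by move=> hu hv; apply: filterS (gradB hu hv) => x h; rewrite !gradmuE h projTB. Qed.

Lemma gradmuM phi v : Alg phi -> inAm Alg v -> {ae mu, forall x : borelT X,
  gradmu D (spanAt D vk) (fun y => phi y *: v y) x =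
  phi x *: gradmu D (spanAt D vk) v x +
  projT (seqspan (fun k => grad D (vk k) x)) (outer (v x) (D phi x))}.
Proof.
by move=> hp hv; apply: filterS (gradM hp hv) => x h; rewrite !gradmuE h projTD projTZ.
Qed.

Lemma gradmu_sum n (v : nat -> X -> 'rV[R]_m) : (forall k, inAm Alg (v k)) ->
  {ae mu, forall x : borelT X, gradmu D (spanAt D vk) (fun y => \sum_(k < n) v k y) x =
     \sum_(k < n) gradmu D (spanAt D vk) (v k) x}.
Proof.
move=> hv; apply: filterS (grad_sum n hv) => x h; rewrite gradmuE h.
elim: n {h} => [|n IH]; first by rewrite !big_ord0 projT0.
by rewrite !big_ord_recr /= projTD IH.
Qed.

Lemma gradmu_bounded u : inAm Alg u ->
  exists2 M : R, 0 <= M & {ae mu, forall x : borelT X, fnorm (gradmu D (spanAt D vk) u x) <= M}.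
Proof.
move=> /grad_bounded[M M0 hM]; exists M => //; apply: filterS hM => x.
exact: le_trans (fnorm_gradmu u x).
Qed.

End NormalSpace.
End Vectors.

End DiffAlgebra.

(** * Polynomials approximating a truncated identity on [-1, 1] *)

Section TruncationPolynomials.
Context {R : realType}.
Implicit Types (p q : {poly R}) (t : R).

(** At i = 0 the quotient is a division by 0, hence 0: the constant of integration vanishes. *)
Definition antideriv p : {poly R} := \poly_(i < (size p).+1) (p`_i.-1 / i%:R).

Lemma deriv_antideriv p : (antideriv p)^`() = p.
Proof.
apply/polyP => i; rewrite coef_deriv coef_poly ltnS /=.
have [ip|ip] := ltnP i (size p); last by rewrite mul0rn nth_default.
by rewrite -[_ *+ _]mulr_natr divfK// pnatr_eq0.
Qed.

Lemma antideriv0 p : (antideriv p).[0] = 0.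
Proof. by rewrite horner_coef0 coef_poly /= invr0 mulr0. Qed.

Lemma poly_lipschitz p (M a b : R) :
  (forall x, Num.min a b <= x <= Num.max a b -> `|p^`().[x]| <= M) ->
  `|p.[b] - p.[a]| <= M * `|b - a|.
Proof.
wlog ab : a b / a <= b => [hw h|].
  have [ab|/ltW ba] := leP a b; first exact: hw.
  by rewrite distrC (distrC b); apply: hw => // x; rewrite minC maxC; exact: h.
rewrite (min_idPl ab) (max_idPr ab) => h.
have dp (x : R) : is_derive (x : R^o) (1 : R^o) (horner p : R^o -> R^o) p^`().[x].
  by rewrite derivE derive1E; apply/derivableP; exact: derivable_horner.
have [|c hc ->] := @MVT_segment R (horner p) (horner p^`()) a b ab (fun x _ => dp x).
  by apply: continuous_subspaceT; exact: continuous_horner.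
by rewrite normrM ler_wpM2r// h//; move: hc; rewrite in_itv.
Qed.

Lemma bernoulli_le (y : R) n : 0 <= y <= 1 -> 1 - n%:R * y <= (1 - y) ^+ n.
Proof.
move=> /andP[y0 y1]; elim: n => [|n IH]; first by rewrite expr0 mul0r subr0.
rewrite exprS; apply: le_trans (_ : (1 - y) * (1 - n%:R * y) <= _); last first.
  by rewrite ler_wpM2l// subr_ge0.
have : 0 <= n%:R * y * y by rewrite !mulr_ge0.
by rewrite -natr1; lra.
Qed.

(** Division-free form of (1 - y)^n <= 1 / (1 + n y), effective when n y is large; [bernoulli_le]
    serves when n y is small. *)
Lemma bernoulli_ge (y : R) n : 0 <= y <= 1 -> (1 - y) ^+ n * (1 + n%:R * y) <= 1.
Proof.
move=> /andP[y0 y1]; elim: n => [|n IH]; first by rewrite expr0 mul0r addr0 mul1r.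
apply: le_trans IH; rewrite exprSr -mulrA ler_wpM2l ?exprn_ge0 ?subr_ge0//.
have : 0 <= n%:R * y * y by rewrite !mulr_ge0.
have : 0 <= y * y by rewrite mulr_ge0.
by rewrite -natr1; lra.
Qed.

(* q' = 1 - (1 - t^(2n))^(k^n) is close to 0 for t^2 < 1/k and to 1 for t^2 > 1/k. *)
Lemma truncation_poly (kap : R) : 0 < kap -> exists2 kap1 : R, 0 < kap1 &
  forall eta : R, 0 < eta -> exists q, [/\ q.[0] = 0, q^`().[0] = 0 &
    forall t, `|t| <= 1 -> [/\ 0 <= q^`().[t] <= 1,
      `|t| <= kap1 -> q^`().[t] <= eta & kap <= `|t| -> 1 - eta <= q^`().[t]]].
Proof.
(* k makes k kap^2 at least 2, and [kap1] below makes k kap1^2 equal to 1/2, so that on both sides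
   the n-th powers leave an error of at most 2^-n. *)
move=> kap0; pose k := (Num.bound (2 / kap ^+ 2)).+1.
have k0 : 0 < k%:R :> R by rewrite ltr0n.
have kk : 2 / k%:R <= kap ^+ 2.
  rewrite ler_pdivrMr// mulrC -ler_pdivrMr ?exprn_gt0//.
  apply: ltW; apply: lt_trans (archi_boundP _) _; first by rewrite divr_ge0// exprn_ge0// ltW.
  by rewrite ltr_nat.
(* This threshold depends on kap alone: in [truncation] eta is chosen after a cut-off whose position
   depends on it. *)
exists (Num.sqrt (1 / (2 * k%:R))); first by rewrite sqrtr_gt0 divr_gt0// mulr_gt0.
move=> eta eta0; pose n := (Num.bound (1 / eta)).+1.
have n2 : 1 / (2 ^+ n) <= eta.
  rewrite ler_pdivrMr ?exprn_gt0// mulrC -ler_pdivrMr//.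
  apply: ltW; apply: lt_trans (archi_boundP _) _; first by rewrite divr_ge0// ltW.
  by rewrite -natrX ltr_nat /n; apply: ltn_trans (ltn_expl _ (ltnSn 1)) _; rewrite ltn_exp2l.
pose P : {poly R} := 1 - (1 - 'X^(2 * n)) ^+ (k ^ n).
have PE t : P.[t] = 1 - (1 - (t ^+ 2) ^+ n) ^+ (k ^ n).
  by rewrite /P !hornerE exprM.
exists (antideriv P); rewrite deriv_antideriv antideriv0; split=> //.
  by rewrite PE expr0n /= expr0n /= subr0 expr1n subrr.
move=> t t1; rewrite PE; set y := (t ^+ 2) ^+ n.
have t2 : t ^+ 2 = `|t| ^+ 2 by rewrite real_normK// num_real.
have y01 : 0 <= y <= 1.
  by rewrite exprn_ge0 ?sqr_ge0//= exprn_ile1 ?sqr_ge0// t2 exprn_ile1.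
have /andP[y0 y1] := y01.
split.
- by rewrite subr_ge0 exprn_ile1 ?subr_ge0//= ?lerBlDr ?lerDl// exprn_ge0// subr_ge0.
- move=> tk; apply: le_trans n2; rewrite lerBlDr -lerBlDl.
  apply: le_trans (bernoulli_le _ y01); rewrite lerD2l lerN2 natrX.
  have yk : y <= (1 / (2 * k%:R)) ^+ n.
    rewrite lerXn2r ?nnegrE ?sqr_ge0 ?divr_ge0 ?mulr_ge0// t2.
    rewrite -[leRHS](@sqr_sqrtr _ (1 / (2 * k%:R))) ?divr_ge0 ?mulr_ge0//.
    by rewrite lerXn2r ?nnegrE ?sqrtr_ge0.
  apply: le_trans (ler_wpM2l _ yk) _; first by rewrite exprn_ge0// ltW.
  have kk' : k%:R * (1 / (2 * k%:R)) = 2^-1 :> R by field; rewrite gt_eqF.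
  by rewrite -exprMn kk' exprVn mul1r.
- move=> tk; rewrite lerD2l lerN2; apply: le_trans n2.
  rewrite ler_pdivlMr ?exprn_gt0//; apply: le_trans (bernoulli_ge (k ^ n) y01).
  rewrite ler_wpM2l ?exprn_ge0 ?subr_ge0//.
  apply: le_trans (_ : (k ^ n)%:R * y <= _); last by rewrite lerDr.
  have yk : (2 / k%:R) ^+ n <= y.
    rewrite lerXn2r ?nnegrE ?sqr_ge0 ?divr_ge0//; apply: le_trans kk _; rewrite t2.
    by rewrite lerXn2r ?nnegrE ?(ltW kap0).
  apply: le_trans (ler_wpM2l _ yk); last by rewrite ler0n.
  by rewrite natrX -exprMn mulrCA mulfV ?mulr1 ?gt_eqF.
Qed.

Lemma truncation_poly_bounds q (kap kap1 eta : R) : 0 < eta -> q.[0] = 0 ->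
  (forall t, `|t| <= 1 -> [/\ 0 <= q^`().[t] <= 1,
      `|t| <= kap1 -> q^`().[t] <= eta & kap <= `|t| -> 1 - eta <= q^`().[t]]) ->
  0 < kap -> forall t, `|t| <= 1 ->
  [/\ `|q.[t]| <= `|t|, `|t| <= kap1 -> `|q.[t]| <= eta * `|t| & `|q.[t] - t| <= kap + eta].
Proof.
move=> eta0 q0 hq kap0 t t1.
have bet (x : R) : Num.min 0 t <= x <= Num.max 0 t -> `|x| <= `|t|.
  by have [h|h] := leP 0 t => /andP[h1 h2]; rewrite ?(ger0_norm h1) ?(ler0_norm h2)
    ?(ger0_norm h) ?(ltr0_norm h)// lerN2.
split.
- have := @poly_lipschitz q 1 0 t; rewrite q0 !subr0 mul1r; apply => x /bet xt.
  by have [/andP[h1 h2] _ _] := hq x (le_trans xt t1); rewrite ger0_norm.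
- move=> tk; have := @poly_lipschitz q eta 0 t; rewrite q0 !subr0; apply => x /bet xt.
  have [/andP[h1 h2] h _] := hq x (le_trans xt t1).
  by rewrite ger0_norm// h// (le_trans xt).
(* The slope of r is at most 1 in absolute value, and at most eta beyond kap. *)
pose r := q - 'X.
have rE x : r.[x] = q.[x] - x by rewrite /r !hornerE.
have r'E x : r^`().[x] = q^`().[x] - 1 by rewrite /r derivB derivX !hornerE.
have r1 x : `|x| <= 1 -> `|r^`().[x]| <= 1.
  by move=> /hq[/andP[h1 h2] _ _]; rewrite r'E ler0_norm ?subr_le0//; lra.
have r0 : r.[0] = 0 by rewrite rE q0 subr0.
have small (s : R) : `|s| <= 1 -> `|r.[s]| <= `|s|.
  move=> s1; have := @poly_lipschitz r 1 0 s; rewrite r0 !subr0 mul1r; apply => x hx.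
  apply: r1; apply: le_trans s1.
  by move: hx; have [h|h] := leP 0 s => /andP[h1 h2]; rewrite ?(ger0_norm h1) ?(ler0_norm h2)
    ?(ger0_norm h) ?(ltr0_norm h)// lerN2.
rewrite -rE; have [tk|tk] := leP `|t| kap.
  by apply: le_trans (small t t1) _; apply: le_trans tk _; rewrite lerDl ltW.
(* The point of modulus kap between 0 and t: r varies by at most kap up to s and by at most eta from
   s to t. *)
pose s := Num.sg t * kap.
have t0 : t != 0 by rewrite -normr_gt0 (lt_trans kap0).
have ss : `|s| = kap by rewrite normrM normr_sg t0 mul1r gtr0_norm.
have hs : `|r.[s]| <= kap by rewrite -ss; apply: small; rewrite ss (le_trans (ltW tk)).
have hts : `|r.[t] - r.[s]| <= eta * `|t - s|.
  apply: poly_lipschitz => x hx.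
  have [h1 h2] : kap <= `|x| /\ `|x| <= `|t|.
    move: hx tk; rewrite /s; have [tp|tn|] := ltrgt0P t; last by move=> te; rewrite te eqxx in t0.
      rewrite gtr0_sg// mul1r => + tk; rewrite (min_idPl (ltW tk)) (max_idPr (ltW tk)).
      by move=> /andP[h1 h2]; rewrite ger0_norm ?(le_trans (ltW kap0)).
    rewrite ltr0_sg// mulN1r => + tk; have tk' : t <= - kap by lra.
    rewrite (min_idPr tk') (max_idPl tk') => /andP[h1 h2].
    have x0 : x <= 0 by lra.
    by rewrite ler0_norm//; lra.
  have [/andP[q0' q1'] _ /(_ h1) q2] := hq x (le_trans h2 t1).
  by rewrite r'E ler0_norm ?subr_le0//; lra.
have ts : `|t - s| <= 1.
  have -> : t - s = Num.sg t * (`|t| - kap) by rewrite mulrBr -numEsg.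
  by rewrite normrM normr_sg t0 mul1r ger0_norm ?subr_ge0 ?(ltW tk)//; lra.
have := ler_normD (r.[s]) (r.[t] - r.[s]); rewrite addrC subrK => /le_trans; apply.
apply: lerD => //; apply: le_trans hts _.
by rewrite -[leRHS]mulr1 ler_wpM2l// ltW.
Qed.

End TruncationPolynomials.

Lemma fnorm_mono {R : realType} {a b : nat} (A B : 'M[R]_(a, b)) :
  (forall i j, `|A i j| <= `|B i j|) -> fnorm A <= fnorm B.
Proof.
move=> h; rewrite -(ler_pXn2r (n := 2)) ?nnegrE ?fnorm_ge0// !sqr_fnorm /frob.
apply: ler_sum => i _; apply: ler_sum => j _; rewrite -!expr2.
rewrite -(real_normK (num_real (A i j))) -(real_normK (num_real (B i j))).
by rewrite ler_pXn2r ?nnegrE.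
Qed.

(** * Locality and truncation in the Sobolev space *)

Record sobolev {R : realType} {X : pseudoPMetricType R} (d : X -> X -> R)
    (mu : {measure set (borelT X) -> \bar R}) (Alg : set (X -> R)) {m N : nat}
    (D : (X -> R) -> X -> 'rV[R]_N) (vk : nat -> X -> 'rV[R]_m) (p : R) : Prop := Sobolev {
  sb_da : diff_algebra d mu Alg D ;
  sb_gen : normal_gen Alg mu D vk ;
  sb_p : 1 < p ;
  sb_C0 : forall u G, inW Alg mu p D (spanAt D vk) u G -> forall A : set X, open A ->
       {ae mu, forall x : borelT X, A x -> u x = 0} ->
       {ae mu, forall x : borelT X, A x -> G x = 0} }.

Section Sobolev.
Context {R : realType} {X : pseudoPMetricType R} {d : X -> X -> R}
  {mu : {measure set (borelT X) -> \bar R}} {Alg : set (X -> R)} {m N : nat}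
  {D : (X -> R) -> X -> 'rV[R]_N} {vk : nat -> X -> 'rV[R]_m} {p : R}
  (HS : sobolev d mu Alg D vk p).
Let H := sb_da HS.
Let HX := da_metric H.
Let p1 := sb_p HS.
Let p0 : 0 < p := lt_trans ltr01 p1.
Let Sx := spanAt D vk.
Let nab := gradmu D Sx.
Implicit Types (u v w f : X -> 'rV[R]_m).

Lemma vk_inAm k : inAm Alg (vk k).
Proof. by have [h _] := sb_gen HS; have [] := h k. Qed.

Lemma mmeas_nab u : inAm Alg u -> mmeas (nab u).
Proof. by move=> hu; apply: (mmeas_gradmu H vk_inAm). Qed.

Lemma inW_Alg u : inAm Alg u -> inW Alg mu p D Sx u (nab u).
Proof.
move=> hu; split; first exact: (mmeas_inAm H).
split; first exact: mmeas_nab.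
by exists (fun=> u); split=> //; split; apply: (cvgLp_cst p1).
Qed.

Lemma inW0_Alg (A : set X) u : inAm Alg u -> (forall x, ~ A x -> u x = 0) ->
  inW0 Alg mu p D Sx A u (nab u).
Proof.
move=> hu u0; split; first exact: (mmeas_inAm H).
split; first exact: mmeas_nab.
by exists (fun=> u); split=> //; split; apply: (cvgLp_cst p1).
Qed.

Lemma nab_local w (O : set X) : inAm Alg w -> open O -> (forall x, O x -> w x = 0) ->
  {ae mu, forall x : borelT X, O x -> nab w x = 0}.
Proof. by move=> hw oO w0; apply: (sb_C0 HS (inW_Alg hw) oO); exact: aeW. Qed.

Lemma nab_local_eq v w (O : set X) : inAm Alg v -> inAm Alg w -> open O ->
  (forall x, O x -> v x = w x) -> {ae mu, forall x : borelT X, O x -> nab v x = nab w x}.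
Proof.
move=> hv hw oO vw.
have h1 := nab_local (inAmB H hv hw) oO (fun x Ox => eq_ind_r (fun z => z - w x = 0) (subrr _) (vw x Ox)).
apply: filterS (filterI h1 (gradmuB H (vk := vk) hv hw)) => x [h2 h3] Ox.
by apply/eqP; rewrite -subr_eq0 -h3; apply/eqP; exact: h2.
Qed.

Lemma mu_finX : mu [set: borelT X] \is a fin_num.
Proof. by apply: (mu_fin_num HX); exact: measurableT. Qed.

(** Pointwise smallness off a set of small measure gives smallness in L^p: (1 + eta)^p <= 2^p on E,
    and eta^p <= eta off E because eta <= 1. *)
Lemma Ip_indic_bound a b (F : X -> 'M[R]_(a, b)) (c0 eta : R) (E : set X) :
  mmeas F -> measX E -> 0 <= c0 -> 0 <= eta <= 1 ->
  {ae mu, forall x : borelT X, fnorm (F x) <= c0 * (\1_E x + eta)} ->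
  (Ip mu p setT F <= (c0 `^ p * 2 `^ p)%:E * (mu E + eta%:E * mu [set: borelT X]))%E.
Proof.
move=> mF mE c00 /andP[e0 e1] hF.
have mT : measX (setT : set X) by exact: measurableT.
have mI : rmeas (fun x : X => \1_E x : R) by exact: measurable_indic.
have I0 (x : X) : 0 <= \1_E x :> R by rewrite indicE.
have K0 : 0 <= c0 `^ p * 2 `^ p by rewrite mulr_ge0 ?powR_ge0.
have mIe : rmeas (fun x : X => \1_E x + eta) by apply: rmeasD => //; exact: rmeas_cst.
have Ie0 (x : X) : 0 <= \1_E x + eta by rewrite addr_ge0.
apply: (@le_trans _ _ (\int[mu]_(x in setT) (c0 `^ p * 2 `^ p * (\1_E x + eta))%:E)%E).
  apply: int_le_ae => //.
  - exact: measurable_fpow.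
  - exact: rmeasZ.
  - by move=> x; exact: powR_ge0.
  - by move=> x; rewrite mulr_ge0.
  apply: filterS hF => x hx _.
  apply: (@le_trans _ _ ((c0 * (\1_E x + eta)) `^ p)).
    by rewrite ge0_ler_powR ?nnegrE ?fnorm_ge0 ?mulr_ge0 ?(ltW p0).
  rewrite powRM// -mulrA ler_wpM2l ?powR_ge0//.
  rewrite indicE; case: (x \in E); rewrite /= ?add0r.
    apply: (@le_trans _ _ (2 `^ p)); last by rewrite ler_peMr ?powR_ge0// lerDl.
    by rewrite ge0_ler_powR ?nnegrE ?(ltW p0)//; [rewrite addr_ge0|lra].
  apply: (@le_trans _ _ eta).
    rewrite -[leRHS]powRr1//; move: e0; rewrite le_eqVlt => /predU1P[<-|e0].
      by rewrite !powR0 ?gt_eqF.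
    by apply: ger_powR; [rewrite e0|exact: ltW].
  by rewrite ler_peMl// -[leLHS](powRr0 2) ler_powR ?ler1n// ltW.
rewrite intZ// intD//; last exact: rmeas_cst.
rewrite lee_wpmul2l ?lee_fin// leeD//.
  by rewrite integral_indic//= setIT.
by rewrite int_cst.
Qed.

Section RowScaling.
Context (f : X -> 'rV[R]_m) (hf : inAm Alg f) (M : R) (M0 : 0 < M)
  (fM : forall x i, `|f x ord0 i| <= M).

(** What the gradients of the truncations [rowpoly q] converge to; row i is erased on the whole zero
    set of component i, which need not be open. *)
Definition suppgrad : X -> 'M[R]_(m, N) :=
  fun x => \matrix_(i, j) (if f x ord0 i == 0 then 0 else grad D f x i j).

(** Division by M brings the values into [-1, 1], where the polynomials are controlled. *)
Definition rowpoly (q : {poly R}) : X -> 'rV[R]_m :=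
  fun x => \row_i (M * q.[f x ord0 i / M]).

(** The value 0 is excluded, so these sets decrease to the empty set and their measures tend to 0
    with kap. *)
Definition smallvals (kap : R) : set X :=
  [set x | exists i, 0 < `|f x ord0 i| /\ `|f x ord0 i| < M * kap].

Lemma fM1 x i : `|f x ord0 i / M| <= 1.
Proof. by rewrite normrM normfV (gtr0_norm M0) ler_pdivrMr// mul1r. Qed.

Lemma open_smallvals kap : open (smallvals kap).
Proof.
have -> : smallvals kap = \bigcup_(i in [set: 'I_m])
    ([set x | `|f x ord0 i| < M * kap] `&` [set x | 0 < `|f x ord0 i|]).
  by apply/seteqP; split=> x /=; [move=> [i [h1 h2]]; exists i|move=> [i _ [h1 h2]]; exists i].
apply: bigcup_open => i _.
have ci : continuous (fun x => `|f x ord0 i|).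
  by move=> x; apply: continuous_comp; [exact: (da_cont H (hf i))|exact: norm_continuous].
apply: openI.
  by apply: (open_comp (f := fun x => `|f x ord0 i|) (D := [set y | y < M * kap])) => //; exact: open_lt.
by apply: (open_comp (f := fun x => `|f x ord0 i|) (D := [set y | 0 < y])) => //; exact: open_gt.
Qed.

Lemma smallvals_small (e : R) : 0 < e -> exists2 kap : R, 0 < kap <= e & (mu (smallvals kap) < e%:E)%E.
Proof.
move=> e0.
have mS k : measurable (smallvals k : set (borelT X)) by apply: open_meas; exact: open_smallvals.
have sub k k' : k <= k' -> smallvals k `<=` smallvals k'.
  by move=> kk x [i [h1 h2]]; exists i; split=> //; apply: lt_le_trans h2 _; rewrite ler_wpM2l// ltW.
have [n hn] : exists n, (mu (smallvals (n.+1%:R^-1)) < e%:E)%E.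
  apply: (@measure_decr_lt _ _ _ mu (fun n => smallvals (n.+1%:R^-1))) => //.
  - exact: (mu_fin_meas HX).
  - by move=> n k nk; apply: sub; rewrite lef_pV2 ?posrE// ler_nat.
  - rewrite -subset0 => x hx.
    have /choice[g hg] : forall n : nat, exists i, 0 < `|f x ord0 i| /\ `|f x ord0 i| < M * n.+1%:R^-1.
      by move=> n; exact: hx.
    (* The least nonzero component modulus at x, or 1 if smaller: once M/(n+1) is at most c, x has
       left the sets. *)
    pose c := \big[Order.min/1]_(i | f x ord0 i != 0) `|f x ord0 i|.
    have c0 : 0 < c.
      by apply: lt_bigmin => // i; rewrite normr_gt0.
    pose n := Num.bound (M / c).
    have [h1 h2] := hg n.
    have : c <= `|f x ord0 (g n)| by apply: bigmin_le_cond; rewrite -normr_gt0.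
    apply/negP; rewrite -ltNge; apply: lt_le_trans h2 _.
    rewrite ler_pdivrMr// mulrC -ler_pdivrMr//.
    apply: ltW; apply: lt_trans (archi_boundP _) _; first by rewrite divr_ge0// ltW.
    by rewrite ltr_nat.
exists (Num.min e n.+1%:R^-1); first by rewrite lt_min e0 invr_gt0 ltr0n ge_min lexx.
apply: le_lt_trans hn; apply: le_measure; rewrite ?inE//; apply: sub.
by rewrite ge_min lexx orbT.
Qed.

Lemma mmeas_suppgrad : mmeas suppgrad.
Proof.
move=> i j; under eq_fun do rewrite mxE.
apply: measurable_fun_ifT => //; last exact: (mmeas_grad H hf).
apply: measurable_fun_eqr => //; exact: (rmeas_Alg H (hf i)).
Qed.

Lemma rowpoly_inAm q : inAm Alg (rowpoly q).
Proof.
move=> i; under eq_fun do rewrite mxE.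
apply: (da_scale H); have [h _] := Alg_poly H q (da_scale H M^-1 (hf i)).
by move: h; under eq_fun do rewrite mulrC.
Qed.

Lemma grad_rowpoly q : {ae mu, forall x : borelT X, forall i j,
  grad D (rowpoly q) x i j = q^`().[f x ord0 i / M] * grad D f x i j}.
Proof.
have h i : {ae mu, forall x : borelT X, forall j,
    grad D (rowpoly q) x i j = q^`().[f x ord0 i / M] * grad D f x i j}.
  have hs := da_scale H M^-1 (hf i).
  have [Ap Dp] := Alg_poly H q hs.
  apply: filterS (filterI (da_Dscale H M Ap) (filterI Dp (da_Dscale H M^-1 (hf i)))) => x.
  move=> [h1 [h2 h3]] j; rewrite !mxE.
  have -> : (fun y => rowpoly q y ord0 i) = (fun y => M * q.[M^-1 * f y ord0 i]).
    by apply/funext => y; rewrite mxE (mulrC M^-1).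
  rewrite h1 h2 h3 !mxE (mulrC M^-1 (f x ord0 i)); field.
  by rewrite gt_eqF.
exact: (ae_forall_ord (P := fun i x => forall j, grad D (rowpoly q) x i j = q^`().[f x ord0 i / M] * grad D f x i j)).
Qed.

(** Three regimes: at value 0 both terms vanish since q'(0) = 0; beyond M kap the slope is within
    eta of 1; the values in between lie in [smallvals kap]. *)
Lemma suppgrad_entry q (kap kap1 eta Lam : R) x i j : 0 <= eta -> q^`().[0] = 0 ->
  (forall t, `|t| <= 1 -> [/\ 0 <= q^`().[t] <= 1,
      `|t| <= kap1 -> q^`().[t] <= eta & kap <= `|t| -> 1 - eta <= q^`().[t]]) ->
  `|grad D f x i j| <= Lam ->
  `|suppgrad x i j - q^`().[f x ord0 i / M] * grad D f x i j| <=
    Lam * (\1_(smallvals kap) x + eta).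
Proof.
move=> eta0 q0 hq hL; have L0 : 0 <= Lam by exact: le_trans hL.
have I0 : 0 <= \1_(smallvals kap) x :> R by rewrite indicE.
rewrite mxE; case: eqVneq => [->|fi].
  by rewrite mul0r q0 mul0r subrr normr0 mulr_ge0// addr_ge0.
have [/andP[h0 h1] _ h2] := hq _ (fM1 x i).
rewrite -{1}(mul1r (grad D f x i j)) -mulrBl normrM mulrC ler_pM// ger0_norm ?subr_ge0//.
have [hk|hk] := leP kap `|f x ord0 i / M|.
  by have := h2 hk; lra.
rewrite indicE mem_set /=; first by lra.
exists i; split; first by rewrite normr_gt0.
by move: hk; rewrite normrM normfV (gtr0_norm M0) ltr_pdivrMr// mulrC.
Qed.

(** Covers the region where the cut-off may differ from 1: components below M kap contribute only on
    [smallvals kap], whatever the factor psi in [0, 1]. *)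
Lemma suppgrad_entry_small q (kap psi Lam : R) x i j : q^`().[0] = 0 ->
  (forall t, `|t| <= 1 -> 0 <= q^`().[t] <= 1) -> 0 <= psi <= 1 ->
  `|f x ord0 i| < M * kap -> `|grad D f x i j| <= Lam ->
  `|suppgrad x i j - psi * (q^`().[f x ord0 i / M] * grad D f x i j)| <=
    Lam * \1_(smallvals kap) x.
Proof.
move=> q0 hq /andP[s0 s1] fk hL; have L0 : 0 <= Lam by exact: le_trans hL.
rewrite mxE; case: eqVneq => [->|fi].
  by rewrite mul0r q0 mul0r mulr0 subrr normr0 mulr_ge0// indicE.
have /andP[h0 h1] := hq _ (fM1 x i).
rewrite mulrA -{1}(mul1r (grad D f x i j)) -mulrBl normrM mulrC ler_pM//.
rewrite indicE mem_set /=; last by exists i; rewrite normr_gt0.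
have : 0 <= psi * q^`().[f x ord0 i / M] <= 1.
  by rewrite mulr_ge0//= -[leRHS]mulr1 ler_pM.
by move=> /andP[k0 k1]; rewrite ger0_norm ?subr_ge0//; lra.
Qed.

Lemma small_seq (K e : R) : 0 <= K -> 0 < e ->
  exists n0, forall n, (n0 <= n)%N -> K * n.+1%:R^-1 < e.
Proof.
move=> K0 e0; exists (Num.bound (K / e)) => n hn.
rewrite ltr_pdivrMr ?ltr0n// mulrC -ltr_pdivrMr//.
apply: lt_trans (archi_boundP _) _; first by rewrite divr_ge0// ltW.
by rewrite ltr_nat ltnS.
Qed.

Lemma indic_bound_lt (c0 s e : R) (E : set X) : 0 <= c0 -> 0 <= s ->
  (mu E <= s%:E)%E -> (c0 * (1 + fine (mu [set: borelT X]))) * s < e ->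
  (c0%:E * (mu E + s%:E * mu [set: borelT X]) < e%:E)%E.
Proof.
move=> c00 s0 hE he; apply: (@le_lt_trans _ _ (c0%:E * (s%:E + s%:E * mu [set: borelT X]))%E).
  by rewrite lee_wpmul2l ?lee_fin// leeD2r.
move: he; case: (mu [set: borelT X]) mu_finX => [z||]// _ /= he.
have -> : (c0%:E * (s%:E + s%:E * z%:E))%E = (c0 * (s + s * z))%:E by [].
rewrite lte_fin; apply: le_lt_trans he.
by rewrite le_eqVlt; apply/orP; left; apply/eqP; ring.
Qed.

(* f - q_n(f) tends to 0 uniformly while its gradient tends to the part of grad f carried
   by the zero set of the components, so (C0) on the whole space kills the projection of
   that part. *)
Lemma nab_suppgrad : {ae mu, forall x : borelT X,
  nab f x = projT (seqspan (fun k => grad D (vk k) x)) (suppgrad x)}.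
Proof.
pose P x := projT (seqspan (fun k => grad D (vk k) x)).
have [Lam0 L00 hL0] := grad_bounded H hf.
pose Lam := Lam0; have L0 : 0 <= Lam by [].
have /choice[q hq] : forall n : nat, exists q : {poly R}, exists kap : R,
    [/\ 0 < kap, kap <= n.+1%:R^-1, (mu (smallvals kap) < (n.+1%:R^-1)%:E)%E, q^`().[0] = 0 &
      (forall t, `|t| <= 1 -> `|q.[t] - t| <= kap + n.+1%:R^-1) /\
      exists kap1, forall t, `|t| <= 1 -> [/\ 0 <= q^`().[t] <= 1,
      `|t| <= kap1 -> q^`().[t] <= n.+1%:R^-1 & kap <= `|t| -> 1 - n.+1%:R^-1 <= q^`().[t]]].
  move=> n; have n0 : 0 < n.+1%:R^-1 :> R by rewrite invr_gt0 ltr0n.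
  have [kap /andP[k0 kn] hk] := smallvals_small n0.
  have [kap1 k10 hkap1] := truncation_poly k0.
  have [q [q0 q'0 hq]] := hkap1 _ n0.
  exists q, kap; split=> //; split; last by exists kap1.
  by move=> t t1; have [] := truncation_poly_bounds n0 q0 hq k0 t1.
pose w n := rowpoly (q n).
have hw n : inAm Alg (w n) by exact: rowpoly_inAm.
pose un n x := f x - w n x.
have hun n : inAm Alg (un n) by exact: (inAmB H).
pose G x := nab f x - P x (suppgrad x).
have mP : mmeas (fun x => P x (suppgrad x)).
  apply: (mmeas_projT (B := fun k x => grad D (vk k) x)); last exact: mmeas_suppgrad.
  by move=> k; apply: (mmeas_grad H); exact: vk_inAm.
have mG : mmeas G by apply: mmeasB => //; exact: mmeas_nab.
have en0 n : 0 <= (n.+1%:R^-1 : R) <= 1.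
  by rewrite invr_ge0 ler0n/= invf_le1 ?ltr0n// ler1n.
suff hW : inW Alg mu p D Sx (fun=> 0) G.
  have /= := sb_C0 HS hW openT (aeW mu (fun x _ => erefl)).
  by apply: filterS => x /(_ Logic.I) /eqP; rewrite subr_eq0 => /eqP.
split; first exact: mmeas_cst.
split=> //; exists un; split=> //; split; apply/cvgLpP => e e0.
(* Uniform convergence is the case E = set0 of the indicator bound; the factor 2 comes from kap +
   1/(n+1) <= 2/(n+1). *)
- pose c0 := (1 * m)%:R * (2 * M).
  have c00 : 0 <= c0 by rewrite !mulr_ge0// ltW.
  pose K := (c0 `^ p * 2 `^ p) * (1 + fine (mu [set: borelT X])).
  have K0 : 0 <= K by rewrite !mulr_ge0 ?powR_ge0// addr_ge0// fine_ge0.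
  have [n0 hn0] := small_seq K0 e0; exists n0 => n hn.
  have bd : forall x : borelT X, fnorm (un n x - 0) <= c0 * (\1_(set0 : set X) x + n.+1%:R^-1).
    move=> x; rewrite indicE in_set0 add0r subr0 /c0 -mulrA.
    have n1 : 0 <= n.+1%:R^-1 :> R by have /andP[] := en0 n.
    apply: fnorm_le_entries; first by rewrite !mulr_ge0// ltW.
    move=> i j; rewrite ord1 !mxE.
    have [kap [_ kn _ _ [h _]]] := hq n; have := h _ (fM1 x j).
    have -> : f x ord0 j - M * (q n).[f x ord0 j / M] =
        - M * ((q n).[f x ord0 j / M] - f x ord0 j / M) by field; rewrite gt_eqF.
    move=> h'; rewrite normrM normrN (gtr0_norm M0) -mulrA mulrCA ler_wpM2l ?(ltW M0)//.
    by apply: le_trans h' _; rewrite mulr_natl mulr2n lerD2r.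
  apply: le_lt_trans (Ip_indic_bound (E := set0) _ _ c00 (en0 n) (aeW mu bd)) _.
  + apply: mmeasB; last exact: mmeas_cst.
    exact: (mmeas_inAm H).
  + exact: measurable0.
  + apply: indic_bound_lt; first by rewrite mulr_ge0 ?powR_ge0.
    * by have /andP[] := en0 n.
    * by rewrite measure0 lee_fin; have /andP[] := en0 n.
    * exact: hn0.
- pose c0 := (m * N)%:R * Lam.
  have c00 : 0 <= c0 by rewrite mulr_ge0.
  pose K := (c0 `^ p * 2 `^ p) * (1 + fine (mu [set: borelT X])).
  have K0 : 0 <= K by rewrite !mulr_ge0 ?powR_ge0// addr_ge0// fine_ge0.
  have [n0 hn0] := small_seq K0 e0; exists n0 => n hn.
  have [kap [k0 kn hk q'0 [_ [kap1 hq']]]] := hq n.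
  have n1 : 0 <= n.+1%:R^-1 :> R by have /andP[] := en0 n.
  have bd : {ae mu, forall x : borelT X,
      fnorm (nab (un n) x - G x) <= c0 * (\1_(smallvals kap) x + n.+1%:R^-1)}.
    apply: filterS (filterI (gradB H hf (hw n)) (filterI hL0 (grad_rowpoly (q n)))) => x.
    move=> [hB [hL hR]].
    have -> : nab (un n) x - G x = P x (suppgrad x - grad D (w n) x).
      rewrite /nab gradmuE hB /G /P /nab gradmuE !projTB.
      by rewrite opprB addrC addrA subrK.
    apply: le_trans (fnorm_projT _ _) _; rewrite /c0 -mulrA.
    apply: fnorm_le_entries; first by rewrite mulr_ge0// addr_ge0// indicE.
    move=> i j; rewrite [X in `|X|]mxE [(- grad _ _ _) _ _]mxE hR.
    apply: (suppgrad_entry (kap1 := kap1)) => //.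
    exact: le_trans (normr_le_fnorm _ _ _) hL.
  apply: le_lt_trans (Ip_indic_bound _ _ c00 (en0 n) bd) _.
  + by apply: mmeasB => //; exact: mmeas_nab.
  + by apply: open_meas; exact: open_smallvals.
  + apply: indic_bound_lt => //; first by rewrite mulr_ge0 ?powR_ge0.
    * exact: ltW.
    * exact: hn0.
Qed.

End RowScaling.

Lemma closed_sub_oball (K : set X) x (rho : R) : closed K -> 0 < rho -> K `<=` oball d x rho ->
  exists2 r : R, 0 < r < rho & K `<=` oball d x r.
Proof.
move=> cK rho0 Kr; have cptK : compact K by exact: (closed_cpt HX cK).
have /= := compact_near_coveringP K; case=> /(_ cptK) nc _.
have h : \forall r \near rho^'-, K `<=` oball d x r.
  apply: (nc R (rho^'-) (fun r y => oball d x r y)) => y Ky.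
  have hy : d x y < rho by exact: Kr.
  pose e := (rho - d x y) / 2; have e0 : 0 < e by rewrite divr_gt0// subr_gt0.
  exists (oball d y e, [set r | rho - e < r]); last first.
    move=> [z r] [/= zy hr]; rewrite /oball /=.
    apply: le_lt_trans (cm_tri HX x y z) _; move: zy; rewrite /oball /= => zy.
    by move: hr zy; rewrite /e; lra.
  split=> /=; last by apply: nbhs_left_gt; rewrite ltrBlDr ltrDl.
  by apply/(nbhs_oball HX); exists e.
have h2 : \forall r \near rho^'-, 0 < r by exact: nbhs_left_gt.
have h3 : \forall r \near rho^'-, r < rho by exact: nbhs_left_lt.
have /(@filter_ex _ _ (at_left_proper_filter rho))[r [hr1 hr2 hr3]] : \forall r \near rho^'-,
    [/\ K `<=` oball d x r, 0 < r & r < rho].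
  by apply: filterS3 h h2 h3 => r ? ? ?; split.
by exists r; rewrite ?hr2.
Qed.

(* w = phi q(f) with q' = 0 near 0 and q' = 1 away from 0: the compact set where f is not
   small lies in a smaller ball, and nab_suppgrad controls the gradient where f is small. *)
Lemma truncation f x (rho e : R) : inAm Alg f -> 0 < rho -> 0 < e ->
  (forall y, ~ oball d x rho y -> f y = 0) ->
  exists w, exists2 r : R, 0 < r < rho &
    [/\ inAm Alg w, forall y, ~ cball d x r y -> w y = 0,
        forall y, fnorm (w y) <= fnorm (f y) & (lpdist mu p (nab w) (nab f) < e%:E)%E].
Proof.
move=> hf rho0 e0 f0.
have [M M0 fM'] := inAm_bounded H hf.
have fM y i : `|f y ord0 i| <= M by exact: le_trans (normr_le_fnorm _ _ _) (fM' y).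
have [Lam0 L00 hL0] := grad_bounded H hf.
pose Lam := Lam0 + 1; have L1 : 0 < Lam by rewrite ltr_wpDl.
have hL : {ae mu, forall y : borelT X, fnorm (grad D f y) <= Lam}.
  by apply: filterS hL0 => y /le_trans; apply; rewrite lerDl.
pose c0 := (m * N)%:R * Lam.
have c00 : 0 <= c0 by rewrite mulr_ge0// ltW.
pose K := (c0 `^ p * 2 `^ p) * (1 + fine (mu [set: borelT X])).
have K0 : 0 <= K by rewrite !mulr_ge0 ?powR_ge0// addr_ge0// fine_ge0.
pose s := Num.min 1 (e / (K + 1) / 2).
have K1 : 0 < K + 1 by rewrite ltr_wpDl.
have s0 : 0 < s by rewrite lt_min ltr01 !divr_gt0.
have Ks : K * s < e.
  apply: (@le_lt_trans _ _ ((K + 1) * (e / (K + 1) / 2))).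
    by apply: ler_pM => //; [exact: ltW|rewrite lerDl|rewrite ge_min lexx orbT].
  rewrite mulrA (mulrC (K + 1)) divfK ?gt_eqF//; lra.
have [kap /andP[kap0 kaps] hkap] := smallvals_small hf M0 s0.
have [kap1' k10 hpoly] := truncation_poly kap0.
pose kap1 := Num.min kap1' kap; have k1 : 0 < kap1 by rewrite lt_min k10.
(* The closed set where some component is not small; since f vanishes off the open ball, it lies
   inside that ball. *)
pose K0s : set X := [set y | exists i, M * kap1 <= `|f y ord0 i|].
have cK0s : closed K0s.
  have -> : K0s = \bigcup_(i in [set: 'I_m]) [set y | M * kap1 <= `|f y ord0 i|].
    by apply/seteqP; split=> y /=; [move=> [i h1]; exists i|move=> [i _ h1]; exists i].
  apply: closed_bigcup => [|i _]; first exact: finite_finset.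
  have ci : continuous (fun x => `|f x ord0 i|).
    by move=> y; apply: continuous_comp; [exact: (da_cont H (hf i))|exact: norm_continuous].
  by apply: (closed_comp (f := fun x => `|f x ord0 i|) (D := [set y | M * kap1 <= y])) => //; exact: closed_ge.
have K0B : K0s `<=` oball d x rho.
  move=> y [i]; apply: contraPP => /f0 ->; rewrite mxE normr0; apply/negP.
  by rewrite -ltNge mulr_gt0.
have [r0 /andP[r00 r0rho] hr0] := closed_sub_oball cK0s rho0 K0B.
(* Off the ball of radius r0 all components are below M kap1, and phi is 1 up to radius r1 > r0;
   hence phi varies only where f is small. *)
pose r1 := (2 * r0 + rho) / 3; pose r := (r0 + 2 * rho) / 3.
have [r01 r1r rrho] : [/\ r0 < r1, r1 < r & r < rho] by rewrite /r1 /r; split; lra.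
have [phi [Aphi [phi01 [phi0 phi1]]]] := da_urysohn H (K := cball d x r1) (V := oball d x r)
  (closed_cpt HX (@closed_cball _ _ _ _ HX x r1)) (@open_oball _ _ _ _ HX x r)
  (fun y (hy : d x y <= r1) => le_lt_trans hy r1r).
have [Lp Lp0 hLp] := D_bounded H Aphi.
(* Chosen so that eta (Lam + M Lp) = s Lam: both the error of the slope and the product of q(f) with
   the gradient of phi are then covered by s Lam. *)
pose eta := s * Lam / (Lam + M * Lp).
have den : 0 < Lam + M * Lp by rewrite ltr_wpDr// mulr_ge0// ltW.
have eta0 : 0 < eta by rewrite divr_gt0// mulr_gt0.
have etas : eta * (Lam + M * Lp) = s * Lam by rewrite divfK// gt_eqF.
have etas' : eta <= s.
  by rewrite /eta ler_pdivrMr// ler_wpM2l ?(ltW s0)// lerDl; apply: mulr_ge0 => //; exact: ltW.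
have [q [q0 q'0 hq]] := hpoly eta eta0.
pose v := rowpoly f M q.
have hv : inAm Alg v by exact: rowpoly_inAm.
pose w y := phi y *: v y.
have hw : inAm Alg w by exact: (inAmM H).
have fM1' y i : `|f y ord0 i / M| <= 1 by exact: fM1.
have bq t := truncation_poly_bounds eta0 q0 hq kap0 (t := t).
exists w; exists r; first by rewrite rrho andbT (lt_trans r00 (lt_trans r01 r1r)).
split => //.
- move=> y ny; rewrite /w phi0 ?scale0r// => hy; apply: ny; exact: ltW.
- move=> y; apply: fnorm_mono => i j; rewrite ord1 !mxE normrM.
  have /andP[p0' p1'] := phi01 y; rewrite (ger0_norm p0').
  have [h _ _] := bq _ (fM1' y j).
  apply: (@le_trans _ _ (1 * `|M * q.[f y ord0 j / M]|)); first by rewrite ler_wpM2r.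
  rewrite mul1r normrM (gtr0_norm M0) mulrC -ler_pdivlMr// .
  by apply: le_trans h _; rewrite normrM normfV (gtr0_norm M0).
have bd : {ae mu, forall y : borelT X, fnorm (nab w y - nab f y) <= c0 * (\1_(smallvals f M kap) y + s)}.
  have O1 y : oball d x r1 y -> w y = v y.
    by move=> hy; rewrite /w phi1 ?scale1r//; exact: ltW.
  have h1 := nab_local_eq hw hv (@open_oball _ _ _ _ HX x r1) O1.
  have h2 := nab_suppgrad hf M0 fM.
  have h3 := grad_rowpoly hf M0 q.
  have h4 := gradM H Aphi hv.
  apply: filterS (filterI h1 (filterI h2 (filterI h3 (filterI h4 (filterI hL hLp))))) => y.
  move=> [g1 [g2 [g3 [g4 [g5 g6]]]]].
  have I0 : 0 <= \1_(smallvals f M kap) y :> R by rewrite indicE.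
  have gL i j : `|grad D f y i j| <= Lam by exact: le_trans (normr_le_fnorm _ _ _) g5.
  rewrite g2 fnormB.
  (* Inside, w coincides with [rowpoly q] on an open set and locality applies; outside, smallness of
     f controls the Leibniz terms. *)
  have [hy|hy] := pselect (oball d x r1 y).
    rewrite (g1 hy) /nab gradmuE -projTB; apply: le_trans (fnorm_projT _ _) _.
    rewrite /c0 -mulrA; apply: fnorm_le_entries; first by rewrite mulr_ge0 ?(ltW L1)// addr_ge0// ltW.
    move=> i j; rewrite [X in `|X|]mxE [(- grad _ _ _) _ _]mxE g3.
    apply: le_trans (suppgrad_entry M0 fM (ltW eta0) q'0 hq (gL i j)) _.
    by rewrite ler_wpM2l ?(ltW L1)// lerD2l.
  have fsmall i : `|f y ord0 i| < M * kap1.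
    rewrite ltNge; apply/negP => hi; apply: hy; apply: lt_trans r01; apply: hr0.
    by exists i.
  rewrite /nab gradmuE -projTB; apply: le_trans (fnorm_projT _ _) _.
  rewrite /c0 -mulrA; apply: fnorm_le_entries; first by rewrite mulr_ge0 ?(ltW L1)// addr_ge0// ltW.
  move=> i j.
  have e1 (A B C : 'M[R]_(m, N)) : (A - (B + C)) i j = A i j - B i j - C i j.
    by rewrite !mxE opprD addrA.
  have e2 (A : 'M[R]_(m, N)) : (phi y *: A) i j = phi y * A i j by rewrite mxE.
  rewrite [grad D w y]g4 e1 e2 g3 outerE.
  apply: le_trans (ler_normB _ _) _; rewrite mulrDr; apply: lerD.
    apply: suppgrad_entry_small => //.
    - by move=> t /hq[].
    - apply: lt_le_trans (fsmall i) _; rewrite ler_wpM2l ?(ltW M0)//.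
      by rewrite /kap1 ge_min lexx orbT.
  have tk : `|f y ord0 i / M| <= kap1'.
    rewrite normrM normfV (gtr0_norm M0) ler_pdivrMr// mulrC; apply: le_trans (ltW (fsmall i)) _.
    by rewrite ler_wpM2l ?(ltW M0)// /kap1 ge_min lexx.
  rewrite [v y ord0 i]mxE normrM normrM (gtr0_norm M0).
  have [_ /(_ tk) h _] := bq _ (fM1' y i).
  apply: (@le_trans _ _ (M * eta * Lp)).
    apply: ler_pM => //; first by rewrite mulr_ge0// ltW.
      rewrite ler_wpM2l ?(ltW M0)//; apply: le_trans h _.
      by rewrite -[leRHS]mulr1 ler_wpM2l// ltW.
    exact: le_trans (normr_le_fnorm _ _ _) g6.
  by rewrite [leRHS]mulrC -etas; have := mulr_ge0 (ltW eta0) (ltW L1); lra.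
apply: le_lt_trans (Ip_indic_bound _ _ c00 _ bd) _.
- by apply: mmeasB; exact: mmeas_nab.
- by apply: open_meas; exact: open_smallvals.
- by rewrite (ltW s0)/= ge_min lexx.
- apply: indic_bound_lt => //; [by rewrite mulr_ge0 ?powR_ge0|exact: ltW|exact: ltW].
Qed.

End Sobolev.

(** * Caratheodory integrands *)

Record caratheodory {R : realType} {X : pseudoPMetricType R} {a b : nat}
    (mu : {measure set (borelT X) -> \bar R}) (L : X -> 'M[R]_(a, b) -> \bar R) (p : R)
    (l : X -> 'M[R]_(a, b) -> R) (C c : R) : Prop := Caratheodory {
  ca_C : 0 < C ;
  ca_c : 0 < c ;
  ca_cont : {ae mu, forall x : borelT X, forall (xi : 'M[R]_(a, b)) (e : R), 0 < e ->
     exists2 del : R, 0 < del &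
     forall xi' : 'M[R]_(a, b), fnorm (xi' - xi) < del -> `|l x xi' - l x xi| < e} ;
  ca_meas : forall G, mmeas G -> rmeas (fun x => l x (G x)) ;
  ca_low : forall x xi, C * fnorm xi `^ p <= l x xi ;
  ca_up : forall x xi, l x xi <= c * (1 + fnorm xi `^ p) ;
  ca_ae : {ae mu, forall x : borelT X, forall xi, L x xi = (l x xi)%:E} }.

Section RationalMatrices.
Context {R : realType} {a b : nat}.

Definition ratmx (r : 'M[rat]_(a, b)) : 'M[R]_(a, b) := map_mx ratr r.

Lemma ratmx_dense (xi : 'M[R]_(a, b)) (e : R) : 0 < e ->
  exists r, fnorm (ratmx r - xi) < e.
Proof.
move=> e0; pose K : R := (a * b)%:R + 1; have K0 : 0 < K by rewrite ltr_wpDl.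
have eK : 0 < e / K by rewrite divr_gt0.
have /choice[q hq] : forall i, exists q : 'I_b -> rat, forall j, `|ratr (q j) - xi i j| < e / K.
  move=> i; suff /choice[q hq] : forall j, exists q : rat, `|ratr q - xi i j| < e / K by exists q.
  move=> j; have /rat_in_itvoo[q] : xi i j - e / K < xi i j + e / K by lra.
  by rewrite in_itv /= => /andP[h1 h2]; exists q; rewrite ltr_distl; apply/andP; split; lra.
exists (\matrix_(i, j) q i j); apply: (@le_lt_trans _ _ ((a * b)%:R * (e / K))).
  apply: fnorm_le_entries; first exact: ltW.
  by move=> i j; rewrite !mxE; exact: ltW.
by rewrite mulrCA -[ltRHS]mulr1 ltr_pM2l// ltr_pdivrMr// mul1r /K ltrDl.
Qed.

Lemma nbhs_fnorm (xi : 'M[R]_(a, b)) (V : set 'M[R]_(a, b)) : nbhs xi V ->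
  exists2 e : R, 0 < e & forall xi', fnorm (xi' - xi) < e -> V xi'.
Proof.
move=> /nbhs_ballP[e /= e0 he]; exists e => // xi' h; apply: he; split=> // i j.
rewrite /ball /= distrC; apply: le_lt_trans h.
by apply: le_trans (normr_le_fnorm (xi' - xi) i j); rewrite !mxE.
Qed.

End RationalMatrices.

Section Caratheodory.
Context {R : realType} {X : pseudoPMetricType R} {a b : nat}
  {mu : {measure set (borelT X) -> \bar R}} {L : X -> 'M[R]_(a, b) -> \bar R} {p : R}
  (p1 : 1 < p) (L0 : forall x xi, (0 <= L x xi)%E).
Let p0 : 0 < p := lt_trans ltr01 p1.

(* The a.e. growth bounds hold simultaneously only at rational matrices; continuity extends
   them to all matrices, at the price of the factors 2^p. *)
Lemma caratheodory_growth x (C c : R) : 0 < C -> 0 < c -> continuous (L x) ->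
  (forall r : 'M[rat]_(a, b), (C * fnorm (ratmx r : 'M[R]_(a, b)) `^ p)%:E <= L x (ratmx r)
     <= (c * (1 + fnorm (ratmx r : 'M[R]_(a, b)) `^ p))%:E)%E ->
  forall xi, ((C / 2 `^ p * fnorm xi `^ p)%:E <= L x xi
    <= (c * (1 + 2 `^ p) * (1 + fnorm xi `^ p))%:E)%E.
Proof.
move=> C0 c0 cL hr xi.
have aux1 (A B D f e k : R) : A <= B + D -> D <= k -> k <= e -> f + e + e = A -> f + e <= B.
  by move=> h1 h2 h3 h4; rewrite -(lerD2r e) h4 (le_trans h1)// lerD2l (le_trans h2).
have aux2 (H K A B : R) : H <= K * (A + B) -> 0 <= K -> B <= 1 -> 0 <= A -> 1 + H <= (1 + K) * (1 + A).
  move=> h k0 b1 a0; have b2 := ler_wpM2l k0 b1.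
  have -> : (1 + K) * (1 + A) = 1 + A + (K * A + K * 1) by ring.
  by rewrite -addrA lerD2l (le_trans h)// mulrDr -[leLHS]add0r lerD// lerD2l.
have K0 : 0 < 2 `^ p :> R by rewrite powR_gt0.
have small (del : R) (xi' : 'M[R]_(a, b)) : 0 < del <= 1 -> fnorm (xi' - xi) < del ->
    fnorm (xi' - xi) `^ p <= del.
  move=> /andP[d0 d1] h; apply: (@le_trans _ _ (del `^ p)).
    by rewrite ge0_ler_powR ?nnegrE ?fnorm_ge0 ?(ltW p0) ?(ltW d0)// ltW.
  by apply: ge1r_powR; rewrite ?d0//= ltW.
apply/andP; split.
- rewrite leNgt; apply/negP => hlt.
  have Lf : L x xi \is a fin_num.
    by rewrite ge0_fin_numE//; apply: lt_trans hlt _; exact: ltry.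
  move: hlt; rewrite -(fineK Lf) lte_fin => hlt.
  pose e := (C / 2 `^ p * fnorm xi `^ p - fine (L x xi)) / 2.
  have e0 : 0 < e by rewrite divr_gt0// subr_gt0.
  have e2 : fine (L x xi) + e + e = C / 2 `^ p * fnorm xi `^ p by rewrite /e; field.
  have : (L x xi < (fine (L x xi) + e)%:E)%E by rewrite -{1}(fineK Lf) lte_fin ltrDl.
  move=> /open_ereal_lt' /cL /nbhs_fnorm [del d0 hdel].
  pose del' := Num.min del (Num.min 1 (e / C)).
  have d'0 : 0 < del' by rewrite !lt_min d0 ltr01 divr_gt0.
  have [r hrd] := ratmx_dense xi d'0.
  have hd : fnorm (ratmx r - xi) < del by apply: lt_le_trans hrd _; rewrite ge_min lexx.
  have d'1 : 0 < del' <= 1 by rewrite d'0 ge_min ge_min lexx orbT.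
  have d'C : C * del' <= e by rewrite mulrC -ler_pdivlMr// !ge_min lexx !orbT.
  have hp := small _ _ d'1 hrd.
  have := hdel _ hd => /= hlt2; have /andP[hge _] := hr r.
  have := le_lt_trans hge hlt2; rewrite lte_fin; apply/negP; rewrite -leNgt.
  have := fpowD p0 (ratmx r) (xi - ratmx r); rewrite addrC subrK fnormB => hD.
  have h1 : C / 2 `^ p * fnorm xi `^ p <= C * (fnorm (ratmx r : 'M[R]_(a, b)) `^ p + fnorm (ratmx r - xi) `^ p).
    by rewrite mulrAC ler_pdivrMr// -mulrA ler_wpM2l ?(ltW C0)// mulrC.
  have h2 : C * fnorm (ratmx r - xi) `^ p <= C * del' by rewrite ler_wpM2l// ltW.
  by move: h1; rewrite mulrDr => /aux1; apply; [exact: h2|exact: d'C|exact: e2].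
- rewrite leNgt; apply/negP => /open_ereal_gt' /cL /nbhs_fnorm [del d0 hdel].
  pose del' := Num.min del 1.
  have d'0 : 0 < del' by rewrite !lt_min d0 ltr01.
  have [r hrd] := ratmx_dense xi d'0.
  have hd : fnorm (ratmx r - xi) < del by apply: lt_le_trans hrd _; rewrite ge_min lexx.
  have d'1 : 0 < del' <= 1 by rewrite d'0 ge_min lexx orbT.
  have hp := small _ _ d'1 hrd.
  have := hdel _ hd => /= hlt2; have /andP[_ hge] := hr r.
  have := lt_le_trans hlt2 hge; rewrite lte_fin; apply/negP; rewrite -leNgt.
  have := fpowD p0 xi (ratmx r - xi); rewrite addrC subrK => hD.
  rewrite -mulrA; apply: ler_wpM2l; first exact: ltW.
  apply: (aux2 _ _ _ _ hD (ltW K0)); last exact: powR_ge0.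
  by apply: le_trans hp _; have /andP[] := d'1.
Qed.

(** Replaces L by a finite-valued l whose growth bounds hold at every point and for all matrices,
    which spares exceptional sets in the integral estimates. *)
Lemma caratheodory_ex :
  {ae mu, forall x : borelT X, continuous (L x)} ->
  (forall xi : 'M[R]_(a, b), exists g : borelT X -> \bar R,
     measurable_fun [set: borelT X] g /\ {ae mu, forall x : borelT X, g x = L x xi}) ->
  (exists C c : R, 0 < C /\ 0 < c /\
     forall xi, {ae mu, forall x : borelT X,
       ((C * fnorm xi `^ p)%:E <= L x xi <= (c * (1 + fnorm xi `^ p))%:E)%E}) ->
  exists l C c, caratheodory mu L p l C c.
Proof.
move=> cL mL [C [c [C0 [c0 gr]]]].
have K0 : 0 < 2 `^ p :> R by rewrite powR_gt0.
have /choice[g hg] : forall r : 'M[rat]_(a, b), exists g : borelT X -> \bar R,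
     measurable_fun [set: borelT X] g /\ {ae mu, forall x : borelT X, g x = L x (ratmx r)}.
  by move=> r; exact: mL.
have hall : {ae mu, forall x : borelT X, forall n : nat,
    if (unpickle n : option 'M[rat]_(a, b)) is Some r then
      g r x = L x (ratmx r) /\
      ((C * fnorm (ratmx r : 'M[R]_(a, b)) `^ p)%:E <= L x (ratmx r) <= (c * (1 + fnorm (ratmx r : 'M[R]_(a, b)) `^ p))%:E)%E
    else True}.
  apply/ae_foralln => n; case: unpickle => [r|]; last exact: aeW.
  by apply: filterS (filterI (hg r).2 (gr (ratmx r))) => x [].
have [N0 [mN0 muN0 hN0]] := filterI cL hall.
have good x : ~ N0 x -> continuous (L x) /\ forall r : 'M[rat]_(a, b), g r x = L x (ratmx r) /\
      ((C * fnorm (ratmx r : 'M[R]_(a, b)) `^ p)%:E <= L x (ratmx r) <= (c * (1 + fnorm (ratmx r : 'M[R]_(a, b)) `^ p))%:E)%E.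
  move=> nx; have : ~ ~ _ := fun h => nx (hN0 x h); move=> /contrapT[h1 h2].
  by split=> // r; have := h2 (pickle r); rewrite pickleK.
(* The summand C' in c' makes the upper bound hold on [N0] too, where l is set equal to C' times the
   p-th power of the norm. *)
pose C' := C / 2 `^ p; pose c' := c * (1 + 2 `^ p) + C'.
have C'0 : 0 < C' by rewrite divr_gt0.
have cc0 : 0 < c * (1 + 2 `^ p) by rewrite mulr_gt0// addr_gt0.
have c'0 : 0 < c' by rewrite addr_gt0.
pose l x xi := if x \in N0 then C' * fnorm xi `^ p else fine (L x xi).
have gro x xi : ~ N0 x -> ((C' * fnorm xi `^ p)%:E <= L x xi <= (c * (1 + 2 `^ p) * (1 + fnorm xi `^ p))%:E)%E.
  by move=> /good[h1 h2]; apply: caratheodory_growth => // r; have [] := h2 r.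
have lE x xi : ~ N0 x -> L x xi = (l x xi)%:E.
  move=> nx; rewrite /l memNset// fineK// ge0_fin_numE//.
  by have /andP[_ h] := gro x xi nx; apply: le_lt_trans h _; exact: ltry.
have lcont x : ~ N0 x -> forall (xi : 'M[R]_(a, b)) (e : R), 0 < e -> exists2 del : R, 0 < del &
     forall xi' : 'M[R]_(a, b), fnorm (xi' - xi) < del -> `|l x xi' - l x xi| < e.
  move=> nx xi e e0; have [cx _] := good x nx.
  have h1 : (L x xi < (l x xi + e)%:E)%E by rewrite lE// lte_fin ltrDl.
  have h2 : ((l x xi - e)%:E < L x xi)%E by rewrite lE// lte_fin gtrBl.
  have [d1 d10 hd1] := nbhs_fnorm (cx _ _ (open_ereal_lt' h1)).
  have [d2 d20 hd2] := nbhs_fnorm (cx _ _ (open_ereal_gt' h2)).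
  exists (Num.min d1 d2); first by rewrite lt_min d10.
  move=> xi'; rewrite lt_min => /andP[/hd1 /= + /hd2 /=]; rewrite lE// !lte_fin => k1 k2.
  by rewrite ltr_distl k2 k1.
exists l, C', c'; split=> //.
- by exists N0; split=> // x /= h; apply: contrapT => nx; apply: h; exact: lcont.
- move=> G mG.
  pose h x := if x \in N0 then 0 else l x (G x).
  have hE : (fun x => l x (G x)) = (fun x => if x \in N0 then C' * fnorm (G x) `^ p else h x).
    by apply/funext => x; rewrite /h /l; case: ifP.
  have mb : measurable_fun [set: borelT X] (fun x : borelT X => x \in N0).
    apply: (measurable_fun_bool true); rewrite (_ : _ @^-1` _ = N0) ?setTI//.
    by apply/seteqP; split=> x /=; [move/set_mem | move/mem_set].
  rewrite hE; apply: measurable_fun_ifT => //.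
    by apply: measurable_funM => //; exact: measurable_fpow.
  apply: (measurability _ (RGenInftyO.measurableE R)).
  move=> _ [_ [s ->] <-]; rewrite setTI.
  (* By continuity, [h x < s] off [N0] means that for some k every rational matrix r within 1/(k+1)
     of [G x] has [g r x] at most s - 1/(k+1). Codes of no matrix get [setT], neutral for the
     intersection. *)
  pose S (k n : nat) : set (borelT X) :=
    if (unpickle n : option 'M[rat]_(a, b)) is Some r then
      [set x | k.+1%:R^-1 <= fnorm (ratmx r - G x)] `|` [set x | (g r x <= (s - k.+1%:R^-1)%:E)%E]
    else setT.
  have mS k n : measurable (S k n).
    rewrite /S; case: unpickle => [r|]; last exact: measurableT.
    apply: measurableU.
      have := measurable_fnorm (mmeasB (mmeas_cst (ratmx r)) mG).
      move=> /(_ measurableT `[k.+1%:R^-1, +oo[%classic (measurable_itv _)); rewrite setTI.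
      by congr measurable; apply/seteqP; split=> x /=; rewrite in_itv/= andbT.
    have := (hg r).1 measurableT [set u | (u <= (s - k.+1%:R^-1)%:E)%E].
    rewrite setTI; apply; have := emeasurable_itv `]-oo, (s - k.+1%:R^-1)%:E]%O.
    by congr measurable; apply/seteqP; split=> x /=; rewrite in_itv.
  have inN0 : measurable ([set x : borelT X | 0 < s] `&` N0).
    have [s0|s0] := ltP 0 s.
      by rewrite (_ : [set _ | _] = setT) ?setTI//; apply/seteqP; split.
    by rewrite (_ : [set _ | _] = set0) ?set0I//; apply/seteqP; split=> x //=; rewrite ltNge s0.
  rewrite [X in measurable X](_ : _ = ([set x : borelT X | 0 < s] `&` N0) `|`
      (~` N0 `&` \bigcup_k \bigcap_n S k n)).
    apply: measurableU => //; apply: measurableI; first exact: measurableC.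
    by apply: bigcupT_measurable => k; exact: bigcapT_measurable.
  apply/seteqP; split=> x /=; rewrite in_itv /= /h.
  + case: ifPn => [/set_mem xN hs|/negP xN' hs]; first by left.
    have nx : ~ N0 x by move=> /mem_set.
    right; split=> //.
    pose e := (s - l x (G x)) / 2; have e0 : 0 < e by rewrite divr_gt0// subr_gt0.
    have [del d0 hdel] := lcont x nx (G x) e e0.
    have [k kn] : exists k : nat, k.+1%:R^-1 < Num.min e del.
      have m0 : 0 < Num.min e del by rewrite lt_min e0.
      have := near_infty_natSinv_lt (PosNum m0).
      by case=> k _ /(_ k (leqnn k)) hk; exists k.
    move: kn; rewrite lt_min => /andP[ke kd].
    exists k => // n _; rewrite /S; case: unpickle => [r|]//.
    have [hr|hr] := leP k.+1%:R^-1 (fnorm (ratmx r - G x)); [by left|right] => /=.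
    have [_ /(_ r)[-> _]] := good x nx; rewrite lE// lee_fin.
    have := hdel (ratmx r) (lt_trans hr kd); rewrite ltr_distl => /andP[_ h2].
    have : e * 2 = s - l x (G x) by rewrite divfK.
    by move: (k.+1%:R^-1) ke => ik ke; lra.
  + move=> [[s0 xN]|[nx [k _ hk]]]; first by rewrite mem_set.
    rewrite memNset//; have k0 : 0 < k.+1%:R^-1 :> R by rewrite invr_gt0 ltr0n.
    have [del d0 hdel] := lcont x nx (G x) _ k0.
    have m0 : 0 < Num.min del k.+1%:R^-1 by rewrite lt_min d0.
    have [r hr] := ratmx_dense (G x) m0; move: hr; rewrite lt_min => /andP[hr1 hr2].
    have := hk (pickle r) Logic.I; rewrite /S pickleK => -[/=|/=]; first by rewrite leNgt hr2.
    have [_ /(_ r)[-> _]] := good x nx; rewrite lE// lee_fin => hle.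
    by have := hdel _ hr1; rewrite ltr_distl => /andP[h1 _]; rewrite -(ltrD2r (- k.+1%:R^-1)) (lt_le_trans h1).
- move=> x xi; rewrite /l; case: ifPn => // /negP nx.
  have nx' : ~ N0 x by move=> /mem_set.
  by rewrite -lee_fin; have /andP[h _] := gro x xi nx'; rewrite -[fine _]/(fine _) (le_trans h)// lE// /l memNset.
- move=> x xi; have h0 : 0 <= fnorm xi `^ p by exact: powR_ge0.
  rewrite /l /c'; case: ifPn => [_|/negP nx].
    rewrite mulrDl; have := mulr_ge0 (ltW cc0) h0; rewrite !mulrDr !mulr1; lra.
  have nx' : ~ N0 x by move=> /mem_set.
  have /andP[_] := gro x xi nx'; rewrite lE// /l memNset// lee_fin => /le_trans; apply.
  by rewrite mulrDl lerDl mulr_ge0 ?(ltW C'0)// addr_ge0.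
- by exists N0; split=> // x /= h; apply: contrapT => nx; apply: h => xi; exact: lE.
Qed.

End Caratheodory.

Lemma projT_idem {R : realType} {a b : nat} (z : nat -> 'M[R]_(a, b)) xi :
  projT (seqspan z) (projT (seqspan z) xi) = projT (seqspan z) xi.
Proof.
rewrite -{1}(subKr xi (projT (seqspan z) xi)) projTB.
by rewrite (projT_span (projTP z xi).1) subr0.
Qed.

Lemma measXT {R : realType} {X : pseudoPMetricType R} : measX [set: X].
Proof. exact: measurableT. Qed.
#[local] Hint Resolve measXT : core.

Lemma int_bigsetU {R : realType} {X : pseudoPMetricType R}
  (mu : {measure set (borelT X) -> \bar R}) (Q : nat -> set X) (f : X -> R) n :
  (forall i, measX (Q i)) -> trivIset setT Q -> rmeas f -> (forall x, 0 <= f x) ->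
  (\int[mu]_(x in \big[setU/set0]_(i < n) Q i) (f x)%:E =
   \sum_(i < n) \int[mu]_(x in Q i) (f x)%:E)%E.
Proof.
move=> mQ tQ mf f0; rewrite -(big_mkord xpredT Q) (@ge0_integral_bigsetU _ _ _ mu _ Q) ?iota_uniq//.
- by rewrite big_mkord.
- exact: sub_trivIset tQ.
- exact: rmeasE.
- by move=> x _; rewrite lee_fin.
Qed.

Lemma ring_pigeonhole {R : realType} {X : pseudoPMetricType R}
  (mu : {measure set (borelT X) -> \bar R}) (Q : set X) (S : nat -> set X) (f : X -> R) (T : R) n :
  measX Q -> (forall i, measX (S i)) -> trivIset setT S -> (forall i, S i `<=` Q) ->
  rmeas f -> (forall x, 0 <= f x) -> (\int[mu]_(x in Q) (f x)%:E <= T%:E)%E -> (0 < n)%N ->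
  exists2 i, (i < n)%N & (\int[mu]_(x in S i) (f x)%:E <= (T / n%:R)%:E)%E.
Proof.
move=> mQ mS tS SQ mf f0 fT; case: n => // n _; apply: contrapT => hn.
have h i : (i < n.+1)%N -> ((T / n.+1%:R)%:E < \int[mu]_(x in S i) (f x)%:E)%E.
  by move=> i_n; rewrite ltNge; apply/negP => hle; apply: hn; exists i.
have := int_bigsetU mu n.+1 mS tS mf f0 => hS.
have : (T%:E < \int[mu]_(x in \big[setU/set0]_(i < n.+1) S i) (f x)%:E)%E.
  rewrite hS.
  have -> : (T%:E = \sum_(i < n.+1) (T / n.+1%:R)%:E)%E.
    by rewrite sumEFin sumr_const card_ord -[(_ / _) *+ _]mulr_natr divfK// pnatr_eq0.
  rewrite !big_ord_recr/=; apply: lee_ltD.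
  - by rewrite sumEFin.
  - by apply: lee_sum => i _; apply: ltW; apply: h; exact: leqW (ltn_ord i).
  - exact: h.
apply/negP; rewrite -leNgt; apply: le_trans fT; apply: int_subset => //.
  by apply: bigsetU_measurable => i _; exact: mS.
by move=> x; rewrite -bigcup_mkord => -[i _ /SQ].
Qed.

(** * Vitali coverings and limits along radii *)

Definition frequently0 {R : realType} (P : R -> Prop) :=
  forall e : R, 0 < e -> exists2 r, 0 < r < e & P r.

Section Vitali.
Context {R : realType} {X : pseudoPMetricType R} {d : X -> X -> R}
  {mu : {measure set (borelT X) -> \bar R}} (HX : compact_metric d mu).

Lemma cball_neg x : cball d x (-1) = set0.
Proof.
rewrite -subset0 => y; rewrite /cball/= => h.
by have := le_trans (cm_ge0 HX x y) h; rewrite lerNr oppr0 ler10.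
Qed.

Lemma oball_neg x : oball d x (-1) = set0.
Proof. by rewrite -subset0 -(cball_neg x) => y /ltW. Qed.

Lemma mu_bigsetU (Q : nat -> set X) n : (forall i, measX (Q i)) -> trivIset setT Q ->
  mu (\big[setU/set0]_(i < n) Q i) = (\sum_(i < n) fine (mu (Q i)))%:E.
Proof.
move=> mQ tQ; have := int_bigsetU mu n mQ tQ (rmeas_cst 1) (fun=> ler01).
rewrite int_cst; last by apply: bigsetU_measurable => i _; exact: mQ.
rewrite mul1e => ->; rewrite -sumEFin; apply: eq_bigr => i _.
by rewrite int_cst// mul1e fineK// (mu_fin_num HX (mQ i)).
Qed.

Context (hC2 : forall (A : set X) (F : set (set X)),
     (forall B, F B -> exists (x : X) (r : R), 0 < r /\ B = cball d x r) ->
     (forall x, A x -> forall e : R, 0 < e -> exists r : R, 0 < r < e /\ F (cball d x r)) ->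
     exists Gf : set (set X), Gf `<=` F /\ countable Gf /\ trivIset Gf id /\
       mu.-negligible (A `\` \bigcup_(B in Gf) B)).

(* Unused indices carry the radius -1, for which both balls are empty. *)
Lemma vitali_finite (E : set X) (P : X -> R -> Prop) (e del : R) :
  (forall x, E x -> frequently0 (P x)) ->
  (forall A, open A -> E `<=` A -> (e%:E <= mu A)%E) -> 0 < del ->
  exists n (x : nat -> X) (r : nat -> R), [/\
    forall j, r j = -1 \/ 0 < r j /\ P (x j) (r j),
    trivIset setT (fun j => cball d (x j) (r j)) &
    ((e - del)%:E < mu (\big[setU/set0]_(j < n) cball d (x j) (r j)))%E].
Proof.
move=> hP hE del0.
pose F : set (set X) := [set B | exists x r, [/\ 0 < r, P x r & B = cball d x r]].
have [B [x [r [r0 _ ->]]]|x Ex e0 e00|Gf [GF [cG [tG nG]]]] := hC2 (A := E) (F := F).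
- by exists x, r.
- have [r r0 Pr] := hP x Ex e0 e00; exists r; split=> //.
  by exists x, r; split=> //; have /andP[] := r0.
(* f numbers the countable family injectively, so each index carries at most one ball. *)
have [f finj] := countable_injP _ cG.
have /choice[xr hxr] : forall j, exists xr : X * R,
    (exists2 B, Gf B & [/\ f B = j, 0 < xr.2, P xr.1 xr.2 & B = cball d xr.1 xr.2]) \/
    (xr.2 = -1 /\ forall B, Gf B -> f B <> j).
  move=> j; have [[B GB fB]|h] := pselect (exists2 B, Gf B & f B = j).
    have [x [r [r0 Pxr BE]]] := GF B GB.
    by exists (x, r); left; exists B.
  exists (point, -1); right; split=> // B GB fB; apply: h; by exists B.
pose Q j := cball d (xr j).1 (xr j).2.
have mQ j : measX (Q j) by exact: (@meas_cball _ _ _ _ HX).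
have tQ : trivIset setT Q.
  apply/trivIsetP => i j _ _ ij; rewrite -subset0 => y [Qi Qj].
  have [[Bi GBi [fi _ _ BiE]]|[hi _]] := hxr i; last by move: Qi; rewrite /Q hi cball_neg.
  have [[Bj GBj [fj _ _ BjE]]|[hj _]] := hxr j; last by move: Qj; rewrite /Q hj cball_neg.
  have : Bi = Bj by apply: tG => //; exists y; rewrite BiE BjE.
  by move=> BB; move/eqP: ij; apply; rewrite -fi -fj BB.
have UQ : \bigcup_(B in Gf) B `<=` \bigcup_j Q j.
  move=> y [B GB By]; exists (f B) => //; rewrite /Q.
  have [[B' GB' [fB' _ _ BE]]|[_ h]] := hxr (f B); last by have := h B GB.
  by rewrite -BE; rewrite (finj B' B) ?inE.
have mU : measX (\bigcup_j Q j) by apply: bigcupT_measurable => j; exact: mQ.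
have hU : (e%:E <= mu (\bigcup_j Q j))%E.
  have [N [mN N0 EN]] := nG.
  have mUN : measX (\bigcup_j Q j `|` N) by exact: measurableU.
  apply: (@le_trans _ _ (mu (\bigcup_j Q j `|` N))); last first.
    by apply: le_trans (mu_leU mU mN) _; rewrite N0 adde0.
  (* The bound by e is available for open sets only, so the union of the balls and of the null set N
     is enlarged to an open set. *)
  apply/lee_addgt0Pr => eta eta0.
  have [V [oV UV] muV] := open_approx HX mUN eta0.
  apply: le_trans (hE V oV _) muV => y Ey; apply: UV.
  have [hy|hy] := pselect ((\bigcup_(B in Gf) B) y); first by left; exact: UQ.
  by right; apply: EN.
have mB n : measX (\big[setU/set0]_(j < n) Q j) by apply: bigsetU_measurable => j _; exact: mQ.
have [n hn] : exists n, (mu (\bigcup_j Q j `\` \big[setU/set0]_(j < n) Q j) < del%:E)%E.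
  apply: (@measure_decr_lt _ _ _ mu (fun n => \bigcup_j Q j `\` \big[setU/set0]_(j < n) Q j)) => //.
  - exact: (mu_fin_meas HX (measurableD mU (mB _))).
  - by move=> n; exact: (measurableD mU (mB n)).
  - move=> n k nk; apply: setDS; rewrite -!bigcup_mkord; apply: bigcup_subset => j /= jn.
    exact: leq_trans jn nk.
  - rewrite -subset0 => y hy; have [[j _ Qj] _] := hy 0%N I.
    have [_] := hy j.+1 I; apply; rewrite -bigcup_mkord; exists j => //=.
exists n, (fun j => (xr j).1), (fun j => (xr j).2); split=> //.
  by move=> j; have [[B GB [_ r0 Pr _]]|[-> _]] := hxr j; [right|left].
have mf := mu_fin_num HX (mB n).
have sub : \big[setU/set0]_(j < n) Q j `<=` \bigcup_j Q j.
  by rewrite -bigcup_mkord; apply: bigcup_subset.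
have hs : (e%:E < mu (\big[setU/set0]_(j < n) Q j) + del%:E)%E.
  apply: le_lt_trans hU _; rewrite -{1}(setDUK sub).
  apply: le_lt_trans (mu_leU (mB n) (measurableD mU (mB n))) _.
  by rewrite lteD2lE.
by rewrite EFinB lteBlDr.
Qed.

End Vitali.

Lemma near_right0 {R : realType} (P : R -> Prop) (del : R) : 0 < del ->
  (forall r, 0 < r < del -> P r) -> \forall r \near 0^'+, P r.
Proof.
move=> d0 h; near=> r; apply: h; apply/andP; split; near: r.
- exact: nbhs_right_gt.
- exact: nbhs_right_lt.
Unshelve. all: end_near. Qed.

Lemma not_frequently0 {R : realType} (P : R -> Prop) : ~ frequently0 P ->
  exists2 del : R, 0 < del & forall r, 0 < r < del -> ~ P r.
Proof.
move=> h; apply: contrapT => hn; apply: h => e e0; apply: contrapT => he.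
by apply: hn; exists e => // r hr Pr; apply: he; exists r.
Qed.

Lemma cvge_order {R : realType} {T : Type} (F : set_system T) {FF : Filter F}
  (f : T -> \bar R) (l : \bar R) :
  (forall y : R, (y%:E < l)%E -> \forall x \near F, (y%:E < f x)%E) ->
  (forall y : R, (l < y%:E)%E -> \forall x \near F, (f x < y%:E)%E) -> f @ F --> l.
Proof.
move=> h1 h2 A /=; case: l h1 h2 => [r| |] h1 h2.
- move=> hnA; have /nbhs_ballP[e /= e0 he] : nbhs r (fun z => A z%:E) by exact: hnA.
  have hA (z : R) : r - e < z < r + e -> A z%:E.
    move=> hz; apply: (he z); rewrite /ball/= distrC ltr_distl; exact: hz.
  have n1 := h1 (r - e); have n2 := h2 (r + e).
  have {}n1 := n1 (_ : ((r - e)%:E < r%:E)%E); have {}n2 := n2 (_ : (r%:E < (r + e)%:E)%E).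
  have {}n1 := n1 ltac:(by rewrite lte_fin gtrBl).
  have {}n2 := n2 ltac:(by rewrite lte_fin ltrDl).
  apply: filterS (filterI n1 n2) => x [/=]; case: (f x) => // z.
  by rewrite !lte_fin => z1 z2; apply: hA; rewrite z1.
- move=> [M [Mr hM]]; apply: filterS (h1 M (ltry M)) => x; exact: hM.
- move=> [M [Mr hM]]; apply: filterS (h2 M (ltNyr M)) => x; exact: hM.
Qed.

(* The common limit is the upper limit of b at 0. *)
Lemma squeeze_cvg {R : realType} (a b : R -> \bar R) :
  (forall r, 0 < r -> (0 <= a r)%E) -> (forall r, 0 < r -> (a r <= b r)%E) ->
  (forall s t : rat, 0 < (ratr s : R) < ratr t ->
     ~ (frequently0 (fun r => (a r < (ratr s)%:E)%E) /\
        frequently0 (fun r => ((ratr t)%:E < b r)%E))) ->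
  exists l : \bar R, a @ 0^'+ --> l /\ b @ 0^'+ --> l.
Proof.
move=> a0 ab hst.
pose S := [set y : \bar R | exists2 del : R, 0 < del & forall r, 0 < r < del -> (b r <= y)%E].
pose l := ereal_inf S.
have up y : (l < y)%E -> \forall r \near 0^'+, (b r < y)%E.
  move=> /ereal_inf_lt[z [del d0 hd] zy]; apply: (near_right0 d0) => r hr.
  exact: le_lt_trans (hd r hr) zy.
have low (y : R) : (y%:E < l)%E -> \forall r \near 0^'+, (y%:E < a r)%E.
  move=> yl; have [y0|y0] := ltP y 0.
    apply: (near_right0 ltr01) => r /andP[r0 _]; apply: lt_le_trans (a0 r r0).
    by rewrite lte_fin.
  have [z yz zl] : exists2 z : R, y < z & (z%:E <= l)%E.
    move: yl; case: (l) => [w| |] //; last by exists (y + 1); [rewrite ltrDl|rewrite leey].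
    by rewrite lte_fin => yw; exists w.
  have [s] := rat_in_itvoo yz; rewrite in_itv/= => /andP[ys sz].
  have [t] := rat_in_itvoo sz; rewrite in_itv/= => /andP[st tz].
  have s0 : 0 < ratr s :> R by exact: le_lt_trans ys.
  have hs : 0 < (ratr s : R) < ratr t by rewrite s0.
  (* Otherwise [ratr t] would bound b near 0 and hence be at least l; the hypothesis then prevents a
     from being frequently below [ratr s]. *)
  have hb : frequently0 (fun r => ((ratr t)%:E < b r)%E).
    apply: contrapT => /not_frequently0[del d0 hd].
    have : (l <= (ratr t)%:E)%E.
      apply: ereal_inf_lbound; exists del => // r /hd /negP; by rewrite -leNgt.
    apply/negP; rewrite -ltNge; apply: lt_le_trans zl; by rewrite lte_fin.
  have /not_frequently0[del d0 hd] : ~ frequently0 (fun r => (a r < (ratr s)%:E)%E).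
    by move=> ha; exact: (hst s t hs).
  apply: (near_right0 d0) => r /hd/negP; rewrite -leNgt; apply: lt_le_trans.
  by rewrite lte_fin.
have abn : \forall r \near 0^'+, (a r <= b r)%E.
  by apply: (near_right0 ltr01) => r /andP[r0 _]; exact: ab.
exists l; split; apply: cvge_order => // y hy.
- by apply: filterS (filterI abn (up _ hy)) => r [/le_lt_trans]; exact.
- by apply: filterS (filterI abn (low _ hy)) => r [h1 h2]; exact: lt_le_trans h2 h1.
- exact: up.
Qed.

(** * The relaxed integrand and the relaxed functional *)

Section RelaxedIntegrand.
Context {R : realType} {X : pseudoPMetricType R} {d : X -> X -> R}
  {mu : {measure set (borelT X) -> \bar R}} {Alg : set (X -> R)} {m N : nat}
  {D : (X -> R) -> X -> 'rV[R]_N} {vk : nat -> X -> 'rV[R]_m} {p : R}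
  (HS : sobolev d mu Alg D vk p)
  {L : X -> 'M[R]_(m, N) -> \bar R} {l : X -> 'M[R]_(m, N) -> R} {C c : R}
  (HL : caratheodory mu L p l C c).
Let H := sb_da HS.
Let HX := da_metric H.
Let p1 := sb_p HS.
Let p0 : 0 < p := lt_trans ltr01 p1.
Let Sx := spanAt D vk.
Let nab := gradmu D Sx.
Implicit Types (u v w f : X -> 'rV[R]_m) (G : X -> 'M[R]_(m, N)).

Let C0 := ca_C HL.
Let c0 := ca_c HL.

Lemma l_ge0 x xi : 0 <= l x xi.
Proof. by apply: le_trans (ca_low HL x xi); rewrite mulr_ge0 ?powR_ge0// ltW. Qed.

(* avec enumerates the rational combinations of the v_k and zc their gradients; hl, the
   resulting countable infimum, is a finite-valued version of Lhat. *)
Definition avec (n : nat) : X -> 'rV[R]_m := fun x =>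
  if (unpickle n : option (seq rat)) is Some s then \sum_(k < size s) ratr s`_k *: vk k x else 0.

Definition zc (n : nat) (x : X) : 'M[R]_(m, N) :=
  if (unpickle n : option (seq rat)) is Some s then ratcomb (fun k => grad D (vk k) x) s else 0.

Lemma avec_A0 n : A0 Alg mu (avec n).
Proof.
have [hv _] := sb_gen HS; rewrite /avec; case: unpickle => [s|].
  split; first by apply: (inAm_sum H _ (v := fun k x => ratr s`_k *: vk k x)) => k;
    apply: (inAmZ H); have [] := hv k.
  move=> x sx; apply: big1 => k _; have [_ h] := hv k; by rewrite h// scaler0.
by split; first exact: (inAm0 H).
Qed.

Lemma grad_avec n : {ae mu, forall x : borelT X, grad D (avec n) x = zc n x}.
Proof.
rewrite /avec /zc; case: unpickle => [s|]; last exact: (grad0 H).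
have hk k : inAm Alg (fun x => ratr s`_k *: vk k x) by apply: (inAmZ H); exact: (vk_inAm HS).
have hZ : {ae mu, forall x : borelT X, forall k,
    grad D (fun y => ratr s`_k *: vk k y) x = ratr s`_k *: grad D (vk k) x}.
  by apply/ae_foralln => k; apply: (gradZ H); exact: (vk_inAm HS).
apply: filterS (filterI (grad_sum H (size s) hk) hZ) => x [-> hx].
by rewrite /ratcomb; apply: eq_bigr => k _; rewrite hx.
Qed.

Lemma zc_span n x : seqspan (fun k => grad D (vk k) x) (zc n x).
Proof. by rewrite /zc; case: unpickle => [s|]; [exact: seqspan_ratcomb|exact: seqspan0]. Qed.

Lemma zc0 x : zc (pickle ([::] : seq rat)) x = 0.
Proof. by rewrite /zc pickleK /ratcomb big_ord0. Qed.

Lemma zc_dense x z (e : R) : seqspan (fun k => grad D (vk k) x) z -> 0 < e ->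
  exists n, fnorm (zc n x - z) < e.
Proof.
move=> hz e0; have [s hs] := ratcomb_dense hz e0.
by exists (pickle s); rewrite /zc pickleK fnormB.
Qed.

Lemma mmeas_zc n : mmeas (zc n).
Proof.
rewrite /zc; case: unpickle => [s|]; last exact: mmeas_cst.
by apply: (mmeas_ratcomb (B := fun k x => grad D (vk k) x)) => k; apply: (mmeas_grad H); exact: (vk_inAm HS).
Qed.

Definition hl (x : X) (xi : 'M[R]_(m, N)) : R := inf [set l x (xi + zc n x) | n in [set: nat]].

Lemma hl_has_inf x xi : has_inf [set l x (xi + zc n x) | n in [set: nat]].
Proof.
split; first by exists (l x (xi + zc 0 x)), 0%N.
by exists 0 => _ [n _ <-]; exact: l_ge0.
Qed.

Lemma hl_le x xi n : hl x xi <= l x (xi + zc n x).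
Proof. by apply: ge_inf; [have [] := hl_has_inf x xi|exists n]. Qed.

Lemma hl_lt x xi t : hl x xi < t -> exists n, l x (xi + zc n x) < t.
Proof. by move=> h; have [_ [n _ <-] h'] := inf_lt (hl_has_inf x xi).1 h; exists n. Qed.

Lemma hl_ge x xi t : (forall n, t <= l x (xi + zc n x)) -> t <= hl x xi.
Proof.
by move=> h; rewrite leNgt; apply/negP => /hl_lt[n]; apply/negP; rewrite -leNgt.
Qed.

Lemma hl_ge0 x xi : 0 <= hl x xi.
Proof. by apply: hl_ge => n; exact: l_ge0. Qed.

Lemma hl_le_l x xi : hl x xi <= l x xi.
Proof. by have := hl_le x xi (pickle ([::] : seq rat)); rewrite zc0 addr0. Qed.

Lemma hl_up x xi : hl x xi <= c * (1 + fnorm xi `^ p).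
Proof. exact: le_trans (hl_le_l x xi) (ca_up HL x xi). Qed.

(** Adding an element of the normal space does not change the projection, and projecting does not
    increase the norm: coercivity survives for the tangential part. *)
Lemma hl_low x xi : C * fnorm (projT (seqspan (fun k => grad D (vk k) x)) xi) `^ p <= hl x xi.
Proof.
apply: hl_ge => n; apply: le_trans (ca_low HL _ _); rewrite ler_wpM2l ?(ltW C0)//.
apply: fpow_le => //.
have := fnorm_projT (fun k => grad D (vk k) x) (xi + zc n x).
by rewrite projTD (projT_span (zc_span n x)) addr0.
Qed.

Lemma hl_meas G : mmeas G -> rmeas (fun x => hl x (G x)).
Proof.
move=> mG; apply: (measurability _ (RGenInftyO.measurableE R)).
move=> _ [_ [s ->] <-]; rewrite setTI.
rewrite [X in measurable X](_ : _ = \bigcup_n [set x : borelT X | l x (G x + zc n x) < s]).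
  apply: bigcupT_measurable => n.
  have := ca_meas HL (mmeasD mG (mmeas_zc n)).
  move=> /(_ measurableT `]-oo, s[%classic (measurable_itv _)); rewrite setTI.
  by congr measurable; apply/seteqP; split=> x /=; rewrite in_itv.
apply/seteqP; split=> x /=; rewrite in_itv/=; first by move=> /hl_lt[n hn]; exists n.
by move=> [n _ hn]; exact: le_lt_trans (hl_le _ _ n) hn.
Qed.

(** One almost optimal [zc n] at xi remains admissible for nearby matrices; this one-sided
    continuity is what [nemytskii_usc] asks for. *)
Lemma hl_usc : {ae mu, forall x : borelT X, forall (xi : 'M[R]_(m, N)) (e : R), 0 < e ->
  exists2 del : R, 0 < del & forall xi' : 'M[R]_(m, N), fnorm (xi' - xi) < del ->
  hl x xi' < hl x xi + e}.
Proof.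
apply: filterS (ca_cont HL) => x hx xi e e0.
have e2 : 0 < e / 2 by rewrite divr_gt0.
have /hl_lt[n hn] : hl x xi < hl x xi + e / 2 by rewrite ltrDl.
have [del d0 hdel] := hx (xi + zc n x) _ e2; exists del => // xi' h.
apply: le_lt_trans (hl_le x xi' n) _.
have := hdel (xi' + zc n x); rewrite opprD addrACA subrr addr0 => /(_ h).
rewrite ltr_distl => /andP[_ h2]; apply: lt_trans h2 _.
by rewrite [e in ltRHS]splitr addrA ltrD2r.
Qed.

(** The [zc n x] are dense in the normal space and l is continuous, so a translation by z changes
    the infimum by at most any positive e; -z gives the converse. *)
Lemma hl_span : {ae mu, forall x : borelT X, forall xi z,
  seqspan (fun k => grad D (vk k) x) z -> hl x (xi + z) = hl x xi}.
Proof.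
have key : {ae mu, forall x : borelT X, forall xi z,
    seqspan (fun k => grad D (vk k) x) z -> hl x (xi + z) <= hl x xi}.
  apply: filterS (ca_cont HL) => x hx xi z hz.
  apply: hl_ge => n; apply/ler_addgt0Pr => e e0.
  have [del d0 hdel] := hx (xi + zc n x) e e0.
  have [k hk] := zc_dense (seqspanB (zc_span n x) hz) d0.
  apply: le_trans (hl_le x (xi + z) k) _.
  have := hdel (xi + z + zc k x).
  have -> : xi + z + zc k x - (xi + zc n x) = zc k x - (zc n x - z).
    by rewrite opprB opprD addrACA -addrA addrACA subrr add0r addrCA addrA addrC.
  by move=> /(_ hk); rewrite ltr_distl => /andP[_ /ltW].
apply: filterS key => x hx xi z hz; apply/eqP; rewrite eq_le hx//=.
by have := hx (xi + z) (- z) (seqspanN hz); rewrite addrK.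
Qed.

Lemma hl_nab v : inAm Alg v ->
  {ae mu, forall x : borelT X, hl x (nab v x) = hl x (grad D v x)}.
Proof.
move=> hv; apply: filterS hl_span => x hx.
have [h _] := projTP (fun k => grad D (vk k) x) (grad D v x).
by rewrite -(hx (nab v x) _ h) /nab gradmuE addrC subrK.
Qed.

Lemma Lhat_hl : {ae mu, forall x : borelT X, forall xi, Lhat Sx L x xi = (hl x xi)%:E}.
Proof.
apply: filterS (filterI (ca_ae HL) (filterI (ca_cont HL) hl_span)) => x [hL [hc hs]] xi.
apply/eqP; rewrite eq_le; apply/andP; split.
- apply/lee_addgt0Pr => e e0.
  have /hl_lt[n hn] : hl x xi < hl x xi + e by rewrite ltrDl.
  apply: ge_ereal_inf; exists (L x (xi + zc n x)); last by rewrite hL -EFinD lee_fin ltW.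
  by exists (zc n x) => //; exact: zc_span.
- apply: le_ereal_inf_tmp => _ [z hz <-]; rewrite hL lee_fin.
  by rewrite -(hs xi z hz) hl_le_l.
Qed.

Context (L0 : forall x xi, (0 <= L x xi)%E).

Lemma int_Lhat A G : measX A -> mmeas G ->
  (\int[mu]_(x in A) Lhat Sx L x (G x))%E = (\int[mu]_(x in A) (hl x (G x))%:E)%E.
Proof.
move=> mA mG; apply: ge0_ae_eq_integral_nonmeas => //.
- by move=> x _; apply: le_ereal_inf_tmp => _ [z _ <-].
- by move=> x _; rewrite lee_fin hl_ge0.
- by apply: rmeasE; exact: hl_meas.
- by apply: filterS Lhat_hl => x h _; exact: h.
Qed.

Lemma Efun_l A v : measX A -> inAm Alg v ->
  Efun mu D L v A = (\int[mu]_(x in A) (l x (grad D v x))%:E)%E.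
Proof.
move=> mA hv; apply: ge0_ae_eq_integral_nonmeas => //.
- by move=> x _; rewrite lee_fin l_ge0.
- by apply: rmeasE; apply: (ca_meas HL); exact: (mmeas_grad H).
- by apply: filterS (ca_ae HL) => x h _; exact: h.
Qed.

Lemma Efun_ge_hl A v : measX A -> inAm Alg v ->
  (\int[mu]_(x in A) (hl x (nab v x))%:E <= Efun mu D L v A)%E.
Proof.
move=> mA hv; rewrite Efun_l//; apply: int_le_ae => //.
- by apply: hl_meas; exact: (mmeas_nab HS).
- by apply: (ca_meas HL); exact: (mmeas_grad H).
- by move=> x; exact: hl_ge0.
- by move=> x; exact: l_ge0.
- by apply: filterS (hl_nab hv) => x -> _; exact: hl_le_l.
Qed.

Lemma A0_ae v : A0 Alg mu v -> {ae mu, forall x : borelT X, v x = 0}.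
Proof. by move=> [_ h]; apply: filterS (ae_supp HX) => x [sx _]; exact: h. Qed.

(* Replaces a measurable selection: on B n, where n is the first admissible index, one will
   use phi_n * avec n, whose gradient is phi_n * zc n because avec n vanishes on the support. *)
Lemma selection_sets v (eps : R) : inAm Alg v -> 0 < eps ->
  exists B : nat -> set X, [/\ forall n, measX (B n), \bigcup_n B n = setT,
    forall i j, i != j -> B i `&` B j = set0 &
    forall n x, B n x -> l x (grad D v x + zc n x) < hl x (grad D v x) + eps].
Proof.
move=> hv eps0; have mv : mmeas (grad D v) by exact: (mmeas_grad H).
pose S n : set X := [set x | l x (grad D v x + zc n x) < hl x (grad D v x) + eps].
have mS n : measX (S n).
  have m1 := ca_meas HL (mmeasD mv (mmeas_zc n)).
  have m2 : rmeas (fun x => hl x (grad D v x) + eps).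
    by apply: rmeasD; [exact: hl_meas|exact: rmeas_cst].
  have := measurable_fun_ltr m1 m2.
  by move=> /(_ measurableT [set true] I); rewrite setTI.
exists (seqDU S); split.
- move=> n; have mU : measX (\big[setU/set0]_(k < n) S k).
    by apply: bigsetU_measurable => k _; exact: mS.
  exact: (measurableD (mS n) mU).
- rewrite -seqDU_bigcup_eq; apply/seteqP; split=> // x _.
  have /hl_lt[n hn] : hl x (grad D v x) < hl x (grad D v x) + eps by rewrite ltrDl.
  by exists n.
- move=> i j ij; have /trivIsetP := trivIset_seqDU S; exact.
- by move=> n x [].
Qed.

(** Exchange of infimum and integral: a single function vanishing on the support realizes the
    pointwise infimum up to the slack below M. *)
Lemma interchange A v (M : R) : measX A -> inAm Alg v ->
  (\int[mu]_(x in A) (hl x (nab v x))%:E < M%:E)%E ->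
  exists2 a, A0 Alg mu a & (Efun mu D L (fun x => v x + a x)%R A < M%:E)%E.
Proof.
move=> mA hv hM; have mv : mmeas (grad D v) by exact: (mmeas_grad H).
have mh : rmeas (fun x => hl x (grad D v x)) by exact: hl_meas.
have hM' : (\int[mu]_(x in A) (hl x (grad D v x))%:E < M%:E)%E.
  apply: le_lt_trans hM; apply: int_le_ae => //.
  - by apply: hl_meas; exact: (mmeas_nab HS).
  - by move=> x; exact: hl_ge0.
  - by move=> x; exact: hl_ge0.
  - by apply: filterS (hl_nab hv) => x ->.
set I := (\int[mu]_(x in A) (hl x (grad D v x))%:E)%E in hM'.
have I0 : (0 <= I)%E by apply: int_ge0 => x; exact: hl_ge0.
have If : I \is a fin_num by rewrite ge0_fin_numE//; apply: lt_trans hM' _; exact: ltry.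
have gap0 : 0 < M - fine I by rewrite subr_gt0 -lte_fin fineK.
(* Three errors of at most [gap] each: [eps] integrated over X, the growth bound c1 on the tail
   [T J] where no generator is used, and the bound c2 on [Ex]. *)
pose gap := (M - fine I) / 4; have g0 : 0 < gap by rewrite divr_gt0.
pose muX := fine (mu [set: borelT X]).
have muX0 : 0 <= muX by exact: fine_ge0.
have muXE : mu [set: borelT X] = muX%:E by rewrite fineK// (mu_finX HS).
pose eps := gap / (muX + 1).
have muX1 : 0 < muX + 1 by rewrite ltr_wpDl.
have eps0 : 0 < eps by rewrite divr_gt0.
have epsg : eps * muX <= gap.
  by rewrite /eps mulrAC ler_pdivrMr// ler_wpM2l ?(ltW g0)// lerDl.
have [B [mB BT Bd hB]] := selection_sets hv eps0.
have [Lam L0' hLam] := grad_bounded H hv.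
pose c1 := c * (1 + Lam `^ p).
have c10 : 0 < c1 by rewrite mulr_gt0// ltr_wpDr// powR_ge0.
pose T J := \bigcup_(n in [set n | (J <= n)%N]) B n.
have mT J : measX (T J) by apply: bigcup_measurable => n _; exact: mB.
have [J hJ] : exists J, (mu (T J) < (gap / c1)%:E)%E.
  apply: (@measure_decr_lt _ _ _ mu T) => //.
  - by have := mu_fin_meas HX (mT 0%N).
  - by move=> n k nk x [i /= ki Bi]; exists i => //=; exact: leq_trans ki.
  - rewrite -subset0 => x hx; have [n _ Bn] := hx 0%N Logic.I.
    have [i /= ni Bi] := hx n.+1 Logic.I.
    have : (B n `&` B i) x by [].
    by rewrite Bd//; move: ni; rewrite ltn_neqAle => /andP[].
  - by rewrite divr_gt0.
have /choice[Lz hLz] : forall n, exists Lz : R, 0 <= Lz /\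
    {ae mu, forall x : borelT X, fnorm (zc n x) <= Lz}.
  move=> n; have [Lz Lz0 h] := grad_bounded H (avec_A0 n).1; exists Lz; split=> //.
  by apply: filterS (filterI h (grad_avec n)) => x [h1 <-].
pose c2 := c * (1 + 2 `^ p * (Lam `^ p + ((m * N)%:R * \sum_(k < J) Lz k) `^ p)).
have c20 : 0 < c2.
  by rewrite mulr_gt0// ltr_wpDr// mulr_ge0 ?powR_ge0// addr_ge0 ?powR_ge0.
(* [Ex] is a union of J sets of measure below eta, so c2 times its measure stays below gap; J + 1
   also covers J = 0. *)
pose eta := gap / c2 / J.+1%:R.
have eta0 : 0 < eta by rewrite !divr_gt0.
have /choice[K /choice[V hKV]] : forall n, exists K V : set X,
    [/\ closed K, open V, K `<=` B n, B n `<=` V & (mu (V `\` K) < eta%:E)%E].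
  by move=> n; have [_ /(_ _ eta0)] := borel_regular HX (mB n).
have /choice[phi hphi] : forall n, exists phi, Alg phi /\ (forall x, 0 <= phi x <= 1) /\
       (forall x, ~ V n x -> phi x = 0) /\ (forall x, K n x -> phi x = 1).
  move=> n; have [cK oV KB BV _] := hKV n; apply: (da_urysohn H) => //.
    exact: closed_cpt HX _ cK.
  exact: subset_trans KB BV.
pose a x := \sum_(n < J) phi n x *: avec n x.
have hpa n : inAm Alg (fun x => phi n x *: avec n x).
  by apply: (inAmM H); [have [] := hphi n|have [] := avec_A0 n].
have ha : inAm Alg a by exact: (inAm_sum H J hpa).
have a0 x : supp mu x -> a x = 0.
  by move=> sx; apply: big1 => n _; have [_ ->//] := avec_A0 n; rewrite scaler0.
exists a => //.
have grad_a : {ae mu, forall x : borelT X, grad D a x = \sum_(n < J) phi n x *: zc n x}.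
  have h1 : {ae mu, forall x : borelT X, forall n,
      grad D (fun y => phi n y *: avec n y) x = phi n x *: zc n x}.
    apply/ae_foralln => n; have [Ap _] := hphi n.
    apply: filterS (filterI (gradM H Ap (avec_A0 n).1) (filterI (grad_avec n) (A0_ae (avec_A0 n)))) => x.
    move=> [-> [-> ->]]; rewrite (_ : outer 0 _ = 0) ?addr0//.
    by apply/matrixP => i j; rewrite outerE !mxE mul0r.
  apply: filterS (filterI (grad_sum H J hpa) h1) => x [-> h].
  by apply: eq_bigr => n _; rewrite h.
(* The transition zones, where a cut-off may take values strictly between 0 and 1. *)
pose Ex := \big[setU/set0]_(n < J) (V n `\` K n).
have mVK n : measX (V n `\` K n).
  by have [cK oV _ _ _] := hKV n; apply: measurableD; [exact: open_meas|exact: (closed_meas (X := X))].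
have mEx : measX Ex by apply: bigsetU_measurable => n _; exact: mVK.
have muEx : (mu Ex <= (J%:R * eta)%:E)%E.
  rewrite /Ex; elim: (J) => [|j IH]; first by rewrite big_ord0 measure0 mul0r.
  rewrite big_ord_recr /=; have mU : measX (\big[setU/set0]_(n < j) (V n `\` K n)).
    by apply: bigsetU_measurable => n _; exact: mVK.
  apply: le_trans (mu_leU mU (mVK j)) _; rewrite -natr1 mulrDl mul1r EFinD leeD//; apply: ltW; by have [] := hKV j.
have bound : {ae mu, forall x : borelT X, A x ->
    l x (grad D (fun y => v y + a y) x) <=
    hl x (grad D v x) + (eps + (c1 * \1_(T J) x + c2 * \1_Ex x))}.
  have hz : {ae mu, forall x : borelT X, forall n, fnorm (zc n x) <= Lz n}.
    by apply/ae_foralln => n; have [] := hLz n.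
  apply: filterS (filterI (gradD H hv ha) (filterI grad_a (filterI hLam hz))) => x.
  move=> [-> [-> [hL hzx]]] _.
  have I1 : 0 <= c1 * \1_(T J) x by rewrite mulr_ge0 ?(ltW c10)// indicE.
  have I2 : 0 <= c2 * \1_Ex x by rewrite mulr_ge0 ?(ltW c20)// indicE.
  have h0 := hl_ge0 x (grad D v x).
  have [xE|xE] := pselect (Ex x).
    apply: (@le_trans _ _ c2); last first.
      rewrite [\1_Ex x]indicE (mem_set xE) mulr1; move: I1; move: (c1 * _) => I1 hI1.
      by rewrite addrA addrA lerDr !addr_ge0// ltW.
    apply: le_trans (ca_up HL _ _) _; rewrite ler_wpM2l ?(ltW c0)// lerD2l.
    apply: le_trans (fpowD p0 _ _) _; rewrite ler_wpM2l ?powR_ge0//.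
    have S0 : 0 <= \sum_(k < J) Lz k by apply: sumr_ge0 => k _; have [] := hLz k.
    apply: lerD; rewrite ge0_ler_powR ?nnegrE ?fnorm_ge0 ?(ltW p0) ?mulr_ge0//.
    apply: fnorm_le_entries => // i j; rewrite summxE.
    apply: le_trans (ler_norm_sum _ _ _) _; apply: ler_sum => n _.
    have [_ [/(_ x)/andP[q0 q1] _]] := hphi n.
    rewrite mxE normrM (ger0_norm q0); apply: (@le_trans _ _ (1 * `|zc n x i j|)).
      by rewrite ler_wpM2r.
    by rewrite mul1r (le_trans (normr_le_fnorm _ _ _)).
  have nVK n : (n < J)%N -> V n x -> K n x.
    move=> nJ Vx; apply: contrapT => nK; apply: xE.
    by rewrite /Ex (bigD1 (Ordinal nJ))//=; left.
  (* Off [Ex], membership in V i forces membership in K i, hence in B i; as the B are disjoint, at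
     most one cut-off is active, with value 1. *)
  have [[i iJ Vi]|hV] := pselect (exists2 i, (i < J)%N & V i x).
    have Ki := nVK i iJ Vi.
    have Bi : B i x by have [_ _ KB _ _] := hKV i; exact: KB.
    rewrite (bigD1 (Ordinal iJ))//= [X in l x (_ + (_ + X))]big1 => [|n ni].
      have [_ [_ [_ ->//]]] := hphi i; rewrite scale1r addr0.
      by apply: le_trans (ltW (hB i x Bi)) _; rewrite lerD2l lerDl addr_ge0.
    suff nV : ~ V n x by have [_ [_ [/(_ _ nV)-> _]]] := hphi n; rewrite scale0r.
    move=> Vn; have Kn := nVK n (ltn_ord n) Vn.
    have Bn : B n x by have [_ _ KB _ _] := hKV n; exact: KB.
    have : (B n `&` B i) x by [].
    by rewrite Bd//; apply: contra ni => /eqP e; apply/eqP/val_inj.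
  rewrite big1 => [|n _]; last first.
    suff nV : ~ V n x by have [_ [_ [/(_ _ nV)-> _]]] := hphi n; rewrite scale0r.
    by move=> Vn; apply: hV; exists n.
  rewrite addr0; have xT : T J x.
    have : (\bigcup_n B n) x by rewrite BT.
    move=> [n _ Bn]; exists n => //=; rewrite leqNgt; apply/negP => nJ.
    by apply: hV; exists n => //; have [_ _ _ BV _] := hKV n; exact: BV.
  apply: (@le_trans _ _ c1).
    apply: le_trans (ca_up HL _ _) _; rewrite ler_wpM2l ?(ltW c0)// lerD2l.
    by rewrite ge0_ler_powR ?nnegrE ?fnorm_ge0 ?(ltW p0).
  rewrite [\1_(T J) x]indicE (mem_set xT) mulr1; move: I2; move: (c2 * _) => I2 hI2.
  by rewrite addrCA addrA addrCA lerDl !addr_ge0// ltW.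
have hva : inAm Alg (fun x => v x + a x) by exact: (inAmD H).
have mI (E : set X) : measX E -> rmeas (fun x => \1_E x : R) by move=> mE; exact: measurable_indic.
have i0 (E : set X) (k : R) : 0 < k -> forall x, 0 <= k * \1_E x.
  by move=> k0 x; rewrite mulr_ge0 ?(ltW k0)// indicE.
have m1 : rmeas (fun x => c1 * \1_(T J) x) by apply: rmeasZ; exact: mI.
have m2 : rmeas (fun x => c2 * \1_Ex x) by apply: rmeasZ; exact: mI.
have m12 : rmeas (fun x => c1 * \1_(T J) x + c2 * \1_Ex x) by exact: rmeasD.
have m3 : rmeas (fun x => eps + (c1 * \1_(T J) x + c2 * \1_Ex x)).
  by apply: rmeasD => //; exact: rmeas_cst.
have n12 x : 0 <= c1 * \1_(T J) x + c2 * \1_Ex x by rewrite addr_ge0 ?i0.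
have n3 x : 0 <= eps + (c1 * \1_(T J) x + c2 * \1_Ex x) by rewrite addr_ge0// ltW.
rewrite Efun_l//; apply: le_lt_trans (int_le_ae mA _ _ _ _ bound) _.
- by apply: (ca_meas HL); exact: (mmeas_grad H).
- exact: rmeasD.
- by move=> x; exact: l_ge0.
- by move=> x; rewrite addr_ge0// hl_ge0.
rewrite intD//; last by move=> x; exact: hl_ge0.
rewrite -/I intD//; [|exact: rmeas_cst|by move=> _; exact: ltW].
rewrite intD//; [|by apply: i0|by apply: i0].
have mAX : (mu A <= mu [set: borelT X])%E by apply: le_measure; rewrite ?inE.
have ind (E : set X) (k t : R) : measX E -> 0 < k -> (mu E <= t%:E)%E ->
    (\int[mu]_(x in A) (k * \1_E x)%:E <= (k * t)%:E)%E.
  move=> mE k0 hE; rewrite intZ ?(ltW k0)//; last exact: mI.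
  rewrite EFinM lee_wpmul2l ?lee_fin ?(ltW k0)//.
  rewrite integral_indic//; apply: le_trans hE; apply: le_measure; rewrite ?inE//.
  exact: measurableI.
have b1 : (\int[mu]_(x in A) eps%:E <= gap%:E)%E.
  rewrite int_cst//; apply: (@le_trans _ _ (eps%:E * mu [set: borelT X])%E).
    by rewrite lee_wpmul2l// lee_fin ltW.
  by rewrite muXE -EFinM lee_fin.
have b2 : (\int[mu]_(x in A) (c1 * \1_(T J) x)%:E <= gap%:E)%E.
  apply: le_trans (ind _ _ (gap / c1) _ _ (ltW hJ)) _ => //.
  by rewrite mulrC divfK ?gt_eqF.
have b3 : (\int[mu]_(x in A) (c2 * \1_Ex x)%:E <= gap%:E)%E.
  apply: le_trans (ind _ _ (J%:R * eta) _ _ muEx) _ => //.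
  rewrite lee_fin mulrCA /eta (mulrA c2) (mulrCA c2) mulfV ?gt_eqF// mulr1 mulrCA.
  by rewrite ler_piMr ?(ltW g0)// ler_pdivrMr// mul1r ler_nat.
apply: (@le_lt_trans _ _ (I + (gap%:E + (gap%:E + gap%:E)))%E).
  by rewrite leeD2l// leeD// leeD.
rewrite -(fineK If) -!EFinD lte_fin.
have : gap * 4 = M - fine I by rewrite divfK.
by lra.
Qed.

Lemma hl_int_usc A G (M : R) : measX A -> mmeas G -> (Ip mu p setT G < +oo)%E ->
  (\int[mu]_(x in A) (hl x (G x))%:E < M%:E)%E ->
  exists2 del : R, 0 < del & forall G', mmeas G' -> (lpdist mu p G' G < del%:E)%E ->
    (\int[mu]_(x in A) (hl x (G' x))%:E < M%:E)%E.
Proof.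
move=> mA mG IG; apply: (nemytskii_usc HX p1 (ltW c0)) => //.
- by move=> x xi; exact: (hl_ge0).
- by move=> x xi; exact: (hl_up).
- by move=> G1 mG1; exact: (hl_meas).
- exact: (hl_usc).
Qed.

Lemma Ip_nab_fin w : inAm Alg w -> (Ip mu p setT (nab w) < +oo)%E.
Proof.
move=> hw; have [M M0 hM] := gradmu_bounded H (vk := vk) hw.
apply: (@le_lt_trans _ _ (\int[mu]_(x in [set: X]) (M `^ p)%:E)%E).
  apply: int_le_ae => //.
  - exact (measurable_fpow p (mmeas_nab HS hw)).
  - exact: rmeas_cst.
  - by move=> x; exact: powR_ge0.
  - by move=> x; exact: powR_ge0.
  by apply: filterS hM => x h _; rewrite ge0_ler_powR ?nnegrE ?fnorm_ge0 ?(ltW p0).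
by rewrite int_cst// -(fineK (mu_finX HS)) -EFinM ltry.
Qed.

Lemma lpdist_addl (a b : nat) (f g h : X -> 'M[R]_(a, b)) :
  lpdist mu p (fun x => h x + f x) (fun x => h x + g x) = lpdist mu p f g.
Proof. by apply: eq_integral => x _; rewrite opprD addrACA subrr add0r. Qed.

Lemma lpdist_ae_eq (a b : nat) (f f' g : X -> 'M[R]_(a, b)) : mmeas f -> mmeas f' -> mmeas g ->
  {ae mu, forall x : borelT X, f x = f' x} -> lpdist mu p f g = lpdist mu p f' g.
Proof.
move=> mf mf' mg h; rewrite !lpdistE; apply: (Ip_ae_eq p1) => //; try exact: mmeasB.
by apply: filterS h => x ->.
Qed.

(** * Recovery sequences, slicing and set properties of the relaxed functional *)

Context {u : X -> 'rV[R]_m} {G : X -> 'M[R]_(m, N)} (hW : inW Alg mu p D Sx u G).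
Let mu' : mmeas u := hW.1.
Let mG : mmeas G := hW.2.1.

Lemma inW_approx (e : R) : 0 < e -> exists v, [/\ inAm Alg v,
  (lpdist mu p v u < e%:E)%E & (lpdist mu p (nab v) G < e%:E)%E].
Proof.
move=> e0; have [_ [_ [un [hu [/cvgLpP/(_ _ e0)[n1 h1] /cvgLpP/(_ _ e0)[n2 h2]]]]]] := hW.
exists (un (maxn n1 n2)); split=> //.
- by apply: h1; exact: leq_maxl.
- by apply: h2; exact: leq_maxr.
Qed.

Lemma inW_fin : (Ip mu p setT G < +oo)%E.
Proof.
have [v [hv _ h]] := inW_approx ltr01.
have -> : G = fun x => nab v x - (nab v x - G x) by apply/funext => x; rewrite opprB addrC subrK.
apply: le_lt_trans (IpB p1 _ _ _) _ => //.
- exact: (mmeas_nab HS).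
- by apply: mmeasB => //; exact: (mmeas_nab HS).
apply: lte_mul_pinfty; rewrite ?lee_fin ?powR_ge0//.
apply: lte_add_pinfty; first exact: Ip_nab_fin hv.
by rewrite -lpdistE (lt_trans h)// ltry.
Qed.

Lemma hl_G_fin : (\int[mu]_(x in [set: X]) (hl x (G x))%:E < +oo)%E.
Proof.
apply: (@le_lt_trans _ _ (\int[mu]_(x in [set: X]) (c * (1 + fnorm (G x) `^ p))%:E)%E).
  apply: int_le => //.
  - exact: (hl_meas).
  - apply: rmeasZ; apply: rmeasD; [exact: rmeas_cst|exact: measurable_fpow].
  - by move=> x; exact: (hl_ge0).
  - by move=> x _; exact: (hl_up).
rewrite intZ ?(ltW c0)//; last 2 first.
- by apply: rmeasD; [exact: rmeas_cst|exact: measurable_fpow].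
- by move=> x; rewrite addr_ge0// powR_ge0.
rewrite intD//; [|exact: rmeas_cst|exact: measurable_fpow|by move=> x; exact: powR_ge0].
apply: lte_mul_pinfty; rewrite ?lee_fin ?(ltW c0)//.
rewrite lte_add_pinfty//; last exact: inW_fin.
by rewrite int_cst// -(fineK (mu_finX HS)) -EFinM ltry.
Qed.

Lemma mmeas_Gnab w : inAm Alg w -> mmeas (fun x => G x + nab w x).
Proof. by move=> hw; apply: mmeasD => //; exact: (mmeas_nab HS). Qed.

Lemma Gnab_fin w : inAm Alg w -> (Ip mu p setT (fun x => G x + nab w x)%R < +oo)%E.
Proof.
move=> hw; apply: le_lt_trans (IpD p1 _ _ _) _ => //; first exact: (mmeas_nab HS).
apply: lte_mul_pinfty; rewrite ?lee_fin ?powR_ge0//.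
by apply: lte_add_pinfty; [exact: inW_fin|exact: Ip_nab_fin hw].
Qed.

(** The function is v + w + a: v approximates u together with its gradient, w is the given
    perturbation, and a, supplied by [interchange], vanishes a.e. *)
Lemma recovery_step A (M e : R) w : measX A -> 0 < e -> inAm Alg w ->
  (lpdist mu p w (fun=> 0%R) < (e / (2 `^ p * 2))%:E)%E ->
  (\int[mu]_(x in A) (hl x (G x + nab w x))%:E < M%:E)%E ->
  exists z, [/\ inAm Alg z, (lpdist mu p z u < e%:E)%E & (Efun mu D L z A < M%:E)%E].
Proof.
move=> mA e0 hw lw hM.
have P0 : 0 < 2 `^ p * 2 :> R by rewrite mulr_gt0// powR_gt0.
have e2 : 0 < e / (2 `^ p * 2) by rewrite divr_gt0.
have [del d0 hdel] := hl_int_usc mA (mmeas_Gnab hw) (Gnab_fin hw) hM.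
have me : 0 < Num.min del (e / (2 `^ p * 2)) by rewrite lt_min d0.
have [v [hv lv lnv]] := inW_approx me.
have hvw := inAmD H hv hw.
have mv := mmeas_inAm H hv; have mw := mmeas_inAm H hw.
have mnv := mmeas_nab HS hv; have mnw := mmeas_nab HS hw.
have hI : (\int[mu]_(x in A) (hl x (nab (fun y => v y + w y) x))%:E < M%:E)%E.
  apply: hdel; first exact: (mmeas_nab HS).
  rewrite (lpdist_ae_eq (f' := fun x => nab w x + nab v x)).
  - have -> : (fun x => G x + nab w x) = (fun x => nab w x + G x) by apply/funext => x; rewrite addrC.
    rewrite lpdist_addl; apply: lt_le_trans lnv _; by rewrite lee_fin ge_min lexx.
  - exact: (mmeas_nab HS).
  - exact: mmeasD.
  - exact: mmeas_Gnab.
  - by apply: filterS (gradmuD H (vk := vk) hv hw) => x; rewrite [nab w x + _]addrC.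
have [a ha hE] := interchange mA hvw hI.
have hz : inAm Alg (fun x => v x + w x + a x) by apply: (inAmD H) => //; exact: ha.1.
exists (fun x => v x + w x + a x); split=> //.
rewrite (lpdist_ae_eq (f' := fun x => v x + w x)) //; last 3 first.
- exact: (mmeas_inAm H).
- exact: (mmeas_inAm H).
- by apply: filterS (A0_ae ha) => x ->; rewrite addr0.
have lw' : (lpdist mu p (fun x => v x + w x)%R v < (e / (2 `^ p * 2))%:E)%E.
  have -> : lpdist mu p (fun x => v x + w x) v = lpdist mu p w (fun=> 0).
    by apply: eq_integral => y _; rewrite addrAC subrr add0r subr0.
  exact: lw.
have lv' : (lpdist mu p v u < (e / (2 `^ p * 2))%:E)%E.
  by apply: lt_le_trans lv _; rewrite lee_fin ge_min lexx orbT.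
exact: (lpdist_lt_tri p1 (mmeasD mv mw) mv mu' lw' lv').
Qed.

Lemma Ebar_le A (M : R) : measX A ->
  (forall e : R, 0 < e -> exists w, [/\ inAm Alg w, (lpdist mu p w (fun=> 0%R) < e%:E)%E &
     (\int[mu]_(x in A) (hl x (G x + nab w x))%:E < M%:E)%E]) ->
  (Ebar Alg mu p D L u A <= M%:E)%E.
Proof.
move=> mA h.
have P0 : 0 < 2 `^ p * 2 :> R by rewrite mulr_gt0// powR_gt0.
have /choice[z hz] : forall n : nat, exists z, [/\ inAm Alg z,
    (lpdist mu p z u < (n.+1%:R^-1)%:E)%E & (Efun mu D L z A < M%:E)%E].
  move=> n; have en : 0 < n.+1%:R^-1 :> R by rewrite invr_gt0.
  have e2 : 0 < n.+1%:R^-1 / (2 `^ p * 2) :> R by rewrite divr_gt0.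
  by have [w [hw lw hM]] := h _ e2; exact: recovery_step hM.
apply: ge_ereal_inf; exists (limn_einf (fun n => Efun mu D L (z n) A)).
  exists z => //; split; first by move=> n; have [] := hz n.
  apply/cvgLpP => e e0; have [n0 hn0] := small_seq (@ler01 R) e0.
  exists n0 => n /hn0; rewrite mul1r => hn; have [_ h1 _] := hz n.
  by apply: lt_trans h1 _; rewrite lte_fin.
rewrite leNgt; apply/negP => /lt_limn_einf[n0 /(_ n0 (leqnn _))].
by have [_ _ h1] := hz n0; rewrite ltNge ltW.
Qed.

(** M1 is the midpoint between the lower limit and M; the remaining gap is what [slicing] spends. *)
Lemma Ebar_lt_approx A (M : R) : measX A -> (Ebar Alg mu p D L u A < M%:E)%E ->
  exists2 M1 : R, 0 <= M1 < M & forall e : R, 0 < e -> exists v, [/\ inAm Alg v,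
    (lpdist mu p v u < e%:E)%E & (\int[mu]_(x in A) (hl x (nab v x))%:E < M1%:E)%E].
Proof.
move=> mA /ereal_inf_lt[_ [un [hun cun] <-] hlim].
set lam := limn_einf _ in hlim.
have lam0 : (0 <= lam)%E by apply: (@limn_einf_ge _ _ _ 0%N) => n _; apply: integral_ge0.
have lamf : lam \is a fin_num by rewrite ge0_fin_numE// (lt_trans hlim)// ltry.
have hlim' : fine lam < M by rewrite -lte_fin fineK.
exists ((fine lam + M) / 2).
  have : 0 <= fine lam by exact: fine_ge0.
  by move: hlim'; lra.
move=> e e0; have [n0 hn0] := (cvgLpP _ _ _).1 cun e e0.
have hl2 : (lam < ((fine lam + M) / 2)%:E)%E by rewrite -(fineK lamf) lte_fin /=; move: hlim'; lra.
have [n /hn0 h1 h2] := limn_einf_lt n0 hl2.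
exists (un n); split=> //; apply: le_lt_trans h2; exact: (Efun_ge_hl).
Qed.

(** Locality settles the open regions d < a and d > b. Since the bounding spheres may carry mass,
    the Leibniz estimate is stated everywhere and used on the closed ring. *)
Lemma nab_cutoff phi h x (a b Lam : R) : Alg phi -> inAm Alg h -> 0 <= Lam ->
  (forall y, 0 <= phi y <= 1) -> (forall y, d x y <= a -> phi y = 1) ->
  (forall y, ~ d x y < b -> phi y = 0) ->
  {ae mu, forall y : borelT X, fnorm (D phi y) <= Lam} ->
  {ae mu, forall y : borelT X, [/\ d x y < a -> nab (fun z => phi z *: h z) y = nab h y,
     b < d x y -> nab (fun z => phi z *: h z) y = 0 &
     fnorm (nab (fun z => phi z *: h z) y) `^ p <=
       2 `^ p * (fnorm (nab h y) `^ p + Lam `^ p * fnorm (h y) `^ p)]}.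
Proof.
move=> hp hh La0 p01 pa pb hLam; have hw := inAmM H hp hh.
have h1 : {ae mu, forall y : borelT X, oball d x a y -> nab (fun z => phi z *: h z) y = nab h y}.
  apply: (nab_local_eq HS) => //; first exact: (open_oball HX).
  by move=> y; rewrite /oball/= => ya; rewrite pa ?scale1r// ltW.
have h2 : {ae mu, forall y : borelT X, b < d x y -> nab (fun z => phi z *: h z) y = 0}.
  apply: (nab_local HS hw (open_oballC HX x b)) => y /= yb.
  by rewrite pb ?scale0r//; apply/negP; rewrite -leNgt ltW.
apply: filterS (filterI h1 (filterI h2 (filterI hLam (gradmuM H (vk := vk) hp hh)))) => y [g1 [g2 [g3 g4]]].
split=> //; rewrite [nab _ y]g4.
apply: le_trans (fpowD p0 _ _) _; rewrite ler_wpM2l ?powR_ge0//; apply: lerD.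
  apply: (fpow_le p0); rewrite fnormZ; have /andP[q0 q1] := p01 y.
  by rewrite ger0_norm// ler_piMl// fnorm_ge0.
rewrite -powRM ?fnorm_ge0//; apply: ge0_ler_powR; rewrite ?nnegrE ?(ltW p0) ?fnorm_ge0 ?mulr_ge0 ?fnorm_ge0//.
apply: le_trans (fnorm_projT _ _) _; rewrite fnorm_outer mulrC.
by rewrite ler_wpM2r ?fnorm_ge0.
Qed.

Lemma mu_inner_ball x (r0 rho del : R) : r0 < rho -> 0 < del ->
  exists2 r, r0 < r < rho & (mu (oball d x rho `\` oball d x r) < del%:E)%E.
Proof.
move=> r_rho d0.
have r_rho' : 0 < rho - r0 by rewrite subr_gt0.
(* The denominator n + 2 keeps every radius strictly above r0. *)
pose r n := rho - (rho - r0) / n.+2%:R.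
have rr n : r0 < r n < rho.
  rewrite /r ltrBrDl -ltrBrDr gtrBl divr_gt0 ?subr_gt0// andbT.
  by rewrite ltr_pdivrMr// ltr_pMr ?subr_gt0// ltr1n.
have [n hn] : exists n, (mu (oball d x rho `\` oball d x (r n)) < del%:E)%E.
  apply: (@measure_decr_lt _ _ _ mu (fun n => oball d x rho `\` oball d x (r n))) => //.
  - by apply: (mu_fin_meas HX); apply: measurableD; exact: (meas_oball HX).
  - by move=> n; apply: measurableD; exact: (meas_oball HX).
  - move=> n k nk y [yr h]; split=> // hy; apply: h; apply: lt_le_trans hy _.
    rewrite /r lerD2l lerN2 ler_pM2l ?subr_gt0// lef_pV2 ?posrE//.
    by rewrite ler_nat !ltnS.
  - rewrite -subset0 => y hy; have [yr _] := hy 0%N I.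
    have dy : 0 < rho - d x y by rewrite subr_gt0.
    have [n hn] := small_seq (ltW r_rho') dy.
    have [_] := hy n I; apply; rewrite /oball/= /r ltrBrDl -ltrBrDr.
    apply: le_lt_trans (hn n (leqnn n)); rewrite ler_pM2l ?subr_gt0// lef_pV2 ?posrE//.
    by rewrite ler_nat.
by exists (r n).
Qed.

(* The cut-off is placed in the one of n disjoint rings that carries at most 1/n of the
   gradient energy. *)
Lemma slicing x (rho M e0 : R) : 0 < rho -> 0 < e0 ->
  (Ebar Alg mu p D L u (oball d x rho) < M%:E)%E ->
  exists w, exists2 r, 0 < r < rho & [/\ inAm Alg w, forall y, ~ cball d x r y -> w y = 0,
    (lpdist mu p w (fun=> 0%R) < e0%:E)%E &
    (\int[mu]_(y in oball d x rho) (hl y (G y + nab w y))%:E < M%:E)%E].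
Proof.
move=> rho0 e00 hF; pose Q := oball d x rho.
have mQ : measX Q by exact: (meas_oball HX).
have [M1 /andP[M10 M1M] hM1] := Ebar_lt_approx mQ hF.
pose gap := (M - M1) / 4; have g0 : 0 < gap by rewrite divr_gt0// subr_gt0.
pose gG y := c * (1 + 2 `^ p * fnorm (G y) `^ p).
have mfG : rmeas (fun y => fnorm (G y) `^ p) by exact: measurable_fpow.
have mgG : rmeas gG by apply: rmeasZ; apply: rmeasD; [exact: rmeas_cst|exact: rmeasZ].
have gG0 y : 0 <= gG y by rewrite mulr_ge0 ?(ltW c0)// addr_ge0// mulr_ge0 ?powR_ge0.
have gGf : (\int[mu]_(y in [set: X]) (gG y)%:E < +oo)%E.
  rewrite intZ ?(ltW c0)//; last 2 first.
  - by apply: rmeasD; [exact: rmeas_cst|exact: rmeasZ].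
  - by move=> y; rewrite addr_ge0// mulr_ge0 ?powR_ge0.
  apply: lte_mul_pinfty; rewrite ?lee_fin ?(ltW c0)//.
  rewrite intD//; [|exact: rmeas_cst|exact: rmeasZ|by move=> y; rewrite mulr_ge0 ?powR_ge0].
  apply: lte_add_pinfty; first by rewrite int_cst// -(fineK (mu_finX HS)) -EFinM ltry.
  rewrite intZ ?powR_ge0//; last by move=> y; exact: powR_ge0.
  by apply: lte_mul_pinfty; rewrite ?lee_fin ?powR_ge0//; exact: (inW_fin).
have [dl dl0 hdl] := integral_abs_cont mgG gG0 gGf g0.
have [r0 /andP[r00 r0rho] hr0] := mu_inner_ball x rho0 dl0.
have mQr : measX (Q `\` oball d x r0) by apply: measurableD => //; exact: (meas_oball HX).
have hr0' := hdl _ mQr hr0.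
set BG := fine (Ip mu p setT G).
have BGE : Ip mu p setT G = BG%:E by rewrite fineK// ge0_fin_numE ?(inW_fin)// Ip_ge0.
have BG0 : 0 <= BG by apply: fine_ge0; exact: Ip_ge0.
(* Energy of v and uk on Q: M1 / C for v by coercivity, the rest for uk, whose projected gradient is
   within L^p distance 1 of G. *)
pose T := M1 / C + 2 `^ p * (1 + BG).
have T0 : 0 <= T by rewrite addr_ge0 ?divr_ge0 ?(ltW C0)// mulr_ge0 ?powR_ge0 ?addr_ge0.
pose P2 : R := 2 `^ p; have P20 : 0 < P2 by exact: powR_gt0.
have [n n0 hn] : exists2 n, (0 < n)%N & c * P2 * P2 * P2 * (T / n%:R) < gap.
  have K0 : 0 <= c * P2 * P2 * P2 * T by rewrite !mulr_ge0 ?(ltW c0) ?(ltW P20).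
  have [n1 hn1] := small_seq K0 g0; exists n1.+1 => //.
  by rewrite mulrA; exact: hn1.
(* Of 2n + 1 equal slices every other one is used, so even the closed rings are disjoint and end
   strictly before rho. *)
pose h := (rho - r0) / (n.*2.+1)%:R.
have h0 : 0 < h by rewrite divr_gt0 ?subr_gt0.
pose a i := r0 + i.*2%:R * h; pose b i := r0 + i.*2.+1%:R * h.
have ab i : a i < b i by rewrite /a /b ltrD2l ltr_pM2r// ltr_nat.
have ba i j : (i < j)%N -> b i < a j.
  by move=> ij; rewrite /a /b ltrD2l ltr_pM2r// ltr_nat -doubleS leq_double.
have r0a i : r0 <= a i by rewrite /a lerDl mulr_ge0// ltW.
have a0 i : 0 < a i by exact: lt_le_trans r00 (r0a i).
have brho i : (i < n)%N -> b i < rho.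
  move=> i_n; rewrite /b -ltrBrDl /h mulrCA gtr_pMr ?subr_gt0// ltr_pdivrMr// mul1r ltr_nat ltnS.
  by rewrite ltn_double.
have /choice[phi hphi] : forall i, exists phi, Alg phi /\ (forall y, 0 <= phi y <= 1) /\
       (forall y, ~ oball d x (b i) y -> phi y = 0) /\ (forall y, cball d x (a i) y -> phi y = 1).
  move=> i; apply: (da_urysohn H).
  - by apply: (closed_cpt HX); exact: (@closed_cball _ _ _ _ HX x (a i)).
  - exact: (open_oball HX).
  - by move=> y ya; exact: le_lt_trans ya (ab i).
have /choice[Lm hLm] : forall i, exists Lm : R, 0 <= Lm /\
    {ae mu, forall y : borelT X, fnorm (D (phi i) y) <= Lm}.
  by move=> i; have [Ap _] := hphi i; have [Lm ? ?] := D_bounded H Ap; exists Lm.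
(* A bound for all n cut-offs at once: v and uk must be chosen L^p-close relative to it, and the
   ring is known only after them. *)
pose Lam := \sum_(i < n) Lm i.
have Lam0 : 0 <= Lam by apply: sumr_ge0 => i _; have [] := hLm i.
have LmL i : (i < n)%N -> Lm i <= Lam.
  move=> i_n; rewrite /Lam (bigD1 (Ordinal i_n))//= lerDl; apply: sumr_ge0 => j _; by have [] := hLm j.
pose kap := c * P2 * P2 * Lam `^ p.
have kap0 : 0 <= kap by rewrite !mulr_ge0 ?(ltW c0) ?(ltW P20) ?powR_ge0.
pose e1 := Num.min e0 (gap / (kap + 1)).
have e10 : 0 < e1 by rewrite lt_min e00 divr_gt0// ltr_wpDl.
have e1g : kap * e1 <= gap.
  apply: (@le_trans _ _ (kap * (gap / (kap + 1)))); first by rewrite ler_wpM2l// ge_min lexx orbT.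
  by rewrite mulrCA ler_piMr ?(ltW g0)// ler_pdivrMr ?mul1r ?lerDl// ltr_wpDl.
have e2 : 0 < e1 / (2 `^ p * 2) by rewrite divr_gt0// mulr_gt0.
have [v [hv lv hvM]] := hM1 _ e2.
have mnv := mmeas_nab HS hv.
have [del d0 hdel] := hl_int_usc mQ mnv (Ip_nab_fin hv) hvM.
have e3 : 0 < Num.min 1 (Num.min del (e1 / (2 `^ p * 2))) by rewrite !lt_min ltr01 d0.
have [uk [huk luk lnuk]] := inW_approx e3.
have mnuk := mmeas_nab HS huk.
have hvu := inAmB H hv huk.
have mv := mmeas_inAm H hv; have muk := mmeas_inAm H huk.
have lvu : (lpdist mu p v uk < e1%:E)%E.
  have luk' : (lpdist mu p u uk < (e1 / (2 `^ p * 2))%:E)%E.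
    by rewrite lpdistC; apply: lt_le_trans luk _; rewrite lee_fin !ge_min lexx !orbT.
  exact: (lpdist_lt_tri p1 mv mu' muk lv luk').
pose psi y := fnorm (nab v y) `^ p + fnorm (nab uk y) `^ p.
have mpsi : rmeas psi by apply: rmeasD; [exact (measurable_fpow p mnv)|exact (measurable_fpow p mnuk)].
have psi0 y : 0 <= psi y by rewrite addr_ge0 ?powR_ge0.
pose S i := [set y | a i <= d x y <= b i].
have SE i : S i = cball d x (b i) `\` oball d x (a i).
  apply/seteqP; split=> y; rewrite /S /cball /oball /=.
    by move=> /andP[h1 h2]; split=> //; apply/negP; rewrite -leNgt.
  by move=> [-> /negP]; rewrite -leNgt => ->.
have mS i : measX (S i).
  by rewrite SE; apply: measurableD; [exact: (@meas_cball _ _ _ _ HX)|exact: (meas_oball HX)].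
have tS : trivIset setT (fun i => S i `&` Q).
  apply/trivIsetP => i j _ _ ij; rewrite -subset0 => y [[/= /andP[i1 i2] _] [/andP[j1 j2] _]].
  move: ij; rewrite neq_ltn => /orP[/ba|/ba] k.
    by have := le_lt_trans i2 k; rewrite ltNge j1.
  by have := le_lt_trans j2 k; rewrite ltNge i1.
have psiT : (\int[mu]_(y in Q) (psi y)%:E <= T%:E)%E.
  rewrite (intD mQ (measurable_fpow p mnv) (measurable_fpow p mnuk) (fun=> powR_ge0 _ _) (fun=> powR_ge0 _ _)).
    rewrite /T EFinD; apply: leeD.
      apply: (@le_trans _ _ (\int[mu]_(y in Q) (C^-1 * hl y (nab v y))%:E)%E).
        apply: int_le => //.
        * exact (measurable_fpow p mnv).
        * by apply: rmeasZ; exact: (hl_meas).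
        * by move=> y; exact: powR_ge0.
        move=> y _; rewrite mulrC ler_pdivlMr// mulrC.
        have := hl_low y (nab v y); rewrite {1}/nab gradmuE.
        by rewrite projT_idem.
      rewrite intZ ?invr_ge0 ?(ltW C0)//; last 2 first.
        exact: (hl_meas).
        by move=> y; exact: (hl_ge0).
      by rewrite mulrC EFinM lee_wpmul2l ?lee_fin ?invr_ge0 ?(ltW C0)// ltW.
    apply: (@le_trans _ _ (Ip mu p setT (nab uk))); first exact: Ip_subset.
    have -> : nab uk = fun y => (nab uk y - G y) + G y by apply/funext => y; rewrite subrK.
    apply: le_trans (IpD p1 _ _ _) _ => //; first exact: mmeasB.
    rewrite EFinM lee_wpmul2l ?lee_fin ?powR_ge0// EFinD BGE leeD2r// -lpdistE ltW//.
    by apply: lt_le_trans lnuk _; rewrite lee_fin ge_min lexx.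
have [i i_n hi] := ring_pigeonhole (S := fun i => S i `&` Q) mQ
  (fun i => measurableI _ _ (mS i) mQ) tS (fun i => @subIsetr _ _ _) mpsi psi0 psiT n0.
have Si : S i `&` Q = S i.
  by apply/setIidPl => y /= /andP[_ h2]; exact: le_lt_trans h2 (brho i i_n).
rewrite Si in hi.
have [Ap [p01 [pb pa]]] := hphi i.
(* uk stands in for u, which need not lie in the algebra: G + nab w is close to nab v inside the
   ring and equals G outside. *)
pose w y := phi i y *: (v y - uk y).
have hw : inAm Alg w by exact: (inAmM H).
exists w, (b i); first by rewrite (lt_trans (a0 i) (ab i)) brho.
split=> //.
- move=> y hy; rewrite /w pb ?scale0r// => hb; apply: hy; exact: ltW hb.
- apply: (@le_lt_trans _ _ (lpdist mu p v uk)); last first.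
    by apply: lt_le_trans lvu _; rewrite lee_fin ge_min lexx.
  rewrite !lpdistE; apply: (Ip_le p1) => //.
  + by apply: mmeasB; [exact: (mmeas_inAm H)|exact: mmeas_cst].
  + exact: mmeasB.
  + apply: aeW => y _; rewrite subr0 /w fnormZ; have /andP[q0 q1] := p01 y.
    by rewrite ger0_norm// ler_piMl// fnorm_ge0.
have hLam : {ae mu, forall y : borelT X, fnorm (D (phi i) y) <= Lam}.
  by have [_ h1] := hLm i; apply: filterS h1 => y h1; exact: le_trans h1 (LmL i i_n).
have hnw := nab_cutoff Ap hvu Lam0 p01 pa pb hLam.
have mnw := mmeas_nab HS hw.
have mGw : mmeas (fun y => G y + nab w y) by exact: mmeasD.
have mhw : rmeas (fun y => hl y (G y + nab w y)) by exact: (hl_meas).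
have hw0 y : 0 <= hl y (G y + nab w y) by exact: (hl_ge0).
have moa : measX (oball d x (a i)) by exact: (meas_oball HX).
have aQ : oball d x (a i) `<=` Q.
  by move=> y ya; apply: lt_trans ya _; exact: lt_trans (ab i) (brho i i_n).
have mQa : measX (Q `\` oball d x (a i)) by exact: measurableD.
have mGuk : mmeas (fun y => nab v y + (G y - nab uk y)) by apply: mmeasD => //; exact: mmeasB.
have b1 : (\int[mu]_(y in oball d x (a i)) (hl y (G y + nab w y))%:E <= M1%:E)%E.
  apply: (@le_trans _ _ (\int[mu]_(y in Q) (hl y (nab v y + (G y - nab uk y)))%:E)%E).
    apply: (@le_trans _ _ (\int[mu]_(y in oball d x (a i)) (hl y (nab v y + (G y - nab uk y)))%:E)%E).
      apply: int_le_ae => //.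
      - exact: (hl_meas).
      - by move=> y; exact: (hl_ge0).
      apply: filterS (filterI hnw (gradmuB H (vk := vk) hv huk)) => y [[h1 _ _] h2] ya.
      by rewrite [nab w y](etrans (h1 ya) h2) addrCA.
    apply: int_subset => //; first exact: (hl_meas).
    by move=> y; exact: (hl_ge0).
  apply: ltW; apply: hdel => //.
  have -> : lpdist mu p (fun y => nab v y + (G y - nab uk y))%R (nab v) = lpdist mu p (nab uk) G.
    rewrite lpdistC; apply: eq_integral => y _.
    by rewrite opprD addNKr opprB.
  by apply: lt_le_trans lnuk _; rewrite lee_fin !ge_min lexx !orbT.
have mnp : rmeas (fun y => fnorm (nab w y) `^ p) by exact (measurable_fpow p mnw).
(* Off the inner ball, growth leaves the term gG, small by absolute continuity as r0 is close to
   rho, and the energy of w, which sits on the chosen ring. *)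
have b2 : (\int[mu]_(y in Q `\` oball d x (a i)) (hl y (G y + nab w y))%:E <=
    gap%:E + (c * P2)%:E * Ip mu p (Q `\` oball d x (a i)) (nab w))%E.
  apply: (@le_trans _ _ (\int[mu]_(y in Q `\` oball d x (a i)) (gG y + c * P2 * fnorm (nab w y) `^ p)%:E)%E).
    have m5 : rmeas (fun y => gG y + c * P2 * fnorm (nab w y) `^ p).
      exact: (rmeasD mgG (rmeasZ (c * P2) mnp)).
    apply: (int_le mQa mhw m5 hw0) => y _; apply: le_trans (hl_up _ _) _.
    rewrite /gG -mulrA -mulrDr ler_wpM2l ?(ltW c0)// -addrA lerD2l -mulrDr.
    exact: fpowD.
  have np0 y : 0 <= fnorm (nab w y) `^ p by exact: powR_ge0.
  have cP0 : 0 <= c * P2 by rewrite mulr_ge0 ?(ltW c0) ?(ltW P20).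
  rewrite (intD mQa mgG (rmeasZ (c * P2) mnp) gG0 (fun y => mulr_ge0 cP0 (np0 y))).
  rewrite (intZ mQa mnp np0 cP0).
  rewrite leeD2r//; apply: le_trans (ltW hr0'); apply: int_subset => //.
  by move=> y [Qy hy]; split=> // hr; apply: hy; exact: lt_le_trans hr (r0a i).
have SQ : S i `<=` Q `\` oball d x (a i).
  move=> y /= /andP[h1 h2]; split; first exact: le_lt_trans h2 (brho i i_n).
  by apply/negP; rewrite -leNgt.
have b3 : (Ip mu p (Q `\` oball d x (a i)) (nab w) <= (P2 * (P2 * (T / n%:R) + Lam `^ p * e1))%:E)%E.
  rewrite /Ip (@int_splitD _ _ mu _ (S i))//; last by move=> y; exact: powR_ge0.
  rewrite [X in (_ + X)%E](_ : _ = 0%E) ?adde0; last first.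
    rewrite -(integral0 mu ((Q `\` oball d x (a i)) `\` S i)).
    apply: (int_eq_ae (g := fun=> 0%R)) => //.
    - exact (measurableD mQa (mS i)).
    - exact: rmeas_cst.
    - by move=> y; exact: powR_ge0.
    apply: filterS hnw => y [_ h2 _] [[Qy hy] Sy]; rewrite [nab w y]h2 ?fnorm0 ?powR0 ?gt_eqF//.
    rewrite ltNge; apply/negP => hb; apply: Sy; rewrite /S/= hb andbT leNgt; exact/negP.
  pose F y := P2 * (P2 * psi y + Lam `^ p * fnorm (v y - uk y) `^ p).
  have mvu : rmeas (fun y => fnorm (v y - uk y) `^ p).
    by apply: measurable_fpow; exact: mmeasB.
  have F0 y : 0 <= P2 * psi y + Lam `^ p * fnorm (v y - uk y) `^ p.
    by rewrite addr_ge0// mulr_ge0// ?(ltW P20)// powR_ge0.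
  have mF : rmeas (fun y => P2 * psi y + Lam `^ p * fnorm (v y - uk y) `^ p).
    by apply: rmeasD; exact: rmeasZ.
  apply: (@le_trans _ _ (\int[mu]_(y in S i) (F y)%:E)%E).
    apply: (int_le_ae (mS i) mnp (rmeasZ P2 mF) (fun=> powR_ge0 _ _) (fun y => mulr_ge0 (ltW P20) (F0 y))).
    apply: filterS (filterI hnw (gradmuB H (vk := vk) hv huk)) => y [[_ _ h1] h2] _.
    rewrite [nab (fun x => v x - uk x) y]h2 in h1; apply: le_trans h1 _; rewrite /F ler_wpM2l ?(ltW P20)// lerD2r.
    by apply: le_trans (fpowD p0 _ _) _; rewrite fnormN.
  have vu0 y : 0 <= fnorm (v y - uk y) `^ p by exact: powR_ge0.
  have Lp0 : 0 <= Lam `^ p by exact: powR_ge0.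
  rewrite (intZ (mS i) mF F0 (ltW P20)) EFinM; apply: lee_wpmul2l; first by rewrite lee_fin ltW.
  rewrite (intD (mS i) (rmeasZ P2 mpsi) (rmeasZ (Lam `^ p) mvu)
    (fun y => mulr_ge0 (ltW P20) (psi0 y)) (fun y => mulr_ge0 Lp0 (vu0 y))) EFinD.
  rewrite (intZ (mS i) mpsi psi0 (ltW P20)) (intZ (mS i) mvu vu0 Lp0) !EFinM.
  apply: leeD; first by apply: lee_wpmul2l => //; rewrite lee_fin ltW.
  apply: lee_wpmul2l; first by rewrite lee_fin.
  apply: le_trans (ltW lvu).
  by apply: (int_subset (mS i) measXT mvu vu0).
rewrite (int_splitD mQ moa mhw hw0 aQ).
apply: le_lt_trans (leeD b1 b2) _.
apply: (@le_lt_trans _ _ (M1%:E + (gap%:E + (c * P2)%:E * (P2 * (P2 * (T / n%:R) + Lam `^ p * e1))%:E))%E).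
  by rewrite leeD2l// leeD2l// lee_wpmul2l// lee_fin mulr_ge0 ?(ltW c0) ?(ltW P20).
rewrite -EFinM -!EFinD lte_fin.
have -> : c * P2 * (P2 * (P2 * (T / n%:R) + Lam `^ p * e1)) = c * P2 * P2 * P2 * (T / n%:R) + kap * e1.
  by rewrite /kap; ring.
have : gap * 4 = M - M1 by rewrite divfK.
by move: hn e1g; move: (_ * (T / _)) (kap * e1) => z1 z2; lra.
Qed.

Lemma nab_off_cball w x r : inAm Alg w -> (forall y, ~ cball d x r y -> w y = 0) ->
  {ae mu, forall y : borelT X, ~ cball d x r y -> nab w y = 0}.
Proof.
move=> hw w0; have := nab_local HS hw (open_oballC HX x r).
have h y : r < d x y -> w y = 0 by move=> ry; apply: w0; apply/negP; rewrite -ltNge.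
by move=> /(_ h); apply: filterS => y hy /negP; rewrite -ltNge; exact: hy.
Qed.

Lemma measurable_hl_Gnab w : inAm Alg w -> rmeas (fun y => hl y (G y + nab w y)).
Proof. by move=> hw; apply: (hl_meas); exact: (mmeas_Gnab). Qed.

Lemma measurable_hl_G : rmeas (fun y => hl y (G y)).
Proof. exact: (hl_meas). Qed.

Lemma hl_G_sub_fin A : measX A -> (\int[mu]_(x in A) (hl x (G x))%:E \is a fin_num)%E.
Proof.
move=> mA; rewrite ge0_fin_numE; last by apply: int_ge0 => x; exact: (hl_ge0).
apply: le_lt_trans (hl_G_fin).
apply: (int_subset mA measXT measurable_hl_G) => // x; exact: (hl_ge0).
Qed.

(** The perturbation from [slicing] vanishes off a closed ball inside the smaller one, so the ring
    costs only the integrand of u itself. *)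
Lemma Ebar_ball_le x (r rho M : R) : 0 < r < rho ->
  (Ebar Alg mu p D L u (oball d x r) < M%:E)%E ->
  (Ebar Alg mu p D L u (oball d x rho) <=
    M%:E + \int[mu]_(y in oball d x rho `\` oball d x r) (hl y (G y))%:E)%E.
Proof.
move=> /andP[r0 rrho] hM.
have mr : measX (oball d x r) by exact: (meas_oball HX).
have mrho : measX (oball d x rho) by exact: (meas_oball HX).
have mD : measX (oball d x rho `\` oball d x r) by exact: measurableD.
have If := hl_G_sub_fin mD.
rewrite -(fineK If) -EFinD; apply: (Ebar_le mrho) => e e0.
have [w [r1 /andP[r10 r1r] [hw w0 lw hI]]] := slicing r0 e0 hM.
exists w; split=> //.
rewrite (int_splitD mrho mr (measurable_hl_Gnab hw)); last 2 first.
- by move=> y; exact: (hl_ge0).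
- by move=> y yr; exact: lt_trans yr rrho.
have -> : (\int[mu]_(y in oball d x rho `\` oball d x r) (hl y (G y + nab w y))%:E =
   \int[mu]_(y in oball d x rho `\` oball d x r) (hl y (G y))%:E)%E; last first.
  by rewrite EFinD fineK//; apply: lte_leD.
apply: (int_eq_ae mD (measurable_hl_Gnab hw) measurable_hl_G).
- by move=> y; exact: (hl_ge0).
- by move=> y; exact: (hl_ge0).
apply: filterS (nab_off_cball hw w0) => y h [_ hy].
by rewrite [nab w y]h ?addr0// => hb; apply: hy; exact: le_lt_trans hb r1r.
Qed.

(** Inner regularity along concentric balls; it allows an open ball to be replaced by a closed one
    inside it in the covering argument. *)
Lemma Ebar_inner x (rho r0 tau : R) : 0 < rho -> r0 < rho ->
  (tau%:E < Ebar Alg mu p D L u (oball d x rho))%E ->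
  exists2 r, 0 < r /\ r0 < r < rho & (tau%:E < Ebar Alg mu p D L u (oball d x r))%E.
Proof.
move=> rho0 r0rho htau.
have [e e0 he] : exists2 e : R, 0 < e & ((tau + e + e)%:E <= Ebar Alg mu p D L u (oball d x rho))%E.
  move: htau; case: (Ebar _ _ _ _ _ _ _) => [z| |] //; last first.
    by move=> _; exists 1; rewrite // leey.
  rewrite lte_fin => h; exists ((z - tau) / 2); first by rewrite divr_gt0// subr_gt0.
  by rewrite lee_fin -addrA -splitr addrC subrK.
have mhG : measurable_fun [set: borelT X] (fun y : borelT X => hl y (G y)) by exact: measurable_hl_G.
have hG0 y : 0 <= hl y (G y) by exact: (hl_ge0).
have [del d0 hdel] := integral_abs_cont mhG hG0 (hl_G_fin) e0.
have mr0 : Num.max r0 0 < rho by rewrite gt_max r0rho.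
have [r /andP[hr rrho] hmu] := mu_inner_ball x mr0 d0.
move: hr; rewrite gt_max => /andP[r0r r_0].
exists r; first by rewrite r_0 r0r.
rewrite ltNge; apply/negP => hle.
have hlt : (Ebar Alg mu p D L u (oball d x r) < (tau + e)%:E)%E.
  by apply: le_lt_trans hle _; rewrite lte_fin ltrDl.
have r_rho : 0 < r < rho by rewrite r_0.
have := Ebar_ball_le r_rho hlt; apply/negP; rewrite -ltNge.
apply: lt_le_trans he; have mr : measX (oball d x rho `\` oball d x r) by apply: measurableD; exact: (meas_oball HX).
by rewrite [(_ + e + e)%:E]EFinD; rewrite lteD2lE//; exact: hdel.
Qed.

Lemma Ebar_superadd n (Q : nat -> set X) (tau : nat -> R) A : measX A ->
  (forall j, measX (Q j)) -> trivIset setT Q -> (forall j, (j < n)%N -> Q j `<=` A) ->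
  (forall j, (j < n)%N -> tau j <= 0 \/ ((tau j)%:E < Ebar Alg mu p D L u (Q j))%E) ->
  ((\sum_(j < n) tau j)%:E <= Ebar Alg mu p D L u A)%E.
Proof.
move=> mA mQ tQ QA htau; apply: le_ereal_inf_tmp => _ [un [hun cun] <-].
have /choice[n0 hn0] : forall j, exists n0, (j < n)%N -> forall k, (n0 <= k)%N ->
    ((tau j)%:E <= Efun mu D L (un k) (Q j))%E.
  move=> j; have [jn|] := ltnP j n; last by move=> _; exists 0%N.
  have [h|h] := htau j jn.
    exists 0%N => _ k _; apply: (@le_trans _ _ 0%E); first by rewrite lee_fin.
    exact: integral_ge0.
  have : ((tau j)%:E < limn_einf (fun k => Efun mu D L (un k) (Q j)))%E.
    apply: lt_le_trans h _; apply: ereal_inf_lbound.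
    by exists un.
  by move=> /lt_limn_einf[n0 hn0]; exists n0 => _ k /hn0/ltW.
apply: (@limn_einf_ge _ _ _ (\max_(j < n) n0 j)) => k hk.
have ml : rmeas (fun x => l x (grad D (un k) x)).
  by apply: (ca_meas HL); exact: (mmeas_grad H).
have l0 x : 0 <= l x (grad D (un k) x) by exact: (l_ge0).
rewrite (Efun_l mA (hun k)).
apply: (@le_trans _ _ (\int[mu]_(x in \big[setU/set0]_(j < n) Q j) (l x (grad D (un k) x))%:E)%E); last first.
  apply: (int_subset _ mA ml l0); first by apply: bigsetU_measurable => j _; exact: mQ.
  by move=> x; rewrite -bigcup_mkord => -[j jn]; exact: QA.
rewrite (int_bigsetU _ _ mQ tQ ml l0) -sumEFin; apply: lee_sum => j _.
rewrite -(Efun_l (mQ j) (hun k)); apply: hn0 => //.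
by apply: leq_trans hk; exact: (leq_bigmax (F := fun j : 'I_n => n0 j)).
Qed.

(** Trades an abstract element of W_0 for a function of the algebra supported in a smaller closed
    ball; [truncation] and upper semicontinuity keep the inequality strict. *)
Lemma competitor x (rho r0 s : R) v F : 0 < rho -> r0 < rho -> 0 < s ->
  inW0 Alg mu p D Sx (oball d x rho) v F ->
  (\int[mu]_(y in oball d x rho) (hl y (G y + F y))%:E < s%:E * mu (oball d x rho))%E ->
  exists w, exists2 r, 0 < r /\ r0 < r < rho & [/\ inAm Alg w,
    forall y, ~ cball d x r y -> w y = 0 &
    (\int[mu]_(y in cball d x r) (hl y (G y + nab w y))%:E < s%:E * mu (cball d x r))%E].
Proof.
move=> rho0 r0rho s0 [mv [mF [un [hun [_ /cvgLpP cF]]]]] hI.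
have mo r : measX (oball d x r) by exact: (meas_oball HX).
have muE r : mu (oball d x r) = (fine (mu (oball d x r)))%:E := esym (fineK (mu_fin_num HX (mo r))).
rewrite muE -EFinM in hI.
have IF : (Ip mu p setT F < +oo)%E.
  have [k hk] := cF _ ltr01; have {hk} := hk k (leqnn k).
  have -> : F = fun y => nab (un k) y - (nab (un k) y - F y) by apply/funext => y; rewrite opprB addrC subrK.
  have mk := mmeas_nab HS (hun k).1.
  rewrite -/F => h; apply: le_lt_trans (IpB p1 measXT mk (mmeasB mk mF)) _.
  apply: lte_mul_pinfty; rewrite ?lee_fin ?powR_ge0//.
  apply: lte_add_pinfty; first exact: (Ip_nab_fin (hun k).1).
  by move: h; rewrite lpdistE; under eq_fun do rewrite opprB addrC subrK; move=> h; apply: lt_trans h (ltry _).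
have IGF : (Ip mu p setT (fun y => G y + F y)%R < +oo)%E.
  apply: le_lt_trans (IpD p1 measXT mG mF) _.
  apply: lte_mul_pinfty; rewrite ?lee_fin ?powR_ge0//.
  exact: lte_add_pinfty (inW_fin) IF.
have [del d0 hdel] := hl_int_usc (mo rho) (mmeasD mG mF) IGF hI.
have d2 : 0 < del / (2 `^ p * 2) by rewrite divr_gt0// mulr_gt0// powR_gt0.
have [k /(_ k (leqnn k)) hk] := cF _ d2.
have [hf f0] := hun k.
have [w [r1 /andP[r10 r1rho] [hw w0 _ lw]]] := truncation HS hf rho0 d2 f0.
have mw := mmeas_nab HS hw.
have lwF : (lpdist mu p (nab w) F < del%:E)%E.
  exact: (lpdist_lt_tri p1 mw (mmeas_nab HS hf) mF lw hk).
have hIw : (\int[mu]_(y in oball d x rho) (hl y (G y + nab w y))%:E < (s * fine (mu (oball d x rho)))%:E)%E.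
  apply: hdel; first exact: mmeasD.
  by rewrite lpdist_addl.
set I := (\int[mu]_(y in oball d x rho) (hl y (G y + nab w y))%:E)%E in hIw.
have I0 : (0 <= I)%E by apply: int_ge0 => y; exact: (hl_ge0).
have If : I \is a fin_num by rewrite ge0_fin_numE// (lt_trans hIw)// ltry.
have gap : 0 < s * fine (mu (oball d x rho)) - fine I by rewrite subr_gt0 -lte_fin fineK.
(* If the ring has measure below this slack divided by s, then s times the measure of the smaller
   ball still exceeds I. *)
have e0 : 0 < (s * fine (mu (oball d x rho)) - fine I) / s by rewrite divr_gt0.
have r2rho : Num.max (Num.max r0 r1) 0 < rho by rewrite !gt_max r0rho r1rho.
have [r /andP[hr rrho] hmu] := mu_inner_ball x r2rho e0.
move: hr; rewrite !gt_max => /andP[/andP[r0r r1r] r_0].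
exists w, r; first by rewrite r_0 r0r.
split=> //; first by move=> y hy; apply: w0 => h1; apply: hy; exact: le_trans h1 (ltW r1r).
have mc : measX (cball d x r) by exact: (@meas_cball _ _ _ _ HX).
apply: (@le_lt_trans _ _ I).
  apply: (int_subset mc (mo rho) (measurable_hl_Gnab hw)); first by move=> y; exact: (hl_ge0).
  by move=> y yr; exact: le_lt_trans yr rrho.
apply: (@lt_le_trans _ _ (s%:E * mu (oball d x r))%E); last first.
  rewrite lee_wpmul2l ?lee_fin ?(ltW s0)//; apply: le_measure; rewrite ?inE//; first exact (mo r).
  by move=> y; exact: ltW.
rewrite muE -EFinM -(fineK If) lte_fin.
have hU : (mu (oball d x rho) <= mu (oball d x r) + mu (oball d x rho `\` oball d x r))%E.
  have sub : oball d x r `<=` oball d x rho by move=> y yr; exact: lt_trans yr rrho.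
  rewrite -[X in (mu X <= _)%E](setDUK sub).
  exact (mu_leU (mo r) (measurableD (mo rho) (mo r))).
have : (mu (oball d x rho) < mu (oball d x r) + ((s * fine (mu (oball d x rho)) - fine I) / s)%:E)%E.
  have mf := mu_fin_num HX (mo r).
  by apply: le_lt_trans hU _; rewrite lteD2lE.
rewrite {1}muE (muE r) -EFinD lte_fin -ltrBlDl ltr_pdivlMr// => h.
by move: h; rewrite mulrBl !(mulrC _ s); lra.
Qed.

(** * Poincare estimate on balls and gluing of competitors *)

Context {K chi rho1 : R} (K0 : 0 < K) (chi1 : 1 <= chi)
  (hC1 : forall (x : X) (rho : R), 0 < rho <= rho1 ->
     forall v F, inW0 Alg mu p D Sx (oball d x rho) v F ->
       (poweR (\int[mu]_(y in oball d x rho) ((fnorm (v y)) `^ (chi * p))%:E)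
              (1 / (chi * p))
        <= (rho * K)%:E *
           poweR (\int[mu]_(y in oball d x rho) ((fnorm (F y)) `^ p)%:E) (1 / p))%E).

(* Integrated with a suitable theta, this replaces Hoelder's inequality. *)
Lemma le_powR_split (a theta : R) : 0 <= a -> 0 < theta ->
  a <= theta + theta / theta `^ chi * a `^ chi.
Proof.
move=> a0 t0; have [at_|ta] := leP a theta.
  by apply: le_trans at_ _; rewrite lerDl !mulr_ge0 ?invr_ge0 ?powR_ge0 ?(ltW t0).
have b1 : 1 <= a / theta by rewrite ler_pdivlMr// mul1r ltW.
have {2}-> : a = a / theta * theta by rewrite divfK// gt_eqF.
rewrite powRM ?divr_ge0 ?(ltW t0)// -mulrA [_^-1 * _]mulrCA mulVf ?mulr1; last first.
  by rewrite gt_eqF// powR_gt0.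
apply: (@le_trans _ _ (theta * (a / theta))); first by rewrite mulrC divfK// gt_eqF.
by rewrite -[leLHS]add0r lerD ?(ltW t0)// ler_wpM2l ?(ltW t0)// le1r_powR.
Qed.

(** (C1) concerns open balls, hence the doubled radius; nothing is lost on the right because the
    projected gradient of w vanishes off the closed ball. *)
Lemma poincare_cball x (r : R) w : ~ @null_points _ _ d mu x -> 0 < r -> 2 * r <= rho1 ->
  inAm Alg w -> (forall y, ~ cball d x r y -> w y = 0) ->
  (Ip mu p (cball d x r) w <=
   ((2 * r * K) `^ p * (fine (mu [set: borelT X]) + 1))%:E *
   (Ip mu p (cball d x r) (nab w) + mu (cball d x r)))%E.
Proof.
move=> xN r0 r1 hw w0.
have r20 : 0 < 2 * r by rewrite mulr_gt0.
have rr : r < 2 * r by rewrite mulr_natl mulr2n ltrDr.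
have mo : measX (oball d x (2 * r)) by exact: (meas_oball HX).
have mc : measX (cball d x r) by exact: (@meas_cball _ _ _ _ HX).
have co : cball d x r `<=` oball d x (2 * r) by move=> y yr; exact: le_lt_trans yr rr.
have mw := mmeas_inAm H hw; have mnw := mmeas_nab HS hw.
have mnp : rmeas (fun y => fnorm (nab w y) `^ p) by exact (measurable_fpow p mnw).
have mwp : rmeas (fun y => fnorm (w y) `^ p) by exact (measurable_fpow p mw).
have mwc : rmeas (fun y => fnorm (w y) `^ (chi * p)) by exact (measurable_fpow (chi * p) mw).
have wout : forall y, ~ oball d x (2 * r) y -> w y = 0 by move=> y hy; apply: w0 => /co.
have r2 : 0 < 2 * r <= rho1 by rewrite r20.
have JE : (\int[mu]_(y in oball d x (2 * r)) (fnorm (nab w y) `^ p)%:E = Ip mu p (cball d x r) (nab w))%E.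
  rewrite (int_splitD mo mc mnp (fun=> powR_ge0 _ _) co).
  rewrite [X in (_ + X)%E](_ : _ = 0%E) ?adde0//.
  rewrite -(integral0 mu (oball d x (2 * r) `\` cball d x r)).
  apply: (int_eq_ae (measurableD mo mc) mnp (rmeas_cst 0) (fun=> powR_ge0 _ _)) => //.
  by apply: filterS (nab_off_cball hw w0) => y h [_ /h]; rewrite -/nab => ->; rewrite fnorm0 powR0// gt_eqF.
have : (poweR (\int[mu]_(y in oball d x (2 * r)) (fnorm (w y) `^ (chi * p))%:E) (1 / (chi * p)) <=
    (2 * r * K)%:E * poweR (\int[mu]_(y in oball d x (2 * r)) (fnorm (nab w y) `^ p)%:E) (1 / p))%E.
  exact: (hC1 r2 (inW0_Alg HS hw wout)).
rewrite JE.
have J0 : (0 <= Ip mu p (cball d x r) (nab w))%E by exact: Ip_ge0.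
have Jf : Ip mu p (cball d x r) (nab w) \is a fin_num.
  rewrite ge0_fin_numE//; apply: le_lt_trans (Ip_nab_fin hw).
  by apply: (Ip_subset _ mc measXT mnw).
move: Jf J0; case: (Ip mu p (cball d x r) (nab w)) => [J| |] // _; rewrite lee_fin => J0.
set I := (\int[mu]_(y in oball d x (2 * r)) (fnorm (w y) `^ (chi * p))%:E)%E.
have cp0 : 0 < chi * p by rewrite mulr_gt0// (lt_le_trans ltr01).
have I0 : (0 <= I)%E by apply: int_ge0 => y; exact: powR_ge0.
rewrite poweR_EFin -EFinM => hC.
have If : I \is a fin_num.
  rewrite ge0_fin_numE// ltey; apply/eqP => IE; move: hC; rewrite IE.
  by rewrite poweRyr // gt_eqF// divr_gt0.
move: hC; rewrite -(fineK If) poweR_EFin lee_fin => hC.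
have i0 : 0 <= fine I by exact: fine_ge0.
have muc0 : 0 < fine (mu (cball d x r)).
  rewrite fine_gt0// (mu_fin_meas HX mc) andbT lt0e measure_ge0 andbT; apply/eqP => mu0.
  apply: xN; exists r => //; apply/eqP; rewrite eq_le measure_ge0 andbT -mu0.
  by apply: le_measure; rewrite ?inE//; [exact: (meas_oball HX)|move=> y /ltW].
have mucE : mu (cball d x r) = (fine (mu (cball d x r)))%:E by rewrite fineK// (mu_fin_num HX).
(* The measure of the ball is added to J so that theta is positive even when the energy J is 0. *)
pose theta := (2 * r * K) `^ p * (J + fine (mu (cball d x r))).
have rK0 : 0 < 2 * r * K by rewrite mulr_gt0.
have t0 : 0 < theta by rewrite mulr_gt0 ?powR_gt0// ltr_wpDl.
have hI : fine I <= theta `^ chi.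
  have -> : fine I = (fine I `^ (1 / (chi * p))) `^ (chi * p).
    by rewrite -powRrM div1r mulVf ?powRr1// gt_eqF.
  apply: (@le_trans _ _ ((2 * r * K * J `^ (1 / p)) `^ (chi * p))).
    by apply: ge0_ler_powR; rewrite ?nnegrE ?powR_ge0 ?(ltW cp0)// mulr_ge0 ?powR_ge0 ?(ltW rK0).
  rewrite [chi * p]mulrC powRrM; apply: ge0_ler_powR; rewrite ?nnegrE ?powR_ge0 ?(ltW t0) ?(le_trans ler01)//.
  rewrite powRM ?powR_ge0 ?(ltW rK0)// -powRrM div1r mulVf ?gt_eqF// powRr1//.
  by rewrite ler_wpM2l ?powR_ge0// lerDl ltW.
have muXE : mu [set: borelT X] = (fine (mu [set: borelT X]))%:E by rewrite fineK// (mu_finX HS).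
apply: (@le_trans _ _ (\int[mu]_(y in cball d x r)
   (theta + theta / theta `^ chi * fnorm (w y) `^ (chi * p))%:E)%E).
  apply: (int_le mc mwp) => [|y|y _].
  - by apply: rmeasD; [exact: rmeas_cst|exact: rmeasZ].
  - exact: powR_ge0.
  - by rewrite [chi * p]mulrC powRrM; apply: le_powR_split => //; exact: powR_ge0.
have tt0 : 0 <= theta / theta `^ chi by rewrite divr_ge0 ?powR_ge0 ?(ltW t0).
rewrite (intD mc (rmeas_cst theta) (rmeasZ _ mwc) (fun=> ltW t0) (fun=> mulr_ge0 tt0 (powR_ge0 _ _))).
rewrite (intZ mc mwc (fun=> powR_ge0 _ _) tt0) (int_cst _ mc).
apply: (@le_trans _ _ (theta%:E * mu [set: borelT X] + theta%:E)%E).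
  apply: leeD.
    by rewrite lee_wpmul2l ?lee_fin ?(ltW t0)//; apply: le_measure; rewrite ?inE.
  apply: (@le_trans _ _ ((theta / theta `^ chi)%:E * I)%E).
    by rewrite lee_wpmul2l ?lee_fin//; apply: (int_subset mc mo mwc (fun=> powR_ge0 _ _)).
  rewrite -(fineK If) -EFinM lee_fin; apply: le_trans (ler_wpM2l tt0 hI) _.
  by rewrite divfK// gt_eqF// powR_gt0.
rewrite muXE mucE -EFinM -!EFinD -EFinM lee_fin /theta.
by rewrite /= le_eqVlt; apply/orP; left; apply/eqP; ring.
Qed.

Section Glue.
Context (n : nat) (x : nat -> X) (r : nat -> R) (w : nat -> X -> 'rV[R]_m).
Context (hw : forall j, inAm Alg (w j)) (w0 : forall j y, ~ cball d (x j) (r j) y -> w j y = 0)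
  (tB : trivIset setT (fun j => cball d (x j) (r j))).
Let B j := cball d (x j) (r j).
Let U := \big[setU/set0]_(j < n) B j.
Let W y := \sum_(j < n) w j y.

Let mB j : measX (B j).
Proof. exact: (@meas_cball _ _ _ _ HX). Qed.

Let mU : measX U.
Proof. by apply: bigsetU_measurable => j _; exact: mB. Qed.

Lemma disjoint_sum {V : zmodType} (g : nat -> V) j y : (j < n)%N -> B j y ->
  (forall i, ~ B i y -> g i = 0) -> \sum_(i < n) g i = g j.
Proof.
move=> jn Bj g0; rewrite (bigD1 (Ordinal jn))//= big1 ?addr0// => i ij.
apply: g0 => Bi; have h : (B i `&` B j) !=set0 by exists y.
by have ijE := tB I I h; move: ij; rewrite -val_eqE /= ijE eqxx.
Qed.

Lemma glue_inAm : inAm Alg W.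
Proof. exact: (inAm_sum H n hw). Qed.

Lemma glue_nab : {ae mu, forall y : borelT X,
  (forall j, (j < n)%N -> B j y -> nab W y = nab (w j) y) /\ (~ U y -> nab W y = 0)}.
Proof.
have h0 : {ae mu, forall y : borelT X, forall j, ~ B j y -> nab (w j) y = 0}.
  by apply/ae_foralln => j; exact: (nab_off_cball (hw j) (@w0 j)).
apply: filterS (filterI h0 (gradmu_sum H (vk := vk) n hw)) => y [h1 h2].
split=> [j jn Bj|Uy]; rewrite [nab W y]h2.
  exact: (disjoint_sum (g := fun i => nab (w i) y) jn Bj (fun i => h1 i)).
apply: big1 => j _; apply: h1 => Bj; apply: Uy.
by rewrite /U -bigcup_mkord; exists j => //=; exact: ltn_ord.
Qed.

Lemma glue_Ip : Ip mu p setT W = (\sum_(j < n) Ip mu p (B j) (w j))%E.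
Proof.
have mW : rmeas (fun y => fnorm (W y) `^ p) by exact (measurable_fpow p (mmeas_inAm H glue_inAm)).
rewrite /Ip (int_splitD measXT mU mW (fun=> powR_ge0 _ _) (@subsetT _ _)).
rewrite [X in (_ + X)%E](_ : _ = 0%E) ?adde0; last first.
  apply: integral0_eq => y [_ Uy]; rewrite /W big1 ?fnorm0 ?powR0// ?gt_eqF// => j _.
  by apply: w0 => Bj; apply: Uy; rewrite /U -bigcup_mkord; exists j => //=; exact: ltn_ord.
rewrite (int_bigsetU mu n mB tB mW (fun=> powR_ge0 _ _)); apply: eq_bigr => j _.
apply: eq_integral => y; rewrite inE => Bj; rewrite /W.
by rewrite (disjoint_sum (g := fun i => w i y) (ltn_ord j) Bj)// => i; exact: w0.
Qed.

Lemma glue_int A (s : R) : measX A -> (forall j, B j `<=` A) ->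
  (forall j, (\int[mu]_(y in B j) (hl y (G y + nab (w j) y))%:E <= s%:E * mu (B j))%E) ->
  (\int[mu]_(y in A) (hl y (G y + nab W y))%:E <=
   s%:E * mu U + \int[mu]_(y in A `\` U) (hl y (G y))%:E)%E.
Proof.
move=> mA BA hB.
have UA : U `<=` A by rewrite /U -bigcup_mkord => y [j _]; exact: BA.
have mAU : measX (A `\` U) by exact: measurableD.
have h0 (xi : 'M[R]_(m, N)) y : 0 <= hl y xi by exact: (hl_ge0).
have mhW : rmeas (fun y => hl y (G y + nab W y)).
  exact (measurable_hl_Gnab glue_inAm).
rewrite (int_splitD mA mU mhW (fun=> h0 _ _) UA); apply: leeD; last first.
  apply: (int_le_ae mAU mhW (measurable_hl_G) (fun=> h0 _ _) (fun=> h0 _ _)).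
  by apply: filterS glue_nab => y [_ h] [_ /h ->]; rewrite addr0.
rewrite (int_bigsetU mu n mB tB mhW (fun=> h0 _ _)) /U (mu_bigsetU HX n mB tB) -EFinM mulr_sumr -sumEFin.
apply: lee_sum => j _; apply: le_trans (_ : (s%:E * mu (B j) <= _)%E); last first.
  by rewrite EFinM fineK// (mu_fin_num HX (mB j)).
apply: le_trans (hB j); apply: (int_le_ae (mB j) mhW _ (fun=> h0 _ _) (fun=> h0 _ _)).
  exact: (measurable_hl_Gnab (hw j)).
by apply: filterS glue_nab => y [h _] Bj; rewrite (h j).
Qed.

(** Coercivity of [hl] bounds the total energy independently of n and of the radii; multiplied by
    the factor of [poincare_cball] it tends to 0. *)
Lemma glue_energy (s : R) : 0 <= s ->
  (forall j, (\int[mu]_(y in B j) (hl y (G y + nab (w j) y))%:E <= s%:E * mu (B j))%E) ->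
  (\sum_(j < n) Ip mu p (B j) (nab (w j)) <=
   (2 `^ p)%:E * (Ip mu p setT G + (C^-1 * s)%:E * mu [set: borelT X]))%E.
Proof.
move=> s0 hB.
have mfG : rmeas (fun y => fnorm (G y) `^ p) by exact: measurable_fpow.
have Ci0 : 0 <= C^-1 by rewrite invr_ge0 ltW.
have h0 (xi : 'M[R]_(m, N)) y : 0 <= hl y xi by exact: (hl_ge0).
apply: (@le_trans _ _ (\sum_(j < n) (2 `^ p)%:E * (Ip mu p (B j) G + (C^-1 * s)%:E * mu (B j)))%E).
  apply: lee_sum => j _.
  have mhj := measurable_hl_Gnab (hw j).
  have mnj : rmeas (fun y => fnorm (nab (w j) y) `^ p).
    exact (measurable_fpow p (mmeas_nab HS (hw j))).
  apply: (@le_trans _ _ (\int[mu]_(y in B j) (2 `^ p * (fnorm (G y) `^ p + C^-1 * hl y (G y + nab (w j) y)))%:E)%E).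
    apply: (int_le (mB j) mnj); last first.
    (* nab (w j) is already projected, so it is the difference of the projections of G + nab (w j)
       and G, to which [hl_low] applies. *)
    - move=> y _; pose P := projT (seqspan (fun k => grad D (vk k) y)).
      rewrite {1}(_ : nab (w j) y = P (G y + nab (w j) y) - P (G y)); last first.
        by rewrite /P projTD addrC addKr /nab gradmuE projT_idem.
      apply: le_trans (fpowD p0 _ _) _; rewrite ler_wpM2l ?powR_ge0// addrC; apply: lerD.
        by rewrite fnormN; apply: fpow_le => //; exact: fnorm_projT.
      by rewrite mulrC ler_pdivlMr// mulrC; exact: (hl_low).
    - by move=> y; exact: powR_ge0.
    - by apply: rmeasZ; apply: rmeasD => //; exact: rmeasZ.
  have k0 y : 0 <= fnorm (G y) `^ p + C^-1 * hl y (G y + nab (w j) y).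
    by rewrite addr_ge0 ?powR_ge0// mulr_ge0.
  rewrite (intZ (mB j) (rmeasD mfG (rmeasZ _ mhj)) k0 (powR_ge0 _ _)).
  rewrite lee_wpmul2l ?lee_fin ?powR_ge0//.
  rewrite (intD (mB j) mfG (rmeasZ _ mhj) (fun=> powR_ge0 _ _) (fun=> mulr_ge0 Ci0 (h0 _ _))).
  rewrite leeD2l// (intZ (mB j) mhj (fun=> h0 _ _) Ci0) EFinM -muleA.
  by rewrite lee_wpmul2l ?lee_fin.
rewrite -ge0_sume_distrr; last first.
  by move=> j _; rewrite adde_ge0 ?Ip_ge0// mule_ge0// lee_fin mulr_ge0.
rewrite lee_wpmul2l ?lee_fin ?powR_ge0// big_split/=; apply: leeD.
  rewrite -(int_bigsetU mu n mB tB mfG (fun=> powR_ge0 _ _)).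
  exact: (int_subset mU measXT mfG (fun=> powR_ge0 _ _)).
rewrite -ge0_sume_distrr//; apply: lee_wpmul2l; first by rewrite lee_fin mulr_ge0.
apply: (@le_trans _ _ (mu U)); last by apply: le_measure; rewrite ?inE.
rewrite /U (mu_bigsetU HX n mB tB) -sumEFin; apply: lee_sum => j _.
by rewrite fineK// (mu_fin_num HX (mB j)).
Qed.

End Glue.

Context (rho10 : 0 < rho1)
  (hC2 : forall (A : set X) (F : set (set X)),
     (forall B, F B -> exists (x : X) (r : R), 0 < r /\ B = cball d x r) ->
     (forall x, A x -> forall e : R, 0 < e -> exists r : R, 0 < r < e /\ F (cball d x r)) ->
     exists Gf : set (set X), Gf `<=` F /\ countable Gf /\ trivIset Gf id /\
       mu.-negligible (A `\` \bigcup_(B in Gf) B)).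

(** * Differentiation of the relaxed functional *)

Definition below (s : R) (x : X) (rho : R) : Prop :=
  exists w F, inW0 Alg mu p D Sx (oball d x rho) w F /\
    (\int[mu]_(y in oball d x rho) (hl y (G y + F y))%:E < s%:E * mu (oball d x rho))%E.

Definition above (t : R) (x : X) (rho : R) : Prop :=
  (t%:E * mu (oball d x rho) < Ebar Alg mu p D L u (oball d x rho))%E.

Definition oscillation (s t : R) : set X :=
  [set x | [/\ ~ @null_points _ _ d mu x, frequently0 (below s x) & frequently0 (above t x)]].

Let mo x r : measX (oball d x r).
Proof. exact: (meas_oball HX). Qed.

Let mc x r : measX (cball d x r).
Proof. exact: (@meas_cball _ _ _ _ HX). Qed.

Let mfin (A : set X) : measX A -> mu A = (fine (mu A))%:E.
Proof. by move=> mA; rewrite fineK// (mu_fin_num HX mA). Qed.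

(** Produces the closed balls that (C2) requires, inside A and of prescribed smallness, with
    competitors in the algebra. *)
Lemma frequently_ball_below (s : R) x A (e : R) : 0 < s -> open A -> A x ->
  frequently0 (below s x) -> 0 < e ->
  frequently0 (fun r => r < e /\ cball d x r `<=` A /\ exists w, [/\ inAm Alg w,
    forall y, ~ cball d x r y -> w y = 0 &
    (\int[mu]_(y in cball d x r) (hl y (G y + nab w y))%:E <= s%:E * mu (cball d x r))%E]).
Proof.
move=> s0 /(open_oballP HX)/(_ x) hA /hA[a a0 aA] hf e0 eta eta0.
have mm : 0 < Num.min a (Num.min e eta) by rewrite !lt_min a0 e0.
have [rho /andP[rho0]] := hf _ mm; rewrite !lt_min => /andP[rhoa /andP[rhoe rhoeta]].
move=> [v [F [hv hI]]].
have [w [r [r0 /andP[_ rrho]] [hw w0 hwI]]] := competitor rho0 rho0 s0 hv hI.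
exists r; first by rewrite r0 (lt_trans rrho).
split; first exact: lt_trans rrho rhoe.
split; last by exists w; split=> //; exact: ltW.
by move=> y yr; apply: aA; apply: le_lt_trans yr _; exact: lt_trans rrho rhoa.
Qed.

Lemma frequently_ball_above (t : R) x A : 0 < t -> open A -> A x ->
  frequently0 (above t x) ->
  frequently0 (fun r => cball d x r `<=` A /\
    ((t * fine (mu (cball d x r)))%:E < Ebar Alg mu p D L u (oball d x r))%E).
Proof.
move=> t0 /(open_oballP HX)/(_ x) hA /hA[a a0 aA] hf eta eta0.
have mm : 0 < Num.min a eta by rewrite !lt_min a0.
have [rho /andP[rho0]] := hf _ mm; rewrite !lt_min => /andP[rhoa rhoeta].
rewrite /above (mfin (mo x rho)) -EFinM => hI.
have [r [r0 /andP[_ rrho]] hr] := Ebar_inner rho0 rho0 hI.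
exists r; first by rewrite r0 (lt_trans rrho).
have co : cball d x r `<=` oball d x rho by move=> y yr; exact: le_lt_trans yr rrho.
split; first by move=> y /co yr; apply: aA; exact: lt_trans yr rhoa.
apply: le_lt_trans hr; rewrite lee_fin ler_wpM2l ?(ltW t0)// -lee_fin -!mfin//.
by apply: le_measure; rewrite ?inE//; [exact (mc x r)|exact (mo x rho)].
Qed.

Lemma Ebar_ge_frequently (E A : set X) (t e del : R) : 0 < t -> open A -> E `<=` A ->
  (forall V, open V -> E `<=` V -> (e%:E <= mu V)%E) ->
  (forall x, E x -> frequently0 (above t x)) -> 0 < del ->
  ((t * (e - del))%:E <= Ebar Alg mu p D L u A)%E.
Proof.
move=> t0 oA EA hE hf del0.
have hP x : E x -> frequently0 (fun r => cball d x r `<=` A /\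
    ((t * fine (mu (cball d x r)))%:E < Ebar Alg mu p D L u (oball d x r))%E).
  by move=> Ex; apply: frequently_ball_above => //; [exact: EA|exact: hf].
have [n [x [r [hxr tB hmu]]]] := vitali_finite HX hC2 hP hE del0.
have mcj j : measX (cball d (x j) (r j)) by exact: mc.
rewrite (mu_bigsetU HX n mcj tB) lte_fin in hmu.
apply: (@le_trans _ _ ((\sum_(j < n) t * fine (mu (cball d (x j) (r j))))%:E)).
  by rewrite -mulr_sumr lee_fin ler_wpM2l ?(ltW t0)// ltW.
apply: (@Ebar_superadd n (fun j => oball d (x j) (r j))
  (fun j => t * fine (mu (cball d (x j) (r j)))) A).
- exact: open_meas.
- by move=> j; exact: mo.
- apply/trivIsetP => i j _ _ ij; have /trivIsetP/(_ i j I I ij) := tB.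
  rewrite -!subset0 => h y [h1 h2]; apply: (h y).
  by split; [exact: (ltW h1)|exact: (ltW h2)].
- move=> j _; have [rj|[r0 [cA _]]] := hxr j; first by rewrite rj (oball_neg HX).
  by move=> y /ltW; exact: cA.
- move=> j _; have [rj|[r0 [_ h]]] := hxr j; last by right.
  by left; rewrite rj (cball_neg HX) measure0 mulr0.
Qed.

Lemma small_radius (B e : R) : 0 <= B -> 0 < e -> exists2 eta : R, 0 < eta &
  forall r, 0 < r < eta -> (2 * r * K) `^ p * B < e.
Proof.
move=> B0 e0; pose q := (e / (B + 1)) `^ p^-1.
have eB : 0 < e / (B + 1) by rewrite divr_gt0// ltr_wpDl.
have q0 : 0 < q by exact: powR_gt0.
have K2 : 0 < 2 * K by rewrite mulr_gt0.
exists (q / (2 * K)); first by rewrite divr_gt0.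
move=> r /andP[r0 rq].
have h : 2 * r * K <= q.
  by rewrite mulrAC mulrC -ler_pdivlMr// ltW.
apply: (@le_lt_trans _ _ (e / (B + 1) * B)); last first.
  by rewrite -mulrA gtr_pMr// mulrC ltr_pdivrMr ?mul1r ?ltrDl// ltr_wpDl.
rewrite ler_wpM2r//; apply: (@le_trans _ _ (q `^ p)).
  by apply: ge0_ler_powR; rewrite ?nnegrE ?(ltW p0) ?(ltW q0)// !mulr_ge0 ?(ltW r0) ?(ltW K0).
by rewrite /q -powRrM mulVf ?powRr1 ?(ltW eB)// gt_eqF.
Qed.

Lemma Ebar_le_frequently (E A : set X) (s e del kap : R) : 0 < s -> open A -> E `<=` A ->
  (forall V, open V -> E `<=` V -> (e%:E <= mu V)%E) -> (mu A < (e + del)%:E)%E ->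
  (forall x, E x -> ~ @null_points _ _ d mu x) ->
  (forall x, E x -> frequently0 (below s x)) -> 0 < del ->
  (forall B, measX B -> (mu B < (2 * del)%:E)%E ->
     (\int[mu]_(y in B) (hl y (G y))%:E < kap%:E)%E) ->
  (Ebar Alg mu p D L u A <= (s * (e + del) + kap)%:E)%E.
Proof.
move=> s0 oA EA hE muA EN hf del0 hkap.
have mA : measX A by exact: open_meas.
apply: (Ebar_le mA) => e0 e00.
set muX := fine (mu [set: borelT X]).
have muX0 : 0 <= muX by exact: fine_ge0.
have muXE : mu [set: borelT X] = muX%:E by rewrite fineK// (mu_finX HS).
set BG := fine (Ip mu p setT G).
have BGE : Ip mu p setT G = BG%:E by rewrite fineK// ge0_fin_numE ?(inW_fin)// Ip_ge0.
have BG0 : 0 <= BG by apply: fine_ge0; exact: Ip_ge0.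
(* Bounds the sum over all balls of energy plus measure. *)
pose T := 2 `^ p * (BG + C^-1 * s * muX) + muX.
have T0 : 0 <= T by rewrite addr_ge0// mulr_ge0 ?powR_ge0// addr_ge0// !mulr_ge0 ?invr_ge0 ?(ltW C0) ?(ltW s0).
have BT0 : 0 <= (muX + 1) * T by rewrite mulr_ge0// addr_ge0.
have [eta eta0 heta] := small_radius BT0 e00.
(* rho1 / 2 allows (C1) on doubled balls, eta gives L^p smallness of the glued function. *)
pose eps := Num.min (rho1 / 2) eta.
have eps0 : 0 < eps by rewrite lt_min divr_gt0.
pose P x r := ~ @null_points _ _ d mu x /\ (r < eps /\ cball d x r `<=` A /\ exists w, [/\ inAm Alg w,
    forall y, ~ cball d x r y -> w y = 0 &
    (\int[mu]_(y in cball d x r) (hl y (G y + nab w y))%:E <= s%:E * mu (cball d x r))%E]).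
have hP x : E x -> frequently0 (P x).
  move=> Ex z z0; have [r hr h] := frequently_ball_below s0 oA (EA x Ex) (hf x Ex) eps0 z0.
  by exists r => //; split=> //; exact: EN.
have [n [x [r [hxr tB hmu]]]] := vitali_finite HX hC2 hP hE del0.
have mcj j : measX (cball d (x j) (r j)) by exact: mc.
have h0 (xi : 'M[R]_(m, N)) y : 0 <= hl y xi by exact: (hl_ge0).
have /choice[w hw] : forall j, exists w, [/\ inAm Alg w,
    forall y, ~ cball d (x j) (r j) y -> w y = 0 &
    (\int[mu]_(y in cball d (x j) (r j)) (hl y (G y + nab w y))%:E <=
      s%:E * mu (cball d (x j) (r j)))%E].
  move=> j; have [->|[r0 [_ [_ [_ hw]]]]] := hxr j; last exact: hw.
  exists (fun=> 0); split=> //; first exact: (inAm0 H).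
  by rewrite (cball_neg HX) integral_set0 measure0 mule0.
have hwA j : inAm Alg (w j) by have [] := hw j.
have w0 j y : ~ cball d (x j) (r j) y -> w j y = 0 by have [_ h _] := hw j; exact: h.
have wI j : (\int[mu]_(y in cball d (x j) (r j)) (hl y (G y + nab (w j) y))%:E <=
      s%:E * mu (cball d (x j) (r j)))%E by have [] := hw j.
have cA j : cball d (x j) (r j) `<=` A.
  by have [->|[_ [_ [_ []]]]//] := hxr j; rewrite (cball_neg HX).
set U := \big[setU/set0]_(j < n) cball d (x j) (r j) in hmu.
have mU : measX U by apply: bigsetU_measurable => j _; exact: mcj.
have UA : U `<=` A.
  rewrite /U -(bigcup_mkord n (fun j => cball d (x j) (r j))) => y [j _]; exact: cA.
exists (fun y => \sum_(j < n) w j y); split.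
- exact: (glue_inAm n hwA).
- have -> : lpdist mu p (fun y => \sum_(j < n) w j y) (fun=> 0) =
      Ip mu p setT (fun y => \sum_(j < n) w j y).
    by apply: eq_integral => y _; rewrite subr0.
  rewrite (glue_Ip n hwA w0 tB).
  have [rmax /andP[rm0 rmeta] hrm] : exists2 rm, 0 < rm < eta & forall j, (j < n)%N -> r j <= rm /\ (0 < r j -> 2 * r j <= rho1).
    (* Starting the maximum at eps / 2 keeps it positive even if every radius is the dummy value
       -1. *)
    pose rm := \big[Num.max/eps / 2]_(j < n) r j.
    exists rm.
      apply/andP; split.
        by apply: lt_le_trans (bigmax_ge_id _ _ _ _); rewrite divr_gt0.
      apply: bigmax_lt; first by apply: lt_le_trans (_ : eps <= _); [rewrite ltr_pdivrMr// ltr_pMr// ltr1n|rewrite ge_min lexx orbT].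
      move=> j _; have [->|[_ [_ [h _]]]] := hxr j; first exact: lt_trans (ltrN10 _) eta0.
      by apply: lt_le_trans h _; rewrite ge_min lexx orbT.
    move=> j jn; split; first exact: (le_bigmax _ (fun j : 'I_n => r j) (Ordinal jn)).
    have [->|[_ [_ [h _]]] _] := hxr j; first by rewrite ltrNr oppr0 ltr10.
    by rewrite mulrC -ler_pdivlMr//; apply: ltW; apply: lt_le_trans h _; rewrite ge_min lexx.
  pose k := (2 * rmax * K) `^ p * (muX + 1).
  have k0 : 0 <= k by rewrite mulr_ge0 ?powR_ge0// addr_ge0.
  apply: (@le_lt_trans _ _ (\sum_(j < n) k%:E * (Ip mu p (cball d (x j) (r j)) (nab (w j)) + mu (cball d (x j) (r j))))%E).
    apply: lee_sum => j _; have [rle r2] := hrm j (ltn_ord j).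
    have [rj|[r0 [xN _]]] := hxr j.
      rewrite /Ip rj (cball_neg HX) !integral_set0 measure0 adde0 mule0; exact: lexx.
    apply: le_trans (poincare_cball xN r0 (r2 r0) (hwA j) (@w0 j)) _.
    apply: lee_wpmul2r; first by rewrite adde_ge0// Ip_ge0.
    rewrite lee_fin /k -/muX ler_wpM2r ?addr_ge0//.
    apply: ge0_ler_powR; rewrite ?nnegrE ?(ltW p0)//; try by rewrite !mulr_ge0 ?(ltW K0) ?(ltW r0) ?(ltW rm0).
    by rewrite ler_wpM2r ?(ltW K0)// ler_wpM2l.
  rewrite -ge0_sume_distrr; last by move=> j _; rewrite adde_ge0// Ip_ge0.
  rewrite big_split /=.
  apply: (@le_lt_trans _ _ (k%:E * T%:E)%E); last first.
    by rewrite -EFinM lte_fin /k -[X in X < _]mulrA heta// rm0.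
  rewrite lee_wpmul2l ?lee_fin// /T EFinD; apply: leeD.
    apply: le_trans (glue_energy n hwA tB (ltW s0) wI) _.
    by rewrite BGE muXE.
  rewrite -muXE; apply: (@le_trans _ _ (mu U)); last by apply: le_measure; rewrite ?inE.
  rewrite /U (mu_bigsetU HX n mcj tB) -sumEFin; apply: lee_sum => j _.
  by rewrite -mfin.
- apply: le_lt_trans (glue_int n hwA w0 tB mA cA wI) _.
  have mAU : measX (A `\` U) by exact: measurableD.
  rewrite EFinD; apply: lee_ltD.
  + by rewrite (mfin mU).
  + rewrite EFinM lee_wpmul2l ?lee_fin ?(ltW s0)//; apply: le_trans (ltW muA).
    by apply: le_measure; rewrite ?inE.
  (* A has measure below e + del and U above e - del, so less than 2 del remains. *)
  + apply: hkap => //.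
    have : (mu U + mu (A `\` U) < (e + del)%:E)%E.
      suff <- : mu A = (mu U + mu (A `\` U))%E by [].
      by rewrite -(measureU mu mU mAU) ?setDUK// setDIK.
    move: hmu; rewrite (mfin mU) (mfin mAU) -EFinD !lte_fin; lra.
Qed.

(* With e the outer measure of the set, the two coverings give t * e <= s * e up to a small
   error. *)
Lemma oscillation_negligible (s t : R) : 0 < s < t -> mu.-negligible (oscillation s t).
Proof.
move=> /andP[s0 st]; have t0 := lt_trans s0 st; set E := oscillation s t.
(* The infimum of S is the outer measure of E, which need not be attained by an open set. *)
pose S := [set fine (mu A) | A in [set A : set X | open A /\ E `<=` A]].
have S0 : lbound S 0 by move=> _ [A _ <-]; exact: fine_ge0.
have hS : has_inf S.
  by split; [exists (fine (mu setT)), setT => //; split; [exact: openT|]|exists 0].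
pose e := inf S.
have e0 : 0 <= e by apply: lb_le_inf => //; exact: hS.1.
have hE V : open V -> E `<=` V -> (e%:E <= mu V)%E.
  move=> oV EV; rewrite (mfin (open_meas oV)) lee_fin; apply: ge_inf; first exact: hS.2.
  by exists V.
have mhG : measurable_fun [set: borelT X] (fun y : borelT X => hl y (G y)).
  exact: (measurable_hl_G).
have hG0 y : 0 <= hl y (G y) by exact: (hl_ge0).
have key del : 0 < del -> (t - s) * e <= (t + s + 1) * del.
  move=> d0.
  have [de de0 hde] := integral_abs_cont mhG hG0 (hl_G_fin) d0.
  (* Twice de' is at most de, as the remainder of measure below 2 de' in [Ebar_le_frequently]
     requires. *)
  pose de' := Num.min del (de / 2).
  have de'0 : 0 < de' by rewrite lt_min d0 divr_gt0.
  have [_ [A [oA EA] <-] hA] := inf_adherent de'0 hS.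
  have muA : (mu A < (e + de')%:E)%E by rewrite (mfin (open_meas oA)) lte_fin.
  have h1 : (Ebar Alg mu p D L u A <= (s * (e + de') + del)%:E)%E.
    apply: (@Ebar_le_frequently E) => //.
    - by move=> x [].
    - by move=> x [].
    - move=> B mB muB; apply: hde => //; apply: lt_le_trans muB _.
      by rewrite lee_fin mulrC -ler_pdivlMr// ge_min lexx orbT.
  have h2 : ((t * (e - de'))%:E <= Ebar Alg mu p D L u A)%E.
    by apply: (@Ebar_ge_frequently E) => // x [].
  have := le_trans h2 h1; rewrite lee_fin.
  have : (t + s) * de' <= (t + s) * del by rewrite ler_wpM2l ?ge_min ?lexx// addr_ge0 ?ltW.
  lra.
have {key} eE : e = 0.
  apply/eqP; rewrite eq_le e0 andbT leNgt; apply/negP => e_gt0.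
  have ts : 0 < (t - s) * e by rewrite mulr_gt0// subr_gt0.
  have ts1 : 0 < t + s + 1 by rewrite !addr_gt0.
  (* With this del, [key] would bound (t - s) e by half of itself. *)
  have d0 : 0 < (t - s) * e / (2 * (t + s + 1)) by rewrite divr_gt0// mulr_gt0.
  have := key _ d0; apply/negP; rewrite -ltNge mulrC invfM !mulrA divfK ?gt_eqF//.
  by rewrite ltr_pdivrMr// ltr_pMr// ltr1n.
have /choice[A hA] : forall n : nat, exists A : set X, [/\ open A, E `<=` A &
    (mu A < (n.+1%:R^-1)%:E)%E].
  move=> n; have n0 : 0 < n.+1%:R^-1 :> R by rewrite invr_gt0.
  have [_ [A [oA EA] <-] hA] := inf_adherent n0 hS; exists A; split=> //.
  by move: hA; rewrite -/e eE add0r (mfin (open_meas oA)) lte_fin.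
have mAn n : measX (A n) by apply: open_meas; have [] := hA n.
exists (\bigcap_n A n); split; first exact: bigcapT_measurable.
  apply/eqP; rewrite eq_le measure_ge0 andbT; apply/lee_addgt0Pr => z z0; rewrite add0e.
  have [n /(_ n (leqnn n))] := small_seq (@ler01 R) z0; rewrite mul1r => hn.
  have [_ _ hAn] := hA n.
  apply: (@le_trans _ _ (mu (A n))); last by apply: ltW; apply: lt_trans hAn _; rewrite lte_fin.
  apply: le_measure; rewrite ?inE; [exact: bigcapT_measurable|exact: mAn|].
  by move=> y; exact.
by move=> y Ey n _; have [_ EA _] := hA n; exact: EA.
Qed.

(** * Averages over balls and their common limit *)

Lemma inW_add A w F : inW0 Alg mu p D Sx A w F ->
  inW Alg mu p D Sx (fun y => u y + w y) (fun y => G y + F y).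
Proof.
move=> [mw [mF [wn [hwn [cw cF]]]]]; have [_ [_ [un [hun [cu cG]]]]] := hW.
split; first exact: mmeasD.
split; first exact: mmeasD.
have hw n : inAm Alg (wn n) by have [] := hwn n.
exists (fun n y => un n y + wn n y); split; first by move=> n; exact: (inAmD H).
split.
  by apply: (cvgLpD p1) => // n; exact: (mmeas_inAm H).
have mnu n := mmeas_nab HS (hun n); have mnw n := mmeas_nab HS (hw n).
apply/cvgLpP => e e0; have [n0 hn0] := (cvgLpP _ _ _).1 (cvgLpD p1 mnu mnw mG mF cG cF) e e0.
exists n0 => n /hn0; rewrite (lpdist_ae_eq (f := gradmu D Sx (fun y => un n y + wn n y))
  (f' := fun y => gradmu D Sx (un n) y + gradmu D Sx (wn n) y) (g := fun x => G x + F x)) => //.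
- exact: (mmeas_nab HS (inAmD H (hun n) (hw n))).
- exact: mmeasD (mnu n) (mnw n).
- exact: mmeasD.
- exact: (gradmuD H (vk := vk) (hun n) (hw n)).
Qed.

(** Translation by u: the two infima of the conclusion agree at every radius, not only in the
    limit. *)
Lemma affine_competitors A (phi : (X -> 'M[R]_(m, N)) -> \bar R) :
  [set phi vG.2 | vG in [set vG : (X -> 'rV[R]_m) * (X -> 'M[R]_(m, N)) |
     inW Alg mu p D Sx vG.1 vG.2 /\
     inW0 Alg mu p D Sx A (fun y => vG.1 y - u y) (fun y => vG.2 y - G y)]] =
  [set phi (fun y => G y + wG.2 y) | wG in [set wG : (X -> 'rV[R]_m) * (X -> 'M[R]_(m, N)) |
     inW0 Alg mu p D Sx A wG.1 wG.2]].
Proof.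
apply/seteqP; split=> _ [[v F] /= hv <-].
  exists (fun y => v y - u y, fun y => F y - G y) => /=; first exact: hv.2.
  by congr phi; apply/funext => y; rewrite addrC subrK.
have h1 := inW_add hv.
exists (fun y => u y + v y, fun y => G y + F y); last exact: erefl.
split; first exact: h1.
rewrite /=.
have -> : (fun y => u y + v y - u y) = v by apply/funext => y; rewrite addrC addKr.
by have -> : (fun y => G y + F y - G y) = F by apply/funext => y; rewrite addrC addKr.
Qed.

Definition infavg (x : X) (rho : R) : \bar R :=
  ereal_inf [set avg mu (oball d x rho) (fun y => Lhat Sx L y (G y + wG.2 y)) |
    wG in [set wG : (X -> 'rV[R]_m) * (X -> 'M[R]_(m, N)) |
           inW0 Alg mu p D Sx (oball d x rho) wG.1 wG.2]].

Lemma infavg_ge0 x rho : (0 <= infavg x rho)%E.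
Proof.
apply: le_ereal_inf_tmp => _ [vF _ <-]; rewrite /avg mule_ge0// ?lee_fin ?invr_ge0 ?fine_ge0//.
by apply: integral_ge0 => y _; apply: le_ereal_inf_tmp => _ [z _ <-].
Qed.

Lemma infavg_below x rho (s : R) : 0 < fine (mu (oball d x rho)) ->
  (infavg x rho < s%:E)%E ->
  below s x rho.
Proof.
move=> q0 /ereal_inf_lt[_ [[v F] /= hv <-]]; rewrite /avg lte_pdivrMl// => hI.
exists v, F; split=> //; have [_ [mF _]] := hv.
rewrite -(int_Lhat (mo x rho) (mmeasD mG mF)); apply: lt_le_trans hI _.
by rewrite muleC fineK// (mu_fin_num HX (mo x rho)).
Qed.

(** A real level strictly above the quotient of F feeds [slicing], whose perturbation vanishes off
    the ball and is a competitor with average below that level. *)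
Lemma infavg_le_Ebar x rho : 0 < rho -> 0 < fine (mu (oball d x rho)) ->
  (infavg x rho <= Ebar Alg mu p D L u (oball d x rho) * ((fine (mu (oball d x rho)))^-1)%:E)%E.
Proof.
move=> rho0 q0; set q := fine _ in q0 *; set b := (_ * _)%E.
have b0 : (0 <= b)%E.
  rewrite mule_ge0// ?lee_fin ?invr_ge0 ?(ltW q0)//.
  apply: le_ereal_inf_tmp => _ [un _ <-]; apply: (@limn_einf_ge _ _ _ 0%N) => n _.
  exact: integral_ge0.
rewrite leNgt; apply/negP => hlt.
have [s bs sa] : exists2 s : R, (b < s%:E)%E & (s%:E <= infavg x rho)%E.
  move: hlt b0; case: (b) => [z| |] //; case: (infavg x rho) => [w| |] //.
  - by rewrite lte_fin => zw _; exists w; rewrite ?lte_fin ?lexx.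
  - by move=> _ _; exists (z + 1); rewrite ?lte_fin ?ltrDl// leey.
move: bs; rewrite lte_pdivrMr// -EFinM => bs.
have [w [r /andP[r0 rrho] [hw w0 _ hI]]] := slicing rho0 (@ltr01 R) bs.
have wout y : ~ oball d x rho y -> w y = 0.
  by move=> hy; apply: w0 => h; apply: hy; exact: le_lt_trans h rrho.
have hle : (infavg x rho <= avg mu (oball d x rho) (fun y => Lhat Sx L y (G y + nab w y)))%E.
  apply: ereal_inf_lbound; exists (w, nab w); last exact: erefl.
  exact: (inW0_Alg HS hw wout).
have := le_trans sa hle; apply/negP; rewrite -ltNge.
rewrite /avg lte_pdivrMl// (int_Lhat (mo x rho) (mmeas_Gnab hw)).
by rewrite muleC -EFinM.
Qed.

End RelaxedIntegrand.

Theorem mainTheorem4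
  (R : realType) (X : pseudoPMetricType R) (d : X -> X -> R)
  (mu : {measure set (borelT X) -> \bar R})
  (Alg : set (X -> R)) (N m : nat) (D : (X -> R) -> X -> 'rV[R]_N)
  (vk : nat -> X -> 'rV[R]_m)
  (L : X -> 'M[R]_(m, N) -> \bar R) (p : R) :
  (* (X,d) is a separable compact metric space, d inducing the topology of X *)
  (forall x y, 0 <= d x y) ->
  (forall x y, d x y = 0 <-> x = y) ->
  (forall x y, d x y = d y x) ->
  (forall x y z, d x z <= d x y + d y z) ->
  (forall (x : X) (e : R), 0 < e -> ball x e = oball d x e) ->
  compact [set: X] ->
  (exists S : set X, countable S /\ closure S = [set: X]) ->
  (* mu is a positive Radon (i.e. finite Borel) measure *)
  (mu [set: borelT X] < +oo)%E ->
  (* A(X): a unital subalgebra of C(X) with the Urysohn property *)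
  (forall f, Alg f -> continuous f) ->
  Alg (fun _ => 1) ->
  (forall f g, Alg f -> Alg g -> Alg (fun x => f x + g x)) ->
  (forall f g, Alg f -> Alg g -> Alg (fun x => f x * g x)) ->
  (forall (a : R) f, Alg f -> Alg (fun x => a * f x)) ->
  (forall K V : set X, compact K -> open V -> K `<=` V ->
     exists phi, Alg phi /\ (forall x, 0 <= phi x <= 1) /\
       (forall x, ~ V x -> phi x = 0) /\ (forall x, K x -> phi x = 1)) ->
  (* the derivation D : A(X) -> L^oo_mu(X;R^N) *)
  (0 < N)%N ->
  (forall f, Alg f ->
     (forall j, measurable_fun [set: borelT X] (fun x : borelT X => D f x ord0 j)) /\
     exists M : R, {ae mu, forall x : borelT X, fnorm (D f x) <= M}) ->
  (forall f g, Alg f -> Alg g ->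
     {ae mu, forall x : borelT X, D (fun y => f y + g y) x = D f x + D g x}) ->
  (forall (a : R) f, Alg f ->
     {ae mu, forall x : borelT X, D (fun y => a * f y) x = a *: D f x}) ->
  (forall f g, Alg f -> Alg g ->
     {ae mu, forall x : borelT X, D (fun y => f y * g y) x = f x *: D g x + g x *: D f x}) ->
  (forall f (K : set X) (c : R), Alg f -> Kclass d mu K -> (forall x, K x -> f x = c) ->
     {ae mu, forall x : borelT X, K x -> D f x = 0}) ->
  (* N^m_mu(x) = span{nabla v_k(x)} for mu-a.e. x *)
  (0 < m)%N ->
  normal_gen Alg mu D vk ->
  (* p in ]1,oo[ and the Caratheodory integrand L *)
  1 < p ->
  (forall x xi, (0 <= L x xi)%E) ->
  {ae mu, forall x : borelT X, continuous (L x)} ->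
  (forall xi : 'M[R]_(m, N), exists g : borelT X -> \bar R,
     measurable_fun [set: borelT X] g /\ {ae mu, forall x : borelT X, g x = L x xi}) ->
  (* growth conditions *)
  (exists C c : R, 0 < C /\ 0 < c /\
     forall xi, {ae mu, forall x : borelT X,
       ((C * fnorm xi `^ p)%:E <= L x xi <= (c * (1 + fnorm xi `^ p))%:E)%E}) ->
  (* (C0) *)
  (forall u G, inW Alg mu p D (spanAt D vk) u G ->
     forall A : set X, open A ->
       {ae mu, forall x : borelT X, A x -> u x = 0} ->
       {ae mu, forall x : borelT X, A x -> G x = 0}) ->
  (* (C1) *)
  (exists (K chi rho0 : R), 0 < K /\ 1 <= chi /\ 0 < rho0 /\
     forall (x : X) (rho : R), 0 < rho <= rho0 ->
     forall v G, inW0 Alg mu p D (spanAt D vk) (oball d x rho) v G ->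
       (poweR (\int[mu]_(y in oball d x rho) ((fnorm (v y)) `^ (chi * p))%:E)
              (1 / (chi * p))
        <= (rho * K)%:E *
           poweR (\int[mu]_(y in oball d x rho) ((fnorm (G y)) `^ p)%:E) (1 / p))%E) ->
  (* (C2) *)
  (forall (A : set X) (F : set (set X)),
     (forall B, F B -> exists (x : X) (r : R), 0 < r /\ B = cball d x r) ->
     (forall x, A x -> forall e : R, 0 < e -> exists r : R, 0 < r < e /\ F (cball d x r)) ->
     exists Gf : set (set X), Gf `<=` F /\ countable Gf /\ trivIset Gf id /\
       mu.-negligible (A `\` \bigcup_(B in Gf) B)) ->
  (* conclusion *)
  forall (u : X -> 'rV[R]_m) (G : X -> 'M[R]_(m, N)),
    inW Alg mu p D (spanAt D vk) u G ->
    {ae mu, forall x : borelT X, exists l : \bar R,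
      ((Ebar Alg mu p D L u (oball d x rho) * ((fine (mu (oball d x rho)))^-1)%:E)%E
         @[rho --> 0^'+] --> l)
      /\
      (ereal_inf [set avg mu (oball d x rho) (fun y => Lhat (spanAt D vk) L y (vG.2 y)) |
                  vG in [set vG : (X -> 'rV[R]_m) * (X -> 'M[R]_(m, N)) |
                         inW Alg mu p D (spanAt D vk) vG.1 vG.2 /\
                         inW0 Alg mu p D (spanAt D vk) (oball d x rho)
                           (fun y => vG.1 y - u y) (fun y => vG.2 y - G y)]]
         @[rho --> 0^'+] --> l)
      /\
      (ereal_inf [set avg mu (oball d x rho) (fun y => Lhat (spanAt D vk) L y (G y + wG.2 y)) |
                  wG in [set wG : (X -> 'rV[R]_m) * (X -> 'M[R]_(m, N)) |
                         inW0 Alg mu p D (spanAt D vk) (oball d x rho) wG.1 wG.2]]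
         @[rho --> 0^'+] --> l)}.
Proof.
move=> d0 deq dsym dtri dball cX _ muf hcont h1 hadd hmul hscale hury _ hDm hDa hDs hDM _ _ hgen p1
  L0 Lc Lm [C' [c' [C'0 [c'0 hgr]]]] hC0 [K [chi [rho0 [K0 [chi1 [rho00 hC1]]]]]] hC2 u G hW.
have HX : compact_metric d mu by split.
have H : diff_algebra d mu Alg D by split.
have HS : sobolev d mu Alg D vk p by split.
have [l [C [c HL]]] := caratheodory_ex p1 L0 Lc Lm (ex_intro _ C' (ex_intro _ c' (conj C'0 (conj c'0 hgr)))).
(* Pairs of rationals are countable, so one null set serves all of them. *)
have hosc : {ae mu, forall x : borelT X, forall s t : rat, 0 < (ratr s : R) < ratr t ->
    ~ oscillation (d := d) (mu := mu) (Alg := Alg) (D := D) (vk := vk) (p := p) (L := L) (l := l)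
       (u := u) (G := G) (ratr s) (ratr t) x}.
  have hn : {ae mu, forall x : borelT X, forall n : nat,
      if (unpickle n : option (rat * rat)) is Some q then 0 < (ratr q.1 : R) < ratr q.2 ->
      ~ oscillation (d := d) (mu := mu) (Alg := Alg) (D := D) (vk := vk) (p := p) (L := L) (l := l)
       (u := u) (G := G) (ratr q.1) (ratr q.2) x else True}.
    apply/ae_foralln => n; case: unpickle => [[s t]|]; last exact: aeW.
    have [st|st] := boolP (0 < (ratr s : R) < ratr t); last exact: aeW.
    have [B [mB B0 hB]] := oscillation_negligible HS HL L0 hW K0 chi1 hC1 rho00 hC2 st.
    exists B; split=> // x /= hx; apply: hB; apply: contrapT => hy; exact: hx.
  apply: filterS hn => x hx s t; have := hx (pickle (s, t)); by rewrite pickleK.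
apply: filterS (filterI (ae_supp HX) hosc) => x [[_ xN] hx].
have q0 rho : 0 < rho -> 0 < fine (mu (oball d x rho)).
  move=> r0; rewrite fine_gt0// (mu_fin_meas HX (meas_oball HX x rho)) andbT.
  rewrite lt0e measure_ge0 andbT; apply/eqP => mu0; apply: xN; by exists rho.
pose a := infavg (d := d) (mu := mu) (Alg := Alg) (D := D) (vk := vk) (p := p) (L := L) (G := G) x.
pose b rho := (Ebar Alg mu p D L u (oball d x rho) * ((fine (mu (oball d x rho)))^-1)%:E)%E.
have gap (s t : rat) : 0 < (ratr s : R) < ratr t ->
    ~ (frequently0 (fun r => (a r < (ratr s)%:E)%E) /\ frequently0 (fun r => ((ratr t)%:E < b r)%E)).
  move=> st [fa fb]; apply: (hx s t st); split=> //.
    move=> e e0; have [r r0 hr] := fa e e0; exists r => //.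
    have /andP[r_0 _] := r0.
    exact: (infavg_below HS HL L0 hW (q0 r r_0) hr).
  move=> e e0; have [r r0 hr] := fb e e0; exists r => //.
  have /andP[r_0 _] := r0.
  move: hr; rewrite lte_pdivlMr ?q0// fineK// (mu_fin_num HX (meas_oball HX x r)) //.
have a0 r : 0 < r -> (0 <= a r)%E by move=> _; exact: infavg_ge0.
have ab r : 0 < r -> (a r <= b r)%E by move=> r0; exact: (infavg_le_Ebar HS HL L0 hW r0 (q0 r r0)).
have [lim [ha hb]] := squeeze_cvg a0 ab gap.
exists lim; split; first exact: hb.
split; last exact: ha.
have -> : (fun rho => ereal_inf [set avg mu (oball d x rho) (fun y => Lhat (spanAt D vk) L y (vG.2 y)) |
                  vG in [set vG : (X -> 'rV[R]_m) * (X -> 'M[R]_(m, N)) |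
                         inW Alg mu p D (spanAt D vk) vG.1 vG.2 /\
                         inW0 Alg mu p D (spanAt D vk) (oball d x rho)
                           (fun y => vG.1 y - u y) (fun y => vG.2 y - G y)]]) =
  a; last exact: ha.
apply/funext => rho; congr ereal_inf.
exact: (affine_competitors HS hW (oball d x rho) (fun F => avg mu (oball d x rho) (fun y => Lhat (spanAt D vk) L y (F y)))).
Qed.
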